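(* Let $E$ be a real separable Banach space, and suppose that $\lambda$ and $M$ are (non-negative) Borel measures on $(0,\infty)$ and on $E\setminus\{0\}$, respectively, such that $$\int_{E\setminus\{0\}}\Big[\|x\|\int_0^{\|x\|^{-1}}t\,\lambda(dt)+\lambda(\{s:s>\|x\|^{-1}\})\Big]M(dx)=\int_0^\infty\Big[t\int_{\{0<\|x\|\le t^{-1}\}}\|x\|\,M(dx)+M(\{x:\|x\|>t^{-1}\})\Big]\lambda(dt)<\infty .$$ Then $M^{(\lambda)}$ and $M$ are Lévy spectral measures on $E$, and $\lambda$ is a Lévy spectral measure on $(0,\infty)$.
   Context: The $\lambda$-mixture of $M$ is the measure $M^{(\lambda)}(A):=\int_0^\infty\int_{E\setminus\{0\}}1_A(tx)\,M(dx)\,\lambda(dt)$ for Borel sets $A\subset E\setminus\{0\}$. A Borel measure $M$ on $E\setminus\{0\}$ is a Lévy spectral measure on $E$ if it is the third parameter in the Lévy–Khintchine representation of an infinitely divisible Borel probability measure on $E$, whose characteristic function is $$\exp\Big[i\langle y,a\rangle-\tfrac12\langle Ry,y\rangle+\int_{E\setminus\{0\}}\big(e^{i\langle y,x\rangle}-1-i\langle y,x\rangle1_{\{\|x\|\le1\}}(x)\big)M(dx)\Big],\quad y\in E',$$ where $E'$ is the dual space, $a\in E$ is a shift vector and $R$ is a Gaussian covariance operator. A Borel measure $\lambda$ on $(0,\infty)$ is a Lévy spectral measure iff $\int_0^\infty\min(1,t^2)\,\lambda(dt)<\infty$.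
   Formalization: Both λ and M are assumed nonzero; if λ = 0 (or M = 0) the integral condition reads 0 = 0 < ∞ for every choice of the other measure, which then need not be a Lévy spectral measure. *)

(* Defs.v *)
From HB Require Import structures.
From mathcomp Require Import all_boot all_order all_algebra.
From mathcomp Require Import all_classical all_reals all_analysis.
From mathcomp Require Import complex.

Set Implicit Arguments.
Unset Strict Implicit.
Unset Printing Implicit Defensive.

Import Order.TTheory GRing.Theory Num.Theory.
Import numFieldNormedType.Exports.

Local Open Scope classical_set_scope.
Local Open Scope ring_scope.
Local Open Scope complex_scope.

Notation borel T := (g_sigma_algebraType (@open T)).

Definition separable (T : topologicalType) : Prop :=
  exists2 S : set T, countable S & dense S.

Record dual (R : realType) (E : normedModType R) := Dual {
  dual_fun :> {linear E -> R^o} ;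
  dual_continuous : continuous dual_fun }.

Section complex_valued.
Context {R : realType}.

Definition cexp (z : R[i]) : R[i] :=
  (expR (complex.Re z) * cos (complex.Im z))
    +i* (expR (complex.Re z) * sin (complex.Im z)).

Context d (T : measurableType d).
Implicit Types (mu : {measure set T -> \bar R}) (f : T -> R[i]).

Definition cintegrable mu (D : set T) f : Prop :=
  mu.-integrable D (fun x => (complex.Re (f x))%:E) /\
  mu.-integrable D (fun x => (complex.Im (f x))%:E).

Definition cintegral mu (D : set T) f : R[i] :=
  (\int[mu]_(x in D) complex.Re (f x)) +i* (\int[mu]_(x in D) complex.Im (f x)).

End complex_valued.

Section levy_khintchine.
Context {R : realType} {E : completeNormedModType R}.
Implicit Types (mu : probability (borel E) R) (y z : dual E) (a : E).

Definition char_fun mu y : R[i] :=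
  cintegral mu setT (fun x : E => cexp (0 +i* y x)).

(* (m1 * m2)(A) = \int m2 (A - x) m1(dx), defined for arbitrary set functions
   so that it can be iterated; for probabilities on a separable space it is
   the law of the sum of two independent vectors. *)
Definition convolution (m1 m2 : set (borel E) -> \bar R) (A : set (borel E)) :
    \bar R :=
  (\int[m1]_x m2 [set y : E | A ((x : E) + y)%R])%E.

Definition conv_power (m : set (borel E) -> \bar R) (n : nat) :
    set (borel E) -> \bar R :=
  iter n (convolution m) (\d_((0 : E) : borel E)).

Definition infinitely_divisible mu : Prop :=
  forall n : nat, (0 < n)%N -> exists nu : probability (borel E) R,
    forall A : set (borel E), measurable A -> mu A = conv_power nu n A.

(* The centered normal law with standard deviation s; normal_prob is junk at
   s = 0, where the law has to be the Dirac mass at 0. *)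
Definition centered_normal (s : R) : set R -> \bar R :=
  if s == 0 then \d_(0 : R) else normal_prob 0 s.

Definition centered_gaussian mu : Prop :=
  forall y, exists s : R, forall A : set R, measurable A ->
    mu ([set x : E | A (y x)]) = centered_normal s A.

Definition gaussian_covariance (Q : dual E -> E) : Prop :=
  exists2 gamma : probability (borel E) R, centered_gaussian gamma &
    forall y z, (z (Q y))%:E = (\int[gamma]_x (y x * z x)%:E)%E.

Definition lk_integrand y (x : E) : R[i] :=
  cexp (0 +i* y x) - 1
    - (0 +i* (y x * \1_[set u : E | `|u| <= 1] x)).

Definition lk_exponent a (Q : dual E -> E)
    (M : {measure set (borel E) -> \bar R}) y : R[i] :=
  (- (2^-1 * y (Q y)) +i* y a) + cintegral M [set~ (0 : E)] (lk_integrand y).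

(* The integrability clause is needed because cintegral is total. *)
Definition lk_representation mu a (Q : dual E -> E)
    (M : {measure set (borel E) -> \bar R}) : Prop :=
  forall y, cintegrable M [set~ (0 : E)] (lk_integrand y) /\
            char_fun mu y = cexp (lk_exponent a Q M y).

(* A Borel measure on E \ {0} is encoded by a Borel measure on E that does not
   charge {0}.  The predicate is stated for a set function m, of which only the
   values on Borel subsets of E \ {0} matter; that m is a measure there is part
   of the claim. *)
Definition levy_spectral (m : set E -> \bar R) : Prop :=
  exists M : {measure set (borel E) -> \bar R},
    [/\ M [set (0 : E)] = 0%E,
        forall A : set (borel E), measurable A -> ~ A (0 : E) -> M A = m A &
        exists mu a (Q : dual E -> E),
          [/\ infinitely_divisible mu, gaussian_covariance Q &
              lk_representation mu a Q M]].

Definition mixture (lam : {measure set R -> \bar R})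
    (M : {measure set (borel E) -> \bar R}) (A : set E) : \bar R :=
  (\int[lam]_(t in `]0%R, +oo[)
     \int[M]_(x in [set~ (0%R : E)]) (\1_A (t *: (x : E))%R)%:E)%E.

End levy_khintchine.

(* lam, viewed as a measure on the Banach space R, is a spectral measure there;
   the integral condition is the classical criterion equivalent to this. *)
Definition levy_spectral_pos (R : realType) (lam : {measure set R -> \bar R}) :
    Prop :=
  [/\ lam `]-oo, 0]%classic = 0%E,
      levy_spectral (E := R^o) lam &
      (\int[lam]_(t in `]0%R, +oo[) (Num.min 1 (t ^+ 2))%R%:E < +oo)%E].

(* Main.v *)
Require Import Defs.
From HB Require Import structures.
From mathcomp Require Import all_boot all_order all_algebra.
From mathcomp Require Import all_classical all_reals all_analysis measurable_realfun.
From mathcomp Require Import complex ring lra.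

Import Order.TTheory GRing.Theory Num.Theory.
Import numFieldNormedType.Exports.

Set Implicit Arguments.
Unset Strict Implicit.
Unset Printing Implicit Defensive.

Local Open Scope classical_set_scope.
Local Open Scope ring_scope.

(** Truncation at the radius 1/t turns the inner expressions of the hypothesis
into a single integral ([truncated_integral]): for t > 0,
  t * int_{0 < |x| <= 1/t} |x| M(dx) + M{|x| > 1/t}
    = int_{x <> 0} min(1, t|x|) M(dx),
and likewise with the roles of lam and M exchanged.  The outer integral being
finite and lam nonzero, the inner one is finite for some t > 0, and changing t
only costs a factor: M integrates min(1,|x|).  Exchanging the roles, lam
integrates min(1,t).  Off the origin both measures are then sigma-finite, so
the mixture is the image of lam x M under (t,x) |-> tx, and its integral of
min(1,|x|) is the given double integral.  All three measures therefore
integrate min(1,|x|), and it remains to see that, on any separable Banach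
space, a measure N which does so is a spectral measure, with no Gaussian part
([levy_khintchine_exists]).

On a general Banach space the integrability of min(1,|x|^2) would be neither
sufficient nor necessary; what makes the stronger condition work without any
geometry of E is that the jumps need no centering.  Let N_k be the (finite)
restriction of N to |x| > 1/k and e(N_k) = exp(-N_k(E)) sum_n N_k^{*n} / n! its
compound Poisson law.  Passing from k to k+1 convolves with the compound Poisson
law of an annulus, and the subadditivity of min(1,|x|) gives
int min(1,|x|) de(A) <= int min(1,|x|) dA ([cpoisson_subadditive]).  So the
e(N_k) are the laws of the partial sums of a series of independent vectors X_k
with sum_k E min(1,|X_k|) finite; such a series converges almost surely, and the
law mu of its sum is the measure sought ([compound_weak_limit]).

The random walk is realised on [0,1[ with Lebesgue measure, without infinite
products: only the index of a nearby point of a dense sequence is recorded at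
each step, the laws of the resulting words of integers are consistent, and
consistent laws on words are realised by nested intervals
([tree_realization]).  The rounding errors are summable.

The law mu is then known through limits of integrals of equi-Lipschitz functions
([weak_limit]), a mode of convergence that is stable under convolution.
Applied to N/n, the construction gives the n-th convolution root of mu
([infinitely_divisible_limit]).  The characteristic function of e(N_k) is the
n-th power of that of e(N_k/n), which is 1 + (1/n) int (e^{iy} - 1) dN_k up to
O(1/n^2), hence it is the exponential of int (e^{iy} - 1) dN_k
([char_u_cpoisson]); dominated convergence passes to the limit in k
([weak_limit_char]).  The compensating term of the representation is y(a) where
a is the vector-valued integral of x over 0 < |x| <= 1 ([vector_mean_exists]). *)

(** * Borel measurability in separable normed spaces *)

Section borel_separable.
Context {R : realType}.

Definition dense_seq (E : normedModType R) (q : nat -> E) :=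
  forall (x : E) (e : R), 0 < e -> exists j, `|x - q j| < e.

Lemma separable_dense_seq (E : normedModType R) :
  separable E -> exists q : nat -> E, dense_seq q.
Proof.
case=> S cS dS.
have [s0 [_ Ss0]] : (setT `&` S) !=set0.
  by apply: dS; [exists 0|exact: openT].
have /pfcard_geP[S0|[f]] := cS; first by move: Ss0; rewrite S0.
exists f => x e e0.
have [y [/= xy Sy]] : (ball x e `&` S) !=set0.
  apply: dS; last exact: ball_open.
  by exists x; exact: ballxx.
have [j _ fj] := @surj _ _ _ _ f y Sy.
by exists j; rewrite fj; move: xy; rewrite -ball_normE.
Qed.

Lemma open_norm_ball (E : normedModType R) (a : E) r :
  open [set x : E | `|x - a| < r].
Proof.
suff -> : [set x : E | `|x - a| < r] = ball a r by exact: ball_open.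
by rewrite -ball_normE; apply/seteqP; split => x /=; rewrite distrC.
Qed.

Let ex_invS_lt (e : R) : 0 < e -> exists k : nat, k.+1%:R^-1 < e.
Proof.
move=> e0; exists (Num.trunc e^-1).
by rewrite -[ltRHS]invrK ltf_pV2 ?posrE ?invr_gt0// truncnS_gt.
Qed.

(** Every open set is a countable union of balls with centre in the dense
sequence and radius 1/(k+1), so preimages of balls suffice. *)
Lemma borel_measurable_fun d (T : measurableType d) (E : normedModType R)
    (q : nat -> E) (f : T -> E) : dense_seq q ->
  (forall j (r : R), measurable [set t | `|f t - q j| < r]) ->
  measurable_fun setT (f : T -> borel E).
Proof.
move=> dq mf; apply: (@measurability _ _ T (borel E) setT f (@open E)) => //.
move=> _ [U oU <-]; rewrite setTI.
rewrite (_ : _ @^-1` _ = \bigcup_p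
    (if `[< [set x : E | `|x - q p.1| < p.2.+1%:R^-1] `<=` U >]
     then [set t | `|f t - q p.1| < p.2.+1%:R^-1] else set0)).
  apply: countable_bigcupT_measurable => // -[j k].
  by case: asboolP => // _; exact: mf.
apply/seteqP; split => [t Uft|t [[j k] _ /=]]; last first.
  by case: asboolP => // sub /= h; apply: sub.
have /nbhs_ballP[e /= e0 sub] : nbhs (f t) U by exact: open_nbhs_nbhs.
have [k hk] := ex_invS_lt (divr_gt0 e0 (ltr0n R 2)).
have [j hj] := dq (f t) k.+1%:R^-1 ltac:(by rewrite invr_gt0).
exists (j, k) => //=; case: asboolP => // -[] x /= xj; apply: sub.
rewrite -ball_normE /=.
rewrite (_ : f t - x = (f t - q j) - (x - q j)); last first.
  by rewrite opprB addrA subrK.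
by rewrite (le_lt_trans (ler_normB _ _))// (splitr e) ltrD// (lt_trans _ hk).
Qed.

Lemma open_borel_measurable (E : normedModType R) (U : set E) : open U ->
  measurable (U : set (borel E)).
Proof. by move=> oU; exact: sub_sigma_algebra. Qed.

Lemma continuous_borel_measurable (E : normedModType R) (f : E -> R) :
  continuous f -> measurable_fun setT (f : borel E -> R).
Proof.
move=> cf; apply: (@measurability _ _ (borel E) R setT f (@RGenOInfty.G R)).
  exact: RGenOInfty.measurableE.
move=> _ [_ [a ->] <-]; rewrite setTI; apply: open_borel_measurable.
by move/continuousP: cf; apply; exact: interval_open.
Qed.

Lemma measurable_norm_borel (E : normedModType R) :
  measurable_fun setT ((fun x => `|x|) : borel E -> R).
Proof. by apply: continuous_borel_measurable; exact: norm_continuous. Qed.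

(** In a separable space the Borel sigma-algebra of the product is generated by
boxes, which is what makes the measurability of sums and of scalings follow from
their joint continuity. *)
Lemma measurable_continuous2 d (T : measurableType d)
    (E F G : normedModType R) (p : nat -> E) (q : nat -> F) (r : nat -> G)
    (op : E -> F -> G) (f : T -> E) (g : T -> F) :
  dense_seq p -> dense_seq q -> dense_seq r ->
  continuous (fun z : E * F => op z.1 z.2) ->
  measurable_fun setT (f : T -> borel E) ->
  measurable_fun setT (g : T -> borel F) ->
  measurable_fun setT ((fun t => op (f t) (g t)) : T -> borel G).
Proof.
move=> dp dq dr cont_op mf mg; apply: (borel_measurable_fun dr) => j s.
pose U := [set z : E * F | `|op z.1 z.2 - r j| < s].
have oU : open U.
  by move/continuousP : cont_op => /(_ _ (open_norm_ball (r j) s)).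
pose box i := [set z : E * F | `|z.1 - p i.1.1| < i.2.+1%:R^-1 /\
                          `|z.2 - q i.1.2| < i.2.+1%:R^-1].
rewrite (_ : [set t | _] = \bigcup_i (if `[< box i `<=` U >]
     then [set t | `|f t - p i.1.1| < i.2.+1%:R^-1] `&`
          [set t | `|g t - q i.1.2| < i.2.+1%:R^-1] else set0)).
  apply: countable_bigcupT_measurable => // -[[i1 i2] k].
  case: asboolP => // _; apply: measurableI.
    rewrite -[X in measurable X]setTI.
    exact: (mf measurableT _ (open_borel_measurable (open_norm_ball (p i1) _))).
  rewrite -[X in measurable X]setTI.
  exact: (mg measurableT _ (open_borel_measurable (open_norm_ball (q i2) _))).
apply/seteqP; split => [t Uft|t [[[i1 i2] k] _ /=]]; last first.
  by case: asboolP => // sub /= -[h1 h2]; apply: (sub (f t, g t)).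
have /nbhs_ballP[e /= e0 sub] : nbhs (f t, g t) U by exact: open_nbhs_nbhs.
have [k hk] := ex_invS_lt (divr_gt0 e0 (ltr0n R 2)).
have [i1 h1] := dp (f t) k.+1%:R^-1 ltac:(by rewrite invr_gt0).
have [i2 h2] := dq (g t) k.+1%:R^-1 ltac:(by rewrite invr_gt0).
exists (i1, i2, k) => //=; case: asboolP => // -[] [x y] /= [xj yj].
apply: sub; split; rewrite -ball_normE /=.
  rewrite (_ : f t - x = (f t - p i1) - (x - p i1)); last first.
    by rewrite opprB addrA subrK.
  by rewrite (le_lt_trans (ler_normB _ _))// (splitr e) ltrD// (lt_trans _ hk).
rewrite (_ : g t - y = (g t - q i2) - (y - q i2)); last first.
  by rewrite opprB addrA subrK.
by rewrite (le_lt_trans (ler_normB _ _))// (splitr e) ltrD// (lt_trans _ hk).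
Qed.

Lemma separable_real : separable R^o.
Proof.
exists (@ratr R @` setT); last exact: dense_rat.
by apply: card_le_trans (card_image_le _ _) _; exact: countableP.
Qed.

Lemma measurable_id_borel_real : measurable_fun setT (id : R -> borel R^o).
Proof.
apply: (@measurability _ _ R (borel R^o) setT id (@open R^o)) => //.
by move=> _ [U oU <-]; rewrite setTI; exact: open_measurable.
Qed.

End borel_separable.

(** * Convolution as an operator on nonnegative functions *)

(** The step of the binomial formula, for terms indexed by the two exponents. *)
Lemma pascal_sum (V : nmodType) (X : nat -> nat -> V) n :
  (\sum_(i < n.+1) X i.+1 (n - i)%N *+ 'C(n, i)) +
  (\sum_(i < n.+1) X i (n - i).+1 *+ 'C(n, i)) =
  \sum_(i < n.+2) X i (n.+1 - i)%N *+ 'C(n.+1, i).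
Proof.
rewrite [RHS]big_ord_recl /= bin0 subn0.
under [in RHS]eq_bigr do rewrite /bump /= add1n binS mulrnDr subSS.
rewrite big_split /= [RHS]addrA [RHS]addrC; congr (_ + _).
rewrite big_ord_recl /= bin0 subn0; congr (_ + _).
rewrite big_ord_recr /= bin_small// mulr0n addr0.
by apply: eq_bigr => i _; rewrite /bump add1n subnSK.
Qed.

Section convolution_operator.
Local Open Scope ereal_scope.
Context {R : realType} {E : normedModType R} (q : nat -> E) (dq : dense_seq q).
Notation BE := (borel E).

Lemma measurable_addE d (T : measurableType d) (f g : T -> E) :
  measurable_fun setT (f : T -> BE) -> measurable_fun setT (g : T -> BE) ->
  measurable_fun setT ((fun t => f t + g t)%R : T -> BE).
Proof.
apply: (@measurable_continuous2 R d T E E E q q q (fun x y => x + y)%R) => //.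
exact: add_continuous.
Qed.

Lemma measurable_shift (x : E) :
  measurable_fun setT ((fun z : E => (x + z)%R) : BE -> BE).
Proof. by apply: measurable_addE => //; exact: measurable_cst. Qed.

(** The adjoint of convolution by A.  Working with these operators rather
than with the convolved measures replaces the associativity and commutativity of
convolution by the composition of operators and Fubini's theorem. *)
Definition conv_op (A : set BE -> \bar R) (f : E -> \bar R) (x : E) : \bar R :=
  \int[A]_z f (x + (z : E))%R.

Definition nonneg_meas (f : E -> \bar R) :=
  measurable_fun setT (f : BE -> \bar R) /\ forall x, 0 <= f x.

Lemma nonneg_meas_shift f x : nonneg_meas f -> nonneg_meas (fun z => f (x + z)%R).
Proof.
move=> [mf f0]; split => // .
exact: (measurableT_comp mf (measurable_shift x)).
Qed.

Lemma nonneg_meas_sum (I : Type) (s : seq I) (f : I -> E -> \bar R) :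
  (forall i, nonneg_meas (f i)) -> nonneg_meas (fun x => \sum_(i <- s) f i x).
Proof.
move=> mf; split=> [|x]; last by apply: sume_ge0 => i _; have [] := mf i.
by apply: (@emeasurable_sum _ BE) => i; have [] := mf i.
Qed.

Lemma nonneg_measZ (k : R) f : (0 <= k)%R -> nonneg_meas f -> nonneg_meas (fun x => k%:E * f x).
Proof.
move=> k0 [mf f0]; split => [|x]; last by rewrite mule_ge0.
exact: measurable_funeM.
Qed.

Lemma nonneg_meas_nneseries (f : nat -> E -> \bar R) :
  (forall i, nonneg_meas (f i)) -> nonneg_meas (fun x => \sum_(i <oo) f i x).
Proof.
move=> mf; split=> [|x]; last by apply: nneseries_ge0 => i _ _; have [] := mf i.
apply: (@ge0_emeasurable_sum _ BE R setT (f : nat -> BE -> _) xpredT) => //.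
- by move=> k x _ _; have [] := mf k.
- by move=> k _; have [] := mf k.
Qed.

Section one_measure.
Variable A : {finite_measure set BE -> \bar R}.

Lemma nonneg_meas_conv_op f : nonneg_meas f -> nonneg_meas (conv_op A f).
Proof.
move=> [mf f0]; split=> [|x]; last exact: integral_ge0.
apply: (@measurable_fun_fubini_tonelli_F _ _ BE BE R A
  (fun p => f ((p.1 : E) + (p.2 : E))%R)) => //.
apply: (measurableT_comp mf).
by apply: measurable_addE; [exact: measurable_fst|exact: measurable_snd].
Qed.

Lemma nonneg_meas_iter_conv_op n f : nonneg_meas f -> nonneg_meas (iter n (conv_op A) f).
Proof. by move=> mf; elim: n => //= n IH; exact: nonneg_meas_conv_op. Qed.

Lemma conv_op_sum (I : Type) (s : seq I) (f : I -> E -> \bar R) x :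
  (forall i, nonneg_meas (f i)) ->
  conv_op A (fun y => \sum_(i <- s) f i y) x = \sum_(i <- s) conv_op A (f i) x.
Proof.
move=> mf; rewrite /conv_op (@ge0_integral_sum _ BE R A setT _ I
  (fun i (z : BE) => f i (x + (z : E))%R))//.
- by move=> i; have [] := nonneg_meas_shift x (mf i).
- by move=> i y _; have [_] := mf i; exact.
Qed.

Lemma conv_opZ (k : R) f x : (0 <= k)%R -> nonneg_meas f ->
  conv_op A (fun y => k%:E * f y) x = k%:E * conv_op A f x.
Proof.
move=> k0 mf; rewrite /conv_op (@ge0_integralZl _ BE R A setT _
  (fun z : BE => f (x + (z : E))%R))//.
- by have [] := nonneg_meas_shift x mf.
- by move=> y _; have [_] := mf; exact.
Qed.

Lemma conv_op_nneseries (f : nat -> E -> \bar R) x :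
  (forall i, nonneg_meas (f i)) ->
  conv_op A (fun y => \sum_(i <oo) f i y) x = \sum_(i <oo) conv_op A (f i) x.
Proof.
move=> mf; rewrite /conv_op (@integral_nneseries _ BE R A setT _
  (fun i (z : BE) => f i (x + (z : E))%R))//.
- by move=> i; have [] := nonneg_meas_shift x (mf i).
- by move=> i y _; have [_] := mf i; exact.
Qed.

Lemma conv_op_natmul f x n : nonneg_meas f ->
  conv_op A (fun y => (f y *+ n)%R) x = (conv_op A f x *+ n)%R.
Proof.
move=> mf.
have eqn (y : \bar R) : (y *+ n)%R = \sum_(i <- iota 0 n) y.
  by rewrite big_const_seq count_predT size_iota iter_addr_0.
rewrite eqn -conv_op_sum//; congr conv_op; apply/funext => y; exact: eqn.
Qed.

Lemma nonneg_meas_natmul f n : nonneg_meas f -> nonneg_meas (fun y => (f y *+ n)%R).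
Proof.
move=> mf.
have eqn (y : \bar R) : (y *+ n)%R = \sum_(i <- iota 0 n) y.
  by rewrite big_const_seq count_predT size_iota iter_addr_0.
by under eq_fun do rewrite eqn; exact: nonneg_meas_sum.
Qed.

Lemma iter_conv_opZ (k : R) f n : (0 <= k)%R -> nonneg_meas f ->
  iter n (conv_op A) (fun y => k%:E * f y) = (fun x => k%:E * iter n (conv_op A) f x).
Proof.
move=> k0 mf; elim: n => //= n ->; apply/funext => x.
by rewrite conv_opZ//; exact: nonneg_meas_iter_conv_op.
Qed.

Lemma iter_conv_op_nneseries (f : nat -> E -> \bar R) n :
  (forall i, nonneg_meas (f i)) ->
  iter n (conv_op A) (fun y => \sum_(i <oo) f i y) =
  (fun x => \sum_(i <oo) iter n (conv_op A) (f i) x).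
Proof.
move=> mf; elim: n => //= n ->; apply/funext => x.
by rewrite conv_op_nneseries// => i; exact: nonneg_meas_iter_conv_op.
Qed.

Lemma le_conv_op f g x : nonneg_meas f -> nonneg_meas g -> (forall y, f y <= g y) ->
  conv_op A f x <= conv_op A g x.
Proof.
move=> mf mg fg; apply: ge0_le_integral => //.
- by move=> y _; have [_] := mf; exact.
- by have [] := nonneg_meas_shift x mf.
- by have [] := nonneg_meas_shift x mg.
Qed.

End one_measure.

Lemma conv_opC (A B : {finite_measure set BE -> \bar R}) f : nonneg_meas f ->
  conv_op A (conv_op B f) = conv_op B (conv_op A f).
Proof.
move=> mf; apply/funext => x; rewrite /conv_op.
rewrite (@fubini_tonelli _ _ BE BE R A B
  (fun p => f (x + (p.1 : E) + (p.2 : E))%R))//.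
- by apply: eq_integral => y _; apply: eq_integral => z _; rewrite addrAC.
- have [mf' _] := mf; apply: (measurableT_comp mf').
  apply: measurable_addE; last exact: measurable_snd.
  by apply: measurable_addE; [exact: measurable_cst|exact: measurable_fst].
- by move=> p; have [_] := mf; exact.
Qed.

Lemma conv_op_iterC (A B : {finite_measure set BE -> \bar R}) n f : nonneg_meas f ->
  conv_op B (iter n (conv_op A) f) = iter n (conv_op A) (conv_op B f).
Proof.
move=> mf; elim: n => //= n <-; rewrite conv_opC//; exact: nonneg_meas_iter_conv_op.
Qed.

(** The binomial formula, valid because the operators of two finite measures
commute. *)
Lemma iter_conv_opD (A B S : {finite_measure set BE -> \bar R}) n f x :
  (forall U, measurable U -> S U = A U + B U) -> nonneg_meas f ->
  iter n (conv_op S) f x =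
  \sum_(i < n.+1) (iter i (conv_op A) (iter (n - i) (conv_op B) f) x *+ 'C(n, i))%R.
Proof.
move=> SAB mf; elim: n x => [|n IH] x; first by rewrite big_ord1 bin0 /=.
have conv_opS g y : nonneg_meas g -> conv_op S g y = conv_op A g y + conv_op B g y.
  move=> mg; rewrite /conv_op -ge0_integral_measure_add//.
  - by apply: eq_measure_integral => U mU _;
    exact: etrans (SAB U mU) (esym (measure_addE A B U)).
  - by move=> z _; have [_] := mg; exact.
  - by have [] := nonneg_meas_shift y mg.
have mX i j : nonneg_meas (iter i (conv_op A) (iter j (conv_op B) f)).
  by apply: nonneg_meas_iter_conv_op; exact: nonneg_meas_iter_conv_op.
rewrite iterS conv_opS; last exact: nonneg_meas_iter_conv_op.
have -> : iter n (conv_op S) f = fun y =>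
    \sum_(i < n.+1) (iter i (conv_op A) (iter (n - i) (conv_op B) f) y *+ 'C(n, i))%R.
  by apply/funext => y; exact: IH.
have mXC i : nonneg_meas (fun y => iter i (conv_op A) (iter (n - i) (conv_op B) f) y *+ 'C(n, i))%R.
  exact: nonneg_meas_natmul.
rewrite !conv_op_sum//.
rewrite -(pascal_sum (fun i j => iter i (conv_op A) (iter j (conv_op B) f) x)).
congr (_ + _); apply: eq_bigr => i _; rewrite conv_op_natmul// conv_op_iterC//.
exact: nonneg_meas_iter_conv_op.
Qed.

End convolution_operator.

(** * Compound Poisson laws *)

Section cauchy_product.
Local Open Scope ereal_scope.
Context {R : realType}.

(** Cauchy product: both sides sum a over pairs of indices, one of them by diagonals. *)
Lemma nneseries_cauchy (a : nat -> nat -> \bar R) : (forall i j, 0 <= a i j) ->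
  \sum_(n <oo) \sum_(i < n.+1) a i (n - i)%N = \sum_(i <oo) \sum_(j <oo) a i j.
Proof.
move=> a0; pose b n i := if (i <= n)%N then a i (n - i)%N else 0.
have b0 n i : 0 <= b n i by rewrite /b; case: ifP.
transitivity (\sum_(n <oo) \sum_(i <oo) b n i).
  apply: eq_eseriesr => n _; rewrite (nneseries_split 0 n.+1)//.
  rewrite add0n [X in _ + X]eseries0 ?adde0; last first.
    by move=> i ni _; rewrite /b leqNgt ni.
  by rewrite big_mkord; apply: eq_bigr => i _; rewrite /b -ltnS ltn_ord.
rewrite nneseries_interchange//; apply: eq_eseriesr => i _.
rewrite (nneseries_split 0 i)// add0n big_mkord big1 ?add0e; last first.
  by move=> k _; rewrite /b leqNgt ltn_ord.
rewrite -nneseries_addn//.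
by apply: eq_eseriesr => j _; rewrite /b leq_addl addnK.
Qed.

Lemma nneseries_exp (c : R) :
  \sum_(n <oo) (n`!%:R^-1 * c ^+ n)%:E = (expR c)%:E.
Proof.
rewrite expRE -EFin_lim; last first.
  rewrite /pseries/=; under eq_fun do rewrite mulrC.
  exact: is_cvg_series_exp_coeff.
by apply/congr_lim/funext => n/=; rewrite /pseries/= /series/= -sumEFin//.
Qed.

End cauchy_product.

Lemma ereal_natmul (R : realType) (x : \bar R) n :
  (x *+ n)%R = (n%:R%:E * x)%E.
Proof.
elim: n => [|n IH]; first by rewrite mulr0n mul0e.
by rewrite mulrS IH -natr1 EFinD ge0_muleDl// ?lee_fin// mul1e addrC.
Qed.

Section image_measures.
Local Open Scope ereal_scope.
Context d1 d2 (T1 : measurableType d1) (T2 : measurableType d2) (R : realType).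

(** A pushforward that keeps the measurability proof as an argument, so that
its measure structure can be inferred. *)
Definition image_measure (f : T1 -> T2) (mf : measurable_fun setT f)
  (m : set T1 -> \bar R) : set T2 -> \bar R := pushforward m f.

Variables (f : T1 -> T2) (mf : measurable_fun setT f).

Section measure.
Variable m : {measure set T1 -> \bar R}.

Let pm := measure_function_pushforward__canonical__measure_function_Measure m mf.

HB.instance Definition _ := isMeasure.Build _ _ _ (image_measure mf m)
  (measure0 pm) (measure_ge0 pm) (@measure_semi_sigma_additive _ _ _ pm).

Lemma ge0_integral_image (g : T2 -> \bar R) :
  measurable_fun setT g -> (forall x, 0 <= g x) ->
  \int[image_measure mf m]_x g x = \int[m]_x g (f x).
Proof.
move=> mg g0; rewrite (@ge0_integral_pushforward _ _ _ _ _ f mf m setT g)//.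
Qed.

End measure.

Section finite_measure.
Variable m : {finite_measure set T1 -> \bar R}.

Let image_finite : fin_num_fun (image_measure mf m).
Proof.
move=> U mU; apply: (fin_num_measure m).
by rewrite -[X in measurable X]setTI; exact: mf.
Qed.

HB.instance Definition _ :=
  Measure_isFinite.Build _ _ _ (image_measure mf m) image_finite.
End finite_measure.

Section probability.
Variable m : probability T1 R.

Let image_setT : image_measure mf m setT = 1.
Proof. exact: probability_setT. Qed.

HB.instance Definition _ :=
  Measure_isProbability.Build _ _ _ (image_measure mf m) image_setT.
End probability.

End image_measures.

Section compound_poisson.
Local Open Scope ereal_scope.
Context {R : realType} {E : normedModType R} (q : nat -> E) (dq : dense_seq q).
Notation BE := (borel E).

Lemma measurable_addp :
  measurable_fun setT ((fun p => ((p.1 : E) + (p.2 : E))%R) : BE * BE -> BE).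
Proof.
by apply: (measurable_addE dq); [exact: measurable_fst|exact: measurable_snd].
Qed.

Section convm.
Variables A B : {finite_measure set BE -> \bar R}.

Definition convm : set BE -> \bar R := image_measure measurable_addp (A \x B).

HB.instance Definition _ := Measure.copy convm
  (image_measure measurable_addp (A \x B)).

Let convm_finite : fin_num_fun convm.
Proof.
apply: lty_fin_num_fun; rewrite /= /convm /image_measure /pushforward preimage_setT.
rewrite -setXTT product_measure1E// lte_mul_pinfty//.
  by rewrite fin_num_measure.
by rewrite ltey_eq fin_num_measure.
Qed.

HB.instance Definition _ := Measure_isFinite.Build _ _ _ convm convm_finite.

Lemma integral_convm (f : E -> \bar R) : nonneg_meas f ->
  \int[convm]_x f x = \int[A]_x conv_op B f x.
Proof.
move=> [mf f0]; rewrite ge0_integral_image// fubini_tonelli1//.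
by apply: (measurableT_comp mf); exact: measurable_addp.
Qed.

End convm.

Variable A : {finite_measure set BE -> \bar R}.

Fixpoint conv_powm n : {finite_measure set BE -> \bar R} :=
  if n is n'.+1 then convm A (conv_powm n') else dirac ((0%R : E) : BE).

Lemma conv_op_conv_powm n (f : E -> \bar R) : nonneg_meas f ->
  conv_op (conv_powm n) f = iter n (conv_op A) f.
Proof.
move=> mf; elim: n => [|n IH]; apply/funext => x.
  rewrite /conv_op integral_dirac//; last by have [] := nonneg_meas_shift dq x mf.
  by rewrite diracT mul1e addr0.
rewrite iterS -IH /conv_op /= integral_convm; last exact: (nonneg_meas_shift dq).
apply: eq_integral => y _; rewrite /conv_op; apply: eq_integral => z _.
by rewrite addrA.
Qed.

Let inv_fact_ge0 n : (0 <= n`!%:R^-1 :> R)%R. Proof. by []. Qed.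

Definition mass : R := fine (A setT).

Let pois := mscale (NngNum (expR_ge0 (- mass)))
  (mseries (fun n => mscale (NngNum (inv_fact_ge0 n)) (conv_powm n)) 0).

(** The operator sum_n A^n / n!, for the convolution operator A. *)
Definition conv_exp (f : E -> \bar R) (x : E) : \bar R :=
  \sum_(n <oo) (n`!%:R^-1)%:E * iter n (conv_op A) f x.

Let conv_op_pois f x : nonneg_meas f -> conv_op pois f x = (expR (- mass))%:E * conv_exp f x.
Proof.
move=> mf; have [mfx fx0] := nonneg_meas_shift dq x mf.
rewrite /conv_op ge0_integral_mscale//= ge0_integral_measure_series//.
congr (_ * _); apply: eq_eseriesr => n _.
rewrite ge0_integral_mscale//=; congr (_ * _).
by rewrite -conv_op_conv_powm.
Qed.

Lemma massE : mass%:E = A setT.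
Proof. by rewrite /mass fineK// fin_num_measure. Qed.

Lemma mass_ge0 : (0 <= mass)%R.
Proof. by rewrite -lee_fin massE. Qed.

Lemma iter_conv_op_cst n (k : R) : iter n (conv_op A) (cst k%:E) = cst (k * mass ^+ n)%:E.
Proof.
elim: n => [|n /= ->]; first by rewrite expr0 mulr1.
apply/funext => x; rewrite /conv_op/= integral_cst//.
transitivity ((k * mass ^+ n)%:E * mass%:E); first by rewrite massE.
by rewrite -EFinM exprSr mulrA.
Qed.

Let pois_setT : pois setT = 1.
Proof.
rewrite -(mul1e (pois setT)) -(integral_cst pois measurableT 1).
have := @conv_op_pois (cst 1) 0%R; rewrite /conv_op => ->; last first.
  by split => // x; rewrite /= lee_fin.
rewrite /conv_exp; under eq_eseriesr => n _ do
  rewrite (iter_conv_op_cst n 1) /= mul1r -EFinM.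
by rewrite nneseries_exp -EFinM expRN mulVf// gt_eqF// expR_gt0.
Qed.

(** The compound Poisson law with jump measure A: the law of a sum of a
Poisson number of independent jumps. *)
Definition cpoisson : set BE -> \bar R := pois.

HB.instance Definition _ := Measure.copy cpoisson pois.
HB.instance Definition _ := Measure_isProbability.Build _ _ _ cpoisson pois_setT.

Lemma conv_op_cpoisson f x : nonneg_meas f ->
  conv_op cpoisson f x = (expR (- mass))%:E * conv_exp f x.
Proof. exact: conv_op_pois. Qed.

Lemma nonneg_meas_conv_exp f : nonneg_meas f -> nonneg_meas (conv_exp f).
Proof.
move=> mf; apply: nonneg_meas_nneseries => n; apply: nonneg_measZ => //.
exact: (nonneg_meas_iter_conv_op dq).
Qed.

End compound_poisson.

Section cpoisson_add.
Local Open Scope ereal_scope.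
Context {R : realType} {E : normedModType R} (q : nat -> E) (dq : dense_seq q).
Notation BE := (borel E).
Variables A B S : {finite_measure set BE -> \bar R}.
Hypothesis SAB : forall U, measurable U -> S U = A U + B U.

Lemma mass_add : mass S = (mass A + mass B)%R.
Proof.
by rewrite /mass (SAB measurableT) fineD// fin_num_measure.
Qed.

Lemma conv_exp_add f x : nonneg_meas f -> conv_exp S f x = conv_exp A (conv_exp B f) x.
Proof.
move=> mf; rewrite /conv_exp.
have mB j : nonneg_meas (iter j (conv_op B) f) by exact: (nonneg_meas_iter_conv_op dq).
have mwB j : nonneg_meas (fun y => (j`!%:R^-1)%:E * iter j (conv_op B) f y).
  exact: nonneg_measZ.
pose a i j := (i`!%:R^-1)%:E * ((j`!%:R^-1)%:E *
  iter i (conv_op A) (iter j (conv_op B) f) x).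
transitivity (\sum_(i <oo) \sum_(j <oo) a i j); last first.
  apply: eq_eseriesr => i _; rewrite (iter_conv_op_nneseries dq)//.
  rewrite -nneseriesZl//; last first.
    by move=> j _; have [_] := nonneg_meas_iter_conv_op dq A i (mwB j); exact.
  apply: eq_eseriesr => j _; rewrite /a (iter_conv_opZ dq)//.
rewrite -nneseries_cauchy; last first.
  move=> i j; rewrite /a !mule_ge0//.
  by have [_] := nonneg_meas_iter_conv_op dq A i (mB j); exact.
apply: eq_eseriesr => n _; rewrite (iter_conv_opD dq _ _ SAB mf).
rewrite ge0_sume_distrr; last first.
  move=> i _; have [_] := nonneg_meas_natmul 'C(n, i)
     (nonneg_meas_iter_conv_op dq A i (mB (n - i)%N)); exact.
apply: eq_bigr => i _; rewrite /a ereal_natmul !muleA -!EFinM; congr (_%:E * _).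
have ilen : (i <= n)%N by rewrite -ltnS.
rewrite -(bin_fact ilen) !natrM !invfM.
rewrite mulrAC mulVf ?mul1r//.
by rewrite pnatr_eq0 -lt0n bin_gt0.
Qed.

(** The functional equation of the exponential for commuting operators, by
the binomial formula and the Cauchy product. *)
Lemma cpoisson_add f : nonneg_meas f ->
  conv_op (cpoisson dq S) f = conv_op (cpoisson dq A) (conv_op (cpoisson dq B) f).
Proof.
move=> mf; apply/funext => x; rewrite !conv_op_cpoisson//; last first.
  exact: (nonneg_meas_conv_op dq).
have -> : conv_op (cpoisson dq B) f = fun y => (expR (- mass B))%:E * conv_exp B f y.
  by apply/funext => y; exact: conv_op_cpoisson.
rewrite conv_exp_add// mass_add opprD expRD EFinM -muleA; congr (_ * _).
have mX := nonneg_meas_conv_exp dq B mf.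
rewrite /conv_exp -nneseriesZl//; last first.
  move=> i _; rewrite mule_ge0//.
  by have [_] := nonneg_meas_iter_conv_op dq A i mX; exact.
apply: eq_eseriesr => i _; rewrite (iter_conv_opZ dq)// ?expR_ge0//.
by rewrite muleCA.
Qed.

End cpoisson_add.

Section cpoisson_bounds.
Local Open Scope ereal_scope.
Context {R : realType} {E : normedModType R} (q : nat -> E) (dq : dense_seq q).
Notation BE := (borel E).
Variables A : {finite_measure set BE -> \bar R}.

(** The terms n = 0 and n = 1 of the exponential series. *)
Lemma cpoisson_ge f : nonneg_meas f ->
  (expR (- mass A))%:E * (f 0%R + \int[A]_x f x) <= \int[cpoisson dq A]_x f x.
Proof.
move=> mf.
have -> : \int[cpoisson dq A]_x f x = conv_op (cpoisson dq A) f 0%R.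
  by apply: eq_integral => x _; rewrite add0r.
rewrite conv_op_cpoisson// lee_pmul2l ?lte_fin ?expR_gt0//.
rewrite /conv_exp (nneseries_split 0 2)//; last first.
  by move=> i _; rewrite mule_ge0//; have [_] := nonneg_meas_iter_conv_op dq A i mf; exact.
rewrite add0n big_mkord 2!big_ord_recl big_ord0 /= adde0 !invr1 !mul1e.
have -> : \int[A]_x f x = conv_op A f 0%R.
  by apply: eq_integral => x _; rewrite add0r.
rewrite leeDl// nneseries_ge0// => i _ _.
by rewrite mule_ge0//; have [_] := nonneg_meas_iter_conv_op dq A i mf; exact.
Qed.

(** A sum of n jumps has h at most the sum of the values of h at the
jumps; taking the mean over a Poisson number of jumps, of mean A(E), gives back
the integral of h against A. *)
Lemma cpoisson_subadditive (h : E -> R) :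
  measurable_fun setT (h : BE -> R) -> (forall x, 0 <= h x)%R -> h 0%R = 0%R ->
  (forall x y, h (x + y) <= h x + h y)%R ->
  \int[A]_x (h x)%:E < +oo ->
  \int[cpoisson dq A]_x (h x)%:E <= \int[A]_x (h x)%:E.
Proof.
move=> mh h0 h00 hD hfin.
have mhh : nonneg_meas (EFin \o h).
  by split; [exact/measurable_EFinP|move=> x /=; rewrite lee_fin].
set H := \int[A]_x (h x)%:E in hfin *.
have H0 : 0 <= H by apply: integral_ge0 => x _; rewrite lee_fin.
have Hf : H \is a fin_num by rewrite ge0_fin_numE.
pose c := mass A; have c0 : (0 <= c)%R := mass_ge0 A.
pose Hr := fine H; have HrE : Hr%:E = H by rewrite /Hr fineK.
have Hr0 : (0 <= Hr)%R by rewrite -lee_fin HrE.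
(* Subadditivity, n times: the n-th convolution power of A has mass c^n, and
   each of the n jumps contributes Hr times the mass c^(n-1) of the others. *)
have key n x : iter n (conv_op A) (EFin \o h) x <=
    (c ^+ n * h x + n%:R * c ^+ n.-1 * Hr)%:E.
  elim: n x => [|n IH] x; first by rewrite /= expr0 !mul0r mul1r addr0.
  pose a := (c ^+ n * h x + n%:R * c ^+ n.-1 * Hr)%R.
  have a0 : (0 <= a)%R.
    by rewrite addr_ge0// !mulr_ge0// exprn_ge0.
  have cn0 : (0 <= c ^+ n)%R by rewrite exprn_ge0.
  rewrite iterS.
  apply: (@le_trans _ _ (\int[A]_z (a%:E + (c ^+ n)%:E * (h z)%:E))).
    have [mi i0] := nonneg_meas_shift dq x (nonneg_meas_iter_conv_op dq A n mhh).
    apply: ge0_le_integral => //.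
    - apply: emeasurable_funD; first exact: measurable_cst.
      by apply: measurable_funeM; have [] := mhh.
    - move=> z _; apply: le_trans (IH _) _.
      rewrite -EFinM -EFinD lee_fin /a addrAC lerD2r -mulrDr.
      by rewrite ler_wpM2l.
  rewrite ge0_integralD//; last 2 first.
  - by move=> z _; rewrite mule_ge0// lee_fin.
  - by apply: measurable_funeM; have [] := mhh.
  rewrite ge0_integralZl//; last 2 first.
  - by have [] := mhh.
  - by move=> z _; rewrite lee_fin.
  rewrite integral_cst// -[\int[A]_x (h x)%:E]/H -HrE.
  have -> : a%:E * A setT = a%:E * c%:E by rewrite /c massE.
  rewrite -!EFinM -EFinD lee_fin /a le_eqVlt; apply/orP; left; apply/eqP.
  case: n {IH a a0 cn0} => [|n].
    by rewrite /= expr0 expr1; ring.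
  by rewrite /= -natr1 !exprS; ring.
have -> : \int[cpoisson dq A]_x (h x)%:E = conv_op (cpoisson dq A) (EFin \o h) 0%R.
  by apply: eq_integral => x _; rewrite add0r.
rewrite conv_op_cpoisson//.
apply: (@le_trans _ _ ((expR (- c))%:E *
    \sum_(n <oo) (n`!%:R^-1 * (n%:R * c ^+ n.-1 * Hr))%:E)).
  rewrite lee_pmul2l ?lte_fin ?expR_gt0//.
  apply: lee_nneseries => n _.
    move=> _; rewrite mule_ge0//; have [_] := nonneg_meas_iter_conv_op dq A n mhh; exact.
  rewrite EFinM lee_pmul2l ?lte_fin ?invr_gt0 ?ltr0n ?fact_gt0//.
  by apply: le_trans (key n _) _; rewrite h00 mulr0 add0r.
rewrite (nneseries_split 0 1)//; last first.
  by move=> n _; rewrite lee_fin !mulr_ge0// exprn_ge0.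
rewrite add0n big_mkord big_ord1 /= !mul0r mulr0 add0e.
rewrite -nneseries_addn//; last first.
  by move=> n; rewrite lee_fin !mulr_ge0// exprn_ge0.
rewrite (@eq_eseriesr R _ (fun n => Hr%:E * (n`!%:R^-1 * c ^+ n)%:E)); last first.
  move=> n _; rewrite addn1 factS natrM -EFinM; congr EFin.
  have f0 : (n`!%:R != 0 :> R)%R by rewrite pnatr_eq0 -lt0n fact_gt0.
  have n0 : (n.+1%:R != 0 :> R)%R by rewrite pnatr_eq0.
  by rewrite /= invfM; field; rewrite f0 nat1r n0.
rewrite nneseriesZl//; last first.
  by move=> n _; rewrite lee_fin mulr_ge0// exprn_ge0.
rewrite nneseries_exp muleCA -EFinM expRN mulVf ?mulr1 ?HrE//.
by rewrite gt_eqF// expR_gt0.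
Qed.

End cpoisson_bounds.

(** * Realising laws of words of integers by nested intervals *)

Section unit_lebesgue.
Context {R : realType}.

Definition unit_lebesgue : set (measurableTypeR R) -> \bar R :=
  mrestr (@lebesgue_measure R) (measurable_itv `[0%R, 1%R[).

HB.instance Definition _ := Measure.copy unit_lebesgue
  (mrestr (@lebesgue_measure R) (measurable_itv `[0%R, 1%R[)).

Let unit_lebesgue_setT : unit_lebesgue setT = 1%E.
Proof.
rewrite /unit_lebesgue /mrestr setTI.
by rewrite lebesgue_measure_itv /= lte_fin ltr01 -EFinD subr0.
Qed.

HB.instance Definition _ :=
  Measure_isProbability.Build _ _ _ unit_lebesgue unit_lebesgue_setT.

End unit_lebesgue.

Section interval_tree.
Context {R : realType} (F : seq nat -> R).
Hypothesis F0 : forall w, 0 <= F w.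
Hypothesis Fnil : F [::] = 1.
Hypothesis Fcons : forall w, (\sum_(a <oo) (F (a :: w))%:E)%E = (F w)%:E.

(** Left end of the interval attached to a word.  A word lists the most
recent letter first, and the children a :: w of w cut the interval of w into
consecutive pieces of lengths F (a :: w). *)
Fixpoint tree_left (w : seq nat) : R :=
  if w is a :: w' then tree_left w' + \sum_(0 <= b < a) F (b :: w') else 0.

Definition tree_itv (w : seq nat) (x : R) :=
  tree_left w <= x < tree_left w + F w.

Lemma tree_partial_sum w n : \sum_(0 <= b < n) F (b :: w) <= F w.
Proof.
rewrite -lee_fin -Fcons -sumEFin.
by apply: nneseries_lim_ge => // k _ _; rewrite lee_fin.
Qed.

Lemma tree_itv_child w x : tree_itv w x -> exists a, tree_itv (a :: w) x.
Proof.
move=> /andP[lx xr].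
have [n hn] : exists n, x - tree_left w < \sum_(0 <= b < n) F (b :: w).
  apply: contrapT => /forallNP hn; move: xr; apply/negP; rewrite -leNgt.
  rewrite addrC -lerBrDr -lee_fin -Fcons; apply: lime_le.
    by apply: is_cvg_nneseries => n _ _; rewrite lee_fin.
  apply: nearW => n; rewrite sumEFin lee_fin leNgt.
  by apply/negP; exact: hn.
elim: n hn => [|n IH].
  by rewrite big_geq// ltNge subr_ge0 lx.
rewrite big_nat_recr//= => hn.
have [/IH//|hn'] := ltP (x - tree_left w) (\sum_(0 <= b < n) F (b :: w)).
exists n; rewrite /tree_itv /= -addrA.
by rewrite -lerBrDl hn' /= -ltrBlDl.
Qed.

Lemma tree_itv_parent a w x : tree_itv (a :: w) x -> tree_itv w x.
Proof.
move=> /andP[/= lx xr]; apply/andP; split.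
  by apply: le_trans lx; rewrite lerDl sumr_ge0.
apply: lt_le_trans xr _; rewrite -addrA lerD2l.
by apply: le_trans (tree_partial_sum w a.+1); rewrite big_nat_recr.
Qed.

Lemma tree_itv_child_uniq a b w x :
  tree_itv (a :: w) x -> tree_itv (b :: w) x -> a = b.
Proof.
wlog ab : a b / (a <= b)%N => [H xa xb|].
  have [ab|/ltnW ba] := leqP a b; first exact: H.
  by apply/esym/H.
rewrite leq_eqVlt in ab; case/orP : ab => [/eqP//|ab].
move=> /andP[_ /= xr] /andP[/= lx _]; exfalso; move: (le_lt_trans lx xr).
apply/negP; rewrite -leNgt -addrA lerD2l.
rewrite [leRHS](big_cat_nat (n := a.+1))//= big_nat_recr//= lerDl.
by rewrite sumr_ge0.
Qed.

Fixpoint tree_word (x : R) n : seq nat :=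
  if n is n'.+1 then
    xget 0%N [set a | tree_itv (a :: tree_word x n') x] :: tree_word x n'
  else [::].

Lemma size_tree_word x n : size (tree_word x n) = n.
Proof. by elim: n => //= n ->. Qed.

Lemma tree_itv_word x n : tree_itv [::] x -> tree_itv (tree_word x n) x.
Proof.
move=> x0; elim: n => //= n IH.
have [a xa] := tree_itv_child IH.
by have /= := @xgetPex _ 0%N [set a | tree_itv (a :: tree_word x n) x]
  (ex_intro _ a xa).
Qed.

Lemma tree_wordP w x :
  tree_itv w x <-> tree_itv [::] x /\ tree_word x (size w) = w.
Proof.
split; last by case=> x0 <-; exact: tree_itv_word.
elim: w => [//|a w IH] xaw.
have [x0 xw] := IH (tree_itv_parent xaw); split => //=.
rewrite xw; congr (_ :: _); apply: (@tree_itv_child_uniq _ _ w x) => //.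
by have := @tree_itv_word x (size w).+1 x0; rewrite /= xw.
Qed.

(** A point of [0,1[ lies in exactly one interval of each generation, and
reading the words of these intervals gives a process in which each word extends
the previous one; the set where a word w is read is the interval of w, of
length F w. *)
Lemma tree_realization : exists D : R -> nat -> seq nat,
  [/\ forall x n, size (D x n) = n,
      forall x n, behead (D x n.+1) = D x n &
      forall w, measurable [set x | D x (size w) = w] /\
        unit_lebesgue [set x | D x (size w) = w] = (F w)%:E].
Proof.
(* Points outside [0,1[ form a null set; they are sent to 0 to make D total. *)
pose c x : R := if 0 <= x < 1 then x else 0.
have c01 x : tree_itv [::] (c x).
  by rewrite /tree_itv /= add0r Fnil /c; case: ifPn => // _; rewrite lexx ltr01.
exists (fun x => tree_word (c x)); split => [x n|//|w].
  exact: size_tree_word.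
pose I := `[tree_left w, tree_left w + F w[%classic.
have IE : [set x | tree_word (c x) (size w) = w] `&` `[0, 1[%classic = I.
  apply/seteqP; split => x /=.
    move=> [xw]; rewrite in_itv /= => x01.
    have cx : c x = x by rewrite /c x01.
    have : tree_itv w (c x) by apply/(tree_wordP w (c x)).
    by rewrite cx /I /= in_itv.
  rewrite /I /= in_itv /= => /(tree_wordP w x)[].
  rewrite {1}/tree_itv /= add0r Fnil => x01 xw.
  by rewrite /c in_itv /= x01.
have mI : measurable I by exact: measurable_itv.
have mA : measurable [set x | tree_word (c x) (size w) = w].
  rewrite -(setIT [set x | _]) -(setUv `[0, 1[%classic) setIUr IE; apply: measurableU => //.
  have [h|h] := pselect (tree_word (c 1) (size w) = w).
    rewrite (_ : _ `&` _ = ~` `[0, 1[%classic).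
      by apply: measurableC; exact: measurable_itv.
    apply/seteqP; split => [x /= []//|x /= xn]; split => //.
    move: h; rewrite /c ltxx andbF.
    by move/negP: xn; rewrite in_itv /= => /negbTE ->.
  rewrite (_ : _ `&` _ = set0)//.
  apply/seteqP; split => [x /= [xw xn]|//]; apply: h; move: xw.
  rewrite /c ltxx andbF.
  by move/negP: xn; rewrite in_itv /= => /negbTE ->.
split => //; rewrite /unit_lebesgue /mrestr IE /I.
rewrite lebesgue_measure_itv /= lte_fin ltrDl.
case: ltP => [_|Fw]; first by rewrite -EFinD addrAC subrr add0r.
by congr EFin; apply/esym/eqP; rewrite eq_le Fw F0.
Qed.

End interval_tree.

(** * A random walk rounded to words of integers *)

(** A copy of the type of integer sequences that carries the discrete
sigma-algebra. *)
Definition word := seq nat.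
HB.instance Definition _ := Countable.on word.
HB.instance Definition _ := isPointed.Build word [::].
HB.instance Definition _ := @isMeasurable.Build default_measure_display word
  discrete_measurable discrete_measurable0 discrete_measurableC
  discrete_measurableU.

Section words.
Context d (T : measurableType d).

Lemma measurable_fun_word (f : T -> word) :
  (forall w, measurable (f @^-1` [set w])) -> measurable_fun setT f.
Proof.
move=> mf _ U _; rewrite setTI.
rewrite (_ : f @^-1` U = \bigcup_(w : word)
    (if `[< U w >] then f @^-1` [set w] else set0)).
  apply: countable_bigcupT_measurable => [|w].
    exact: countableP.
  by case: asboolP.
apply/seteqP; split => [x Ufx|x [w _]] /=.
  by exists (f x) => //; case: asboolP.
by case: asboolP => // Uw /= ->.
Qed.

Lemma measurable_word_fun (g : word -> T) : measurable_fun setT g.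
Proof. by move=> _ U mU. Qed.

Lemma eq_word_measure (R : realType) (m1 m2 : {measure set word -> \bar R}) :
  (forall w, m1 [set w] = m2 [set w]) -> m1 = m2 :> (set word -> \bar R).
Proof.
move=> m12; apply/funext => U.
pose V n := [set w : word | pickle w = n /\ U w].
have UV : U = \bigcup_n V n.
  apply/seteqP; split => [w Uw|w [n _ []//]].
  by exists (pickle w).
have tV : trivIset setT V.
  by apply/trivIsetP => i j _ _ /eqP ij; apply/seteqP; split => // w [[+ _] [+ _]] => -> /ij.
rewrite UV !measure_semi_bigcup//.
apply: eq_eseriesr => n _; have [[w [wn Uw]]|V0] := pselect (V n !=set0).
  suff -> : V n = [set w] by exact: m12.
  apply/seteqP; split => [w' [w'n _]|_ ->//].
  by apply: (pcan_inj pickleK); rewrite w'n.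
have -> : V n = set0 by apply/seteqP; split => // w Vw; apply: V0; exists w.
by rewrite !measure0.
Qed.
End words.

Section nearest.
Context {R : realType} {E : normedModType R} (q : nat -> E) (dq : dense_seq q).

Definition nearest (e : {posnum R}) (x : E) : nat :=
  ex_minn (dq x (gt0 e)).

Lemma nearestP e x : `|x - q (nearest e x)| < e%:num.
Proof. by rewrite /nearest; case: ex_minnP. Qed.

Lemma measurable_nearest e a :
  measurable ([set x | nearest e x = a] : set (borel E)).
Proof.
pose B j := [set x : E | `|x - q j| < e%:num].
have mB j : measurable (B j : set (borel E)).
  by apply: open_borel_measurable; exact: open_norm_ball.
rewrite (_ : [set x | _] = B a `\` \bigcup_(j in [set j | (j < a)%N]) B j).
  by apply: measurableD => //; exact: bigcup_measurable.
apply/seteqP; split => x /=.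
  move=> <-; split; first exact: nearestP.
  case=> j /= ja Bj; move: ja; apply/negP; rewrite -leqNgt.
  by rewrite /nearest; case: ex_minnP => m _; apply.
case=> Ba nB; apply/eqP; rewrite eqn_leq; apply/andP; split.
  by rewrite /nearest; case: ex_minnP => m _; apply.
rewrite leqNgt; apply/negP => na; apply: nB; exists (nearest e x) => //.
exact: nearestP.
Qed.

End nearest.

Section random_walk_words.
Local Open Scope ereal_scope.
Context {R : realType} {E : normedModType R} (q : nat -> E) (dq : dense_seq q).
Notation BE := (borel E).
Variables (e : nat -> {posnum R}) (rho : nat -> probability BE R).

Let code n (x : E) : nat := nearest dq (e n) x.

(** One step of the walk, from a state made of the word of past roundings and
the current position. *)
Definition word_step n (p : (word * BE) * BE) : word * BE :=
  (code n ((p.1.2 : E) + (p.2 : E))%R :: p.1.1, ((p.1.2 : E) + (p.2 : E))%R).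

Lemma measurable_word_step n : measurable_fun setT (word_step n).
Proof.
have msum : measurable_fun setT ((fun p => (p.1.2 : E) + (p.2 : E))%R :
    (word * BE) * BE -> BE).
  apply: (measurable_addE dq); last exact: measurable_snd.
  exact: (measurableT_comp measurable_snd measurable_fst).
have mw : measurable_fun setT (fun p : (word * BE) * BE => p.1.1).
  exact: (measurableT_comp measurable_fst measurable_fst).
apply: measurable_fun_pair => //; apply: measurable_fun_word => -[|a w].
  by rewrite (_ : _ @^-1` _ = set0)//; apply/seteqP; split.
rewrite (_ : _ @^-1` _ =
    ((fun p : (word * BE) * BE => ((p.1.2 : E) + (p.2 : E))%R) @^-1`
       [set x | code n x = a]) `&` ((fun p => p.1.1) @^-1` [set w])).
  apply: measurableI.
    rewrite -[X in measurable X]setTI.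
    exact: (msum measurableT _ (measurable_nearest dq (e n) a)).
  rewrite -[X in measurable X]setTI; exact: (mw measurableT).
by apply/seteqP; split => p /= [-> ->].
Qed.

Fixpoint walk_law n : probability (word * BE)%type R :=
  if n is n'.+1 then
    image_measure (measurable_word_step n') (walk_law n' \x rho n')
  else dirac (([::] : word), ((0%R : E) : BE)).

Lemma integral_walk_law n (G : word * BE -> \bar R) :
  measurable_fun setT G -> (forall u, 0 <= G u) ->
  \int[walk_law n.+1]_u G u = \int[walk_law n]_u \int[rho n]_z
    G (code n ((u.2 : E) + (z : E))%R :: u.1, ((u.2 : E) + (z : E))%R).
Proof.
move=> mG G0; rewrite /= ge0_integral_image// fubini_tonelli1//.
by apply: (measurableT_comp mG); exact: measurable_word_step.
Qed.

Definition word_weight (w : word) : R :=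
  fine (walk_law (size w) ([set w] `*` setT)).

Let mX (U : set word) : measurable (U `*` setT : set (word * BE)).
Proof. by apply: measurableX. Qed.

Lemma word_weightE w :
  (word_weight w)%:E = walk_law (size w) ([set w] `*` setT).
Proof. by rewrite /word_weight fineK// fin_num_measure. Qed.

Lemma word_weight_nil : word_weight [::] = 1%R.
Proof.
apply: EFin_inj; rewrite word_weightE /= diracE.
by rewrite mem_set.
Qed.

Lemma walk_law_cons n (U V : set word) :
  (forall a w, U (a :: w) <-> V w) ->
  walk_law n.+1 (U `*` setT) = walk_law n (V `*` setT).
Proof.
move=> UV; rewrite /= /image_measure /pushforward.
rewrite (_ : _ @^-1` _ = (V `*` setT) `*` setT).
  rewrite product_measure1E//.
  by rewrite [X in _ * X]probability_setT mule1.
apply/seteqP; split => -[[w x] z] /=.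
  by case=> /UV.
by case=> -[Vw _] _; split => //; apply/UV.
Qed.

(** The consistency condition of an interval tree: summing over the most
recent letter forgets the last step. *)
Lemma word_weight_cons w :
  \sum_(a <oo) (word_weight (a :: w))%:E = (word_weight w)%:E.
Proof.
rewrite word_weightE.
rewrite -(@walk_law_cons _ (\bigcup_a [set a :: w])); last first.
  by move=> a v; split => [[b _ [_ ->]]//|->]; exists a.
rewrite (_ : _ `*` _ = \bigcup_a ([set a :: w] `*` setT)); last first.
  apply/seteqP; split => -[v x] /= => [[[a _ va] _]|[a _ [va _]]].
    by exists a.
  by split => //; exists a.
rewrite measure_semi_bigcup//; last 2 first.
- apply/trivIsetP => i j _ _ /eqP ij; apply/seteqP; split => //.
  by move=> -[v x] /= [[+ _] [+ _]] => -> [] /ij.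
- by apply: bigcup_measurable.
by apply: eq_eseriesr => a _; rewrite word_weightE.
Qed.

Lemma walk_law_size n : walk_law n ([set w | size w != n] `*` setT) = 0.
Proof.
elim: n => [|n IH].
  by rewrite /= diracE memNset// => -[].
by rewrite -IH; apply: walk_law_cons => // a w /=; rewrite eqSS.
Qed.

End random_walk_words.

(** * Almost sure convergence of vector series *)

Section almost_sure_limit.
Context d (T : measurableType d) {R : realType} {E : completeNormedModType R}.
Variables (q : nat -> E) (dq : dense_seq q).
Notation BE := (borel E).

Lemma measurable_norm_sub (f : T -> E) (a : E) :
  measurable_fun setT (f : T -> BE) -> measurable_fun setT (fun t => `|f t - a|).
Proof.
move=> mf.
have m1 : measurable_fun setT ((fun x : E => `|x - a|) : BE -> R).
  apply: continuous_borel_measurable => x.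
  by apply: cvg_norm; apply: cvgB; [exact: cvg_id|exact: cvg_cst].
exact: (measurableT_comp m1 mf).
Qed.

Lemma measurable_dist (f g : T -> E) :
  measurable_fun setT (f : T -> BE) -> measurable_fun setT (g : T -> BE) ->
  measurable_fun setT (fun t => `|f t - g t|).
Proof.
move=> mf mg.
have mfg : measurable_fun setT ((fun t => f t - g t) : T -> BE).
  apply: (@measurable_continuous2 R d T E E E q q q (fun x y => x - y)) => //.
  exact: sub_continuous.
exact: (measurableT_comp (@measurable_norm_borel R E) mfg).
Qed.

(** The terms of the series tend to 0, so the truncation at 1 is eventually
inactive and the increments are absolutely summable. *)
Lemma cvg_min1_series (y : nat -> E) :
  (\sum_(k <oo) (Num.min 1 `|y k.+1 - y k|)%:E < +oo)%E -> cvgn y.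
Proof.
set m := fun k => Num.min 1 `|y k.+1 - y k|.
have m0 k : 0 <= m k by rewrite le_min ler01 normr_ge0.
move=> mfin.
have cm : cvgn (series m).
  apply: nondecreasing_is_cvgn; first exact: nondecreasing_series.
  exists (fine (\sum_(k <oo) (m k)%:E)) => _ [n _ <-].
  rewrite -lee_fin fineK; last first.
    by rewrite ge0_fin_numE// nneseries_ge0// => k _ _; rewrite lee_fin.
  rewrite /series /= -sumEFin; apply: nneseries_lim_ge => k _ _.
  by rewrite lee_fin.
have [N _ mN] : \forall k \near \oo, m k < 1.
  have /cvgrPdist_lt/(_ 1 ltr01) := cvg_series_cvg_0 cm.
  by apply: filterS => k; rewrite sub0r normrN ger0_norm.
have : cvgn [normed series (telescope y)].
  rewrite -(is_cvg_series_restrict N).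
  rewrite -(is_cvg_series_restrict N) in cm.
  rewrite (_ : (fun n => _) = [sequence \sum_(N <= k < n) m k]_n)//.
  apply/funext => n /=; apply: eq_big_nat => k /andP[Nk _].
  have := mN k Nk; rewrite /m /telescope /=.
  by case: (lerP 1 `|y k.+1 - y k|) => // _; rewrite ltxx.
move/normed_cvg; rewrite telescopeK => cy.
have -> : y = (fun n => (y n - y 0%N) + y 0%N) by apply/funext => n; rewrite subrK.
by apply: is_cvgD => //; exact: is_cvg_cst.
Qed.

(** The sum of the truncated increments has a finite integral, hence is
finite almost everywhere, and there the sequence converges. *)
Lemma ae_cvg_limit (P : probability T R) (Y : nat -> T -> E) :
  (forall k, measurable_fun setT (Y k : T -> BE)) ->
  (\sum_(k <oo) \int[P]_x (Num.min 1 `|Y k.+1 x - Y k x|)%:E < +oo)%E ->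
  exists2 Z : T -> E, measurable_fun setT (Z : T -> BE) &
    {ae P, forall x, Y k x @[k --> \oo] --> Z x}.
Proof.
move=> mY.
pose m k x := (Num.min 1 `|Y k.+1 x - Y k x|)%:E.
have m0 k x : (0 <= m k x)%E by rewrite lee_fin le_min ler01 normr_ge0.
have mm k : measurable_fun setT (m k).
  apply/measurable_EFinP; apply: measurable_minr; first exact: measurable_cst.
  exact: measurable_dist.
rewrite -integral_nneseries//.
pose S x := (\sum_(k <oo) m k x)%E.
have S0 x : (0 <= S x)%E by exact: nneseries_ge0.
have mS : measurable_fun setT S.
  exact: (@ge0_emeasurable_sum _ T R setT m xpredT).
move=> Sfin.
have iS : P.-integrable setT S.
  apply/integrableP; split => //.
  by under eq_integral do rewrite gee0_abs//.
pose G := [set x | S x \is a fin_num].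
have mG : measurable G.
  by rewrite -[X in measurable X]setTI; exact: emeasurable_fin_num.
(* Modifying Y on a null set makes it converge everywhere, so that the limit is
   measurable. *)
pose Y' k x := if S x \is a fin_num then Y k x else 0.
have mY' k : measurable_fun setT (Y' k : T -> BE).
  apply: (@measurable_fun_ifT _ _ T BE (Y k) (fun=> (0 : E))
    (fun x => S x \is a fin_num)) => //.
  by apply: (measurable_fun_bool true); rewrite setTI.
have cY' x : cvgn (Y' ^~ x).
  have -> : Y' ^~ x = if S x \is a fin_num then Y ^~ x else cst 0.
    by apply/funext => k; rewrite /Y'; case: ifP.
  case: ifPn => [Sx|_]; last exact: is_cvg_cst.
  apply: cvg_min1_series; rewrite ltey_eq.
  by move: Sx; rewrite /S /m => ->.
exists (fun x => limn (Y' ^~ x)).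
  apply: (borel_measurable_fun dq) => j r.
  have md : measurable_fun setT (fun t => `|limn (Y' ^~ t) - q j|).
    apply: (measurable_fun_cvg (h := fun k t => `|Y' k t - q j|)).
      by move=> k; exact: measurable_norm_sub.
    move=> x _; apply: cvg_norm; apply: cvgB; last exact: cvg_cst.
    exact: cY'.
  rewrite -[X in measurable X]setTI.
  rewrite (_ : [set t | _] = (fun t => `|limn (Y' ^~ t) - q j|) @^-1` `]-oo, r[%classic).
    by apply: md.
  by apply/seteqP; split => t /=; rewrite in_itv.
have := integrable_ae measurableT iS; apply: filterS => x /(_ I) Sx.
have := cY' x; rewrite (_ : Y' ^~ x = Y ^~ x)//.
by apply/funext => k; rewrite /Y' Sx.
Qed.

End almost_sure_limit.

(** * Weak limits of a random walk with summable steps *)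

Section weak_limits.
Local Open Scope ereal_scope.
Context {R : realType} {E : completeNormedModType R}.
Variables (q : nat -> E) (dq : dense_seq q).
Notation BE := (borel E).

Definition lip (L : R) (f : E -> R) :=
  forall x y, (`|f x - f y| <= L * `|x - y|)%R.

(** Letting the test function vary with k is what makes this convergence
stable under convolution, see [weak_limit_iter_conv_op]. *)
Definition weak_limit (al : nat -> probability BE R) (a : probability BE R) :=
  forall (L : R) (f_ : nat -> E -> R) (f : E -> R),
  (forall k x, 0 <= f_ k x <= 1)%R -> (forall k, lip L (f_ k)) ->
  (forall x, f_ k x @[k --> \oo] --> f x) ->
  \int[al k]_x (f_ k x)%:E @[k --> \oo] --> \int[a]_x (f x)%:E.

Lemma lip_measurable L f : lip L f -> measurable_fun setT (f : BE -> R).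
Proof.
move=> fL; apply: continuous_borel_measurable => x.
apply/cvgrPdist_lt => e e0; near=> y.
apply: le_lt_trans (fL _ _) _.
have L1 : (0 < `|L| + 1)%R by rewrite ltr_wpDl.
apply: (@le_lt_trans _ _ ((`|L| + 1) * `|x - y|)%R).
  by rewrite ler_wpM2r// (le_trans (ler_norm _))// lerDl.
rewrite mulrC -ltr_pdivlMr//.
by near: y; apply: cvgr_dist_lt; rewrite ?divr_gt0.
Unshelve. all: by end_near. Qed.

Lemma nonneg_meas_lip L f : lip L f -> (forall x, 0 <= f x)%R -> nonneg_meas (EFin \o f).
Proof.
move=> fL f0; split => [|x]; last by rewrite /= lee_fin.
by apply/measurable_EFinP; exact: lip_measurable fL.
Qed.

Variable rho : nat -> probability BE R.
Variable mu : nat -> probability BE R.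
Hypothesis mu0 : forall f, nonneg_meas f -> \int[mu 0%N]_x f x = f 0%R.
Hypothesis muS : forall n f, nonneg_meas f ->
  \int[mu n.+1]_x f x = \int[mu n]_x conv_op (rho n) f x.
Hypothesis rho_fin :
  \sum_(k <oo) \int[rho k]_z (Num.min 1 `|z : E|)%:E < +oo.

Let half_pow_gt0 n : (0 < (2 ^ n.+1)%:R^-1 :> R)%R.
Proof. by rewrite invr_gt0 ltr0n expn_gt0. Qed.
Let e n := PosNum (half_pow_gt0 n).
Let P := walk_law dq e rho.

Let walk_marginal n f : nonneg_meas f -> \int[P n]_u f u.2 = \int[mu n]_x f x.
Proof.
elim: n f => [|n IH] f mf.
  rewrite mu0// /P /= integral_dirac ?diracT ?mul1e//.
  by have [mf' _] := mf; exact: (measurableT_comp mf' measurable_snd).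
have mf2 : measurable_fun setT (fun u : word * BE => f u.2).
  by have [mf' _] := mf; exact: (measurableT_comp mf' measurable_snd).
rewrite [P]lock -lock /P integral_walk_law//; last first.
  by move=> u; have [_] := mf; exact.
by rewrite muS// -IH//; exact: (nonneg_meas_conv_op dq).
Qed.

(** Only the words are realised on [0,1[: they take countably many values,
so their joint law is that of an interval tree. *)
Let walk_realization : exists D : R -> nat -> word,
  [/\ forall x n, behead (D x n.+1) = D x n,
      forall n, measurable_fun setT (fun x : measurableTypeR R => D x n) &
      forall n (h : word -> \bar R), (forall w, 0 <= h w) ->
        \int[unit_lebesgue]_x h (D x n) = \int[P n]_u h u.1].
Proof.
have [D [Dsize Dbehead DF]] := tree_realization
  (fun w => fine_ge0 (measure_ge0 (P (size w)) ([set w] `*` setT)))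
  (word_weight_nil dq e rho) (word_weight_cons dq e rho).
have Dn n w : size w != n -> (fun x => D x n) @^-1` [set w] = set0.
  move=> wn; apply/seteqP; split => // x /= xw; move: wn.
  by rewrite -xw Dsize eqxx.
have mD n : measurable_fun setT (fun x : measurableTypeR R => (D x n : word)).
  apply: measurable_fun_word => w.
  have [<-|/Dn ->//] := eqVneq (size w) n.
  exact: (DF w).1.
exists D; split => // n h h0.
have mh : measurable_fun setT h by exact: measurable_word_fun.
rewrite -(ge0_integral_image (mD n))//.
rewrite -(ge0_integral_image (@measurable_fst _ _ word BE) (P n))//.
apply: eq_measure_integral => U _ _; congr (_ U); apply: eq_word_measure => w.
rewrite /image_measure /pushforward.
have fstE V : fst @^-1` V = V `*` setT :> set (word * BE).
  by apply/seteqP; split => -[v x] //= -[].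
transitivity (P n ([set w] `*` setT)); last by rewrite -fstE.
have [<-|wn] := eqVneq (size w) n.
  by apply: etrans (DF w).2 _; rewrite -word_weightE.
transitivity (@unit_lebesgue R set0).
  by congr unit_lebesgue; exact: Dn.
rewrite measure0; apply/esym.
apply: subset_measure0 (walk_law_size dq e rho n).
- by apply: measurableX.
- by apply: measurableX.
- by move=> [v x] /= [-> _].
Qed.

(** The rounded position is the point of the dense sequence named by the most
recent letter of the word. *)
Let point (w : word) : E := q (head 0%N w).

Let mpoint : measurable_fun setT (point : word -> BE).
Proof. exact: measurable_word_fun. Qed.

Let walk_close n :
  {ae P n.+1, forall u, (`|(u.2 : E) - point u.1| < (e n)%:num)%R}.
Proof.
pose B := [set u : word * BE | ~ (`|(u.2 : E) - point u.1| < (e n)%:num)%R].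
have md : measurable_fun setT (fun u : word * BE => `|(u.2 : E) - point u.1|%R).
  apply: (measurable_dist dq); first exact: measurable_snd.
  exact: (measurableT_comp mpoint measurable_fst).
have mB : measurable B.
  rewrite (_ : B = ~` ((fun u : word * BE => `|(u.2 : E) - point u.1|%R) @^-1`
      `]-oo, (e n)%:num[%classic)).
    by apply: measurableC; rewrite -[X in measurable X]setTI; exact: md.
  by apply/seteqP; split => u /=; rewrite in_itv.
exists B; split => //.
transitivity ((P n \x rho n) set0); last exact: measure0.
rewrite /P /= {1}/image_measure /pushforward; congr (_ _).
apply/seteqP; split => // p /=; apply.
exact: (nearestP dq (e n) ((p.1.2 : E) + (p.2 : E))%R).
Qed.

Let jump (k : nat) (w : word) : R := Num.min 1%R `|point w - point (behead w)|%R.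

(** The increment of the rounded walk differs from the step of the walk by two
rounding errors, each at most 2^-(k+1). *)
Let jump_integral k :
  \int[P k.+2]_u (jump k u.1)%:E <=
  \int[rho k.+1]_z (Num.min 1 `|z : E|)%:E + (2 / (2 ^ k.+1)%:R)%:E.
Proof.
have j0 w : (0 <= jump k w)%R by rewrite le_min ler01 normr_ge0.
have mj : measurable_fun setT (jump k : word -> R).
  exact: measurable_word_fun.
have mG : measurable_fun setT (fun u : word * BE => (jump k u.1)%:E).
  apply/measurable_EFinP; exact: (measurableT_comp mj measurable_fst).
have mmin : nonneg_meas (fun z : E => (Num.min 1 `|z|)%:E).
  split => [|x]; last by rewrite lee_fin le_min ler01 normr_ge0.
  apply/measurable_EFinP; apply: measurable_minr; first exact: measurable_cst.
  exact: measurable_norm_borel.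
rewrite /P integral_walk_law//; last by move=> u; rewrite lee_fin.
set c := \int[rho k.+1]_z _; set c2 := (2 / _)%:E.
have c0 : 0 <= c by apply: integral_ge0 => x _; have [_] := mmin; exact.
have c20 : 0 <= c2 by rewrite lee_fin divr_ge0.
have -> : c + c2 = \int[P k.+1]_u cst (c + c2) u.
  by rewrite integral_cst// [X in _ * X]probability_setT mule1.
apply: ae_ge0_le_integral => //.
- by move=> u _; apply: integral_ge0 => z _; rewrite lee_fin.
- apply: (@measurable_fun_fubini_tonelli_F _ _ _ _ _ (rho k.+1)
    (fun p => (jump k (word_step dq e k.+1 p).1)%:E)) => //.
    by apply: (measurableT_comp mG); exact: measurable_word_step.
  by move=> p; rewrite lee_fin.
- by move=> u _; rewrite /cst adde_ge0.
have [N [mN N0 subN]] := walk_close k; exists N; split => //.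
apply: subset_trans subN => u /= ncl hu; apply: ncl => _.
apply: (@le_trans _ _ (\int[rho k.+1]_z ((Num.min 1 `|z : E|)%:E + c2))); last first.
  rewrite ge0_integralD//; last by have [] := mmin.
  by rewrite integral_cst// [X in _ * X]probability_setT mule1.
have [mmin1 mmin2] := mmin.
have mstep : measurable_fun setT (fun z : BE =>
    (jump k (word_step dq e k.+1 (u, z)).1)%:E).
  apply: (measurableT_comp mG).
  exact: (measurableT_comp (measurable_word_step dq e k.+1) (measurable_pair1 u)).
apply: ge0_le_integral => //.
- by move=> z _; rewrite lee_fin.
- by apply: emeasurable_funD => //; exact: measurable_cst.
move=> z _; rewrite -EFinD lee_fin /jump /=.
set y := ((u.2 : E) + (z : E))%R.
have hy := nearestP dq (e k.+1) y.
rewrite {1}/point /=.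
have ek1 : ((e k.+1)%:num <= (2 ^ k.+1)%:R^-1 :> R)%R.
  by rewrite /e /= lef_pV2 ?posrE ?ltr0n ?expn_gt0// ler_nat leq_pexp2l.
have dist : (`|q (nearest dq (e k.+1) y) - point u.1| <=
    `|z : E| + 2 / (2 ^ k.+1)%:R)%R.
  have -> : (q (nearest dq (e k.+1) y) - point u.1 =
      ((u.2 : E) - point u.1) + (z : E) - (y - q (nearest dq (e k.+1) y)))%R.
    rewrite opprB addrCA; congr (_ + _)%R.
    by rewrite /y (addrAC (u.2 : E)) addrAC subrr sub0r.
  apply: le_trans (ler_normB _ _) _.
  apply: (@le_trans _ _ ((e k)%:num + `|z : E| + (e k.+1)%:num)%R).
    by rewrite lerD ?(ltW hy)// (le_trans (ler_normD _ _))// lerD2r ltW.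
  by rewrite addrAC addrC lerD2l mulrDl mul1r lerD2l.
rewrite ge_min; have [z1|z1] := lerP 1%R `|z : E|.
  by rewrite lerDl divr_ge0.
by rewrite dist orbT.
Qed.

(** The rounded walk converges almost surely, and the limit law is the law of
its limit: equi-Lipschitz test functions do not see the rounding, whose error
tends to 0. *)
Lemma weak_limit_exists : exists a : probability BE R, weak_limit mu a.
Proof.
have [D [Db mD DE]] := walk_realization.
pose Y k x : E := point (D x k.+1).
have mY k : measurable_fun setT (Y k : measurableTypeR R -> BE).
  exact: (measurableT_comp mpoint (mD k.+1)).
have [Z mZ YZ] : exists2 Z : measurableTypeR R -> E,
    measurable_fun setT (Z : _ -> BE) &
    {ae unit_lebesgue, forall x, Y k x @[k --> \oo] --> Z x}.
  apply: (ae_cvg_limit dq mY).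
  apply: (@le_lt_trans _ _ (\sum_(k <oo)
    (\int[rho k.+1]_z (Num.min 1 `|z : E|)%:E + (2 / (2 ^ k.+1)%:R)%:E))).
    apply: lee_nneseries => k _.
      by move=> _; apply: integral_ge0 => x _; rewrite lee_fin le_min ler01 normr_ge0.
    apply: le_trans (jump_integral k).
    rewrite -(DE k.+2 (fun w => (jump k w)%:E)); last first.
      by move=> w; rewrite lee_fin le_min ler01 normr_ge0.
    rewrite le_eqVlt; apply/orP; left; apply/eqP.
    by apply: eq_integral => x _; rewrite /jump /Y Db.
  have c0 k : 0 <= \int[rho k]_z (Num.min 1 `|z : E|)%:E.
    by apply: integral_ge0 => x _; rewrite lee_fin le_min ler01 normr_ge0.
  apply: le_lt_trans (epsilon_trick _ _ _) _ => //.
  rewrite lte_add_pinfty ?ltry//; apply: le_lt_trans rho_fin.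
  under eq_eseriesr do rewrite -addn1.
  rewrite (nneseries_addn 1 (f := fun k => \int[rho k]_z (Num.min 1 `|z : E|)%:E))//.
  by rewrite [leRHS](nneseries_split 0 1)// add0n leeDr// sume_ge0.
exists (image_measure mZ (@unit_lebesgue R)) => L f_ f f01 fL ff.
have flim01 x : (0 <= f x <= 1)%R.
  have cf : cvgn (f_ ^~ x) by apply/cvg_ex; exists (f x); exact: ff.
  rewrite -(cvg_lim _ (ff x))//; apply/andP; split.
    by apply: limr_ge => //; apply: nearW => k; have /andP[] := f01 k x.
  by apply: limr_le => //; apply: nearW => k; have /andP[] := f01 k x.
have fflip : lip L f.
  move=> x y; have cn : `|f_ k x - f_ k y|%R @[k --> \oo] --> `|f x - f y|%R.
    by apply: cvg_norm; apply: cvgB.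
  rewrite -(cvg_lim _ cn)//; apply: limr_le.
    by apply/cvg_ex; exists `|f x - f y|%R.
  by apply: nearW => k; exact: fL.
have f0 x : (0 <= f x)%R by have /andP[] := flim01 x.
have f_0 k x : (0 <= f_ k x)%R by have /andP[] := f01 k x.
rewrite ge0_integral_image; [|by have [] := nonneg_meas_lip fflip f0
  |by move=> x; rewrite lee_fin].
rewrite -(cvg_shiftS (fun k => \int[mu k]_x (f_ k x)%:E)) /=.
have cvgY : \int[unit_lebesgue]_x (f_ k.+1 (Y k x))%:E @[k --> \oo] -->
    \int[unit_lebesgue]_x (f (Z x))%:E.
  have [] := @dominated_convergence _ _ R (@unit_lebesgue R) setT measurableT
    (fun k x => (f_ k.+1 (Y k x))%:E) (fun x => (f (Z x))%:E) (cst 1%:E) => //.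
  - move=> k; apply/measurable_EFinP.
    exact: (measurableT_comp (lip_measurable (fL k.+1)) (mY k)).
  - apply/measurable_EFinP.
    exact: (measurableT_comp (lip_measurable fflip) mZ).
  - have [N [mN N0 subN]] := YZ; exists N; split => //.
    apply: subset_trans subN => x /= ncl YZx; apply: ncl => _.
    apply: cvg_EFin; first exact: nearW.
    apply/cvgrPdist_lt => eps eps0; near=> k.
    rewrite (_ : f (Z x) - f_ k.+1 (Y k x) = (f (Z x) - f_ k.+1 (Z x)) +
      (f_ k.+1 (Z x) - f_ k.+1 (Y k x)))%R; last by rewrite addrA subrK.
    apply: le_lt_trans (ler_normD _ _) _; rewrite (splitr eps) ltrD//.
      near: k; have := ff (Z x); rewrite -(cvg_shiftS (f_ ^~ (Z x))) /=.
      by move/cvgrPdist_lt; apply; rewrite divr_gt0.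
    apply: le_lt_trans (fL _ _ _) _.
    apply: (@le_lt_trans _ _ ((`|L| + 1) * `|Z x - Y k x|)%R).
      by rewrite ler_wpM2r// (le_trans (ler_norm _))// lerDl.
    rewrite mulrC -ltr_pdivlMr ?ltr_wpDl//.
    near: k; move/cvgrPdist_lt : YZx; apply.
    by rewrite !divr_gt0// ltr_wpDl.
  - exact: finite_measure_integrable_cst.
  - apply: nearW => x k _; rewrite /= lee_fin ger0_norm//.
    by have /andP[] := f01 k.+1 (Y k x).
have L0 : (0 <= `|L|)%R by [].
have close k : \int[mu k.+1]_x (f_ k.+1 x)%:E <=
     \int[unit_lebesgue]_x (f_ k.+1 (Y k x))%:E + (`|L| * (2 ^ k.+1)%:R^-1)%:E /\
   \int[unit_lebesgue]_x (f_ k.+1 (Y k x))%:E <=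
     \int[mu k.+1]_x (f_ k.+1 x)%:E + (`|L| * (2 ^ k.+1)%:R^-1)%:E.
  set c := (`|L| * _)%R.
  have c0 : (0 <= c)%R by rewrite mulr_ge0// invr_ge0.
  have mfk := nonneg_meas_lip (fL k.+1) (f_0 k.+1).
  rewrite -walk_marginal//.
  rewrite (DE k.+1 (fun w => (f_ k.+1 (point w))%:E)); last first.
    by move=> w; rewrite lee_fin.
  have key (g1 g2 : word * BE -> R) : (forall u, 0 <= g1 u)%R ->
      (forall u, 0 <= g2 u)%R -> measurable_fun setT g1 ->
      measurable_fun setT g2 ->
      (forall u, `|(u.2 : E) - point u.1| < (e k)%:num -> g1 u <= g2 u + c)%R ->
      \int[P k.+1]_u (g1 u)%:E <= \int[P k.+1]_u (g2 u)%:E + c%:E.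
    move=> g10 g20 mg1 mg2 g12.
    apply: (@le_trans _ _ (\int[P k.+1]_u ((g2 u)%:E + c%:E))).
      apply: ae_ge0_le_integral => //.
      - by move=> u _; rewrite lee_fin.
      - exact/measurable_EFinP.
      - by move=> u _; rewrite -EFinD lee_fin addr_ge0.
      - apply: emeasurable_funD; first exact/measurable_EFinP.
        exact: measurable_cst.
      have [N [mN N0 subN]] := walk_close k; exists N; split => //.
      apply: subset_trans subN => u /= ncl hu; apply: ncl => _.
      by rewrite -EFinD lee_fin; exact: g12.
    rewrite ge0_integralD//.
    - by rewrite integral_cst// [X in _ * X]probability_setT mule1.
    - by move=> u _; rewrite lee_fin.
    - exact/measurable_EFinP.
  have m1 : measurable_fun setT (fun u : word * BE => f_ k.+1 u.2).
    exact: (measurableT_comp (lip_measurable (fL k.+1)) measurable_snd).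
  have m2 : measurable_fun setT (fun u : word * BE => f_ k.+1 (point u.1)).
    exact: (measurableT_comp (lip_measurable (fL k.+1))
      (measurableT_comp mpoint measurable_fst)).
  have dist (x y : E) : (`|x - y| < (e k)%:num -> f_ k.+1 x <= f_ k.+1 y + c)%R.
    move=> xy; rewrite -lerBlDl; apply: le_trans (ler_norm _) _.
    apply: le_trans (fL _ _ _) _; apply: (@le_trans _ _ (`|L| * `|x - y|)%R).
      by rewrite ler_wpM2r// ler_norm.
    by rewrite /c ler_wpM2l// ltW.
  split; apply: key => // u hu; first exact: dist.
  by apply: dist; rewrite distrC.
have lfin : \int[unit_lebesgue]_x (f (Z x))%:E \is a fin_num.
  rewrite ge0_fin_numE; last by apply: integral_ge0 => x _; rewrite lee_fin.
  apply: (@le_lt_trans _ _ (\int[@unit_lebesgue R]_x cst 1 x)).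
    apply: ge0_le_integral => //.
    - by move=> x _; rewrite lee_fin.
    - apply/measurable_EFinP.
      exact: (measurableT_comp (lip_measurable fflip) mZ).
    - by move=> x _; rewrite lee_fin; have /andP[] := flim01 (Z x).
  by rewrite integral_cst// [X in _ * X]probability_setT mule1 ltry.
have c_cvg : (`|L| * (2 ^ k.+1)%:R^-1)%:E @[k --> \oo] --> 0.
  apply: cvg_EFin; first exact: nearW.
  rewrite -(mulr0 `|L|%R); apply: cvgM; first exact: cvg_cst.
  rewrite (_ : (fun k => _) = (fun k => (2^-1 ^+ k.+1)%R : R)).
    rewrite cvg_shiftS; apply: cvg_expr.
    by rewrite ger0_norm// invf_lt1// ltr1n.
  by apply/funext => k; rewrite natrX exprVn.
apply: (@squeeze_cvge _ _ _ _
  (fun k => \int[unit_lebesgue]_x (f_ k.+1 (Y k x))%:E - (`|L| * (2 ^ k.+1)%:R^-1)%:E)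
  _ (fun k => \int[unit_lebesgue]_x (f_ k.+1 (Y k x))%:E + (`|L| * (2 ^ k.+1)%:R^-1)%:E)).
- apply: nearW => k; have [c1 c2] := close k; rewrite c1 andbT.
  by rewrite leeBlDr.
- rewrite -[X in _ --> X]sube0; apply: cvgeB => //.
  by rewrite fin_num_adde_defl.
- rewrite -[X in _ --> X]adde0; apply: cvgeD => //.
  by rewrite fin_num_adde_defl.
Unshelve. all: by end_near. Qed.

End weak_limits.

(** * Convolution powers of weak limits *)

Section lipschitz_determine.
Local Open Scope ereal_scope.
Context {R : realType} {E : completeNormedModType R}.
Notation BE := (borel E).

(** The functions min(1, n d(x)), where d is the distance to the complement of U. *)
Lemma open_lip_approx (U : set E) : open U -> exists f_ : nat -> E -> R,
  [/\ forall n x, (0 <= f_ n x <= 1)%R, forall n, exists L, lip L (f_ n),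
      forall x n m, (n <= m)%N -> (f_ n x <= f_ m x)%R &
      forall x, f_ n x @[n --> \oo] --> (\1_U x : R)].
Proof.
move=> oU; have [UT|] := pselect (U = setT).
  exists (fun _ _ => 1%R); split => //.
  - by move=> n x; rewrite ler01 lexx.
  - by move=> _; exists 0%R => x y; rewrite subrr normr0 mul0r.
  - by move=> x; rewrite UT indicT; exact: cvg_cst.
move=> UT; have [y0 Uy0] : exists y, ~ U y.
  by apply/existsNP => h; apply: UT; apply/seteqP; split => // x _; exact: h.
pose S x := [set `|x - y|%R | y in ~` U].
have S_lb x : lbound (S x) 0%R by move=> _ [y _ <-].
have S_inf x : has_inf (S x).
  by split; [exists `|x - y0|%R; exists y0|exists 0%R; exact: S_lb].
pose d x := inf (S x).
have d0 x : (0 <= d x)%R.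
  by apply: lb_le_inf; [exact: (S_inf x).1|exact: S_lb].
have dle x y : ~ U y -> (d x <= `|x - y|)%R.
  by move=> Uy; apply: ge_inf; [exact: (S_inf x).2|exists y].
have dlip x y : (d x - d y <= `|x - y|)%R.
  rewrite lerBlDr -lerBlDl; apply: lb_le_inf; first exact: (S_inf y).1.
  move=> _ [z Uz <-]; rewrite lerBlDr; apply: le_trans (dle x z Uz) _.
  by rewrite [leRHS]addrC; exact: ler_distD.
have dpos x : U x -> (0 < d x)%R.
  move=> Ux; have /nbhs_ballP[e /= e0 sub] : nbhs x U by exact: open_nbhs_nbhs.
  apply: (lt_le_trans e0); apply: lb_le_inf; first exact: (S_inf x).1.
  move=> _ [y Uy <-]; rewrite leNgt; apply/negP => xy; apply: Uy; apply: sub.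
  by rewrite -ball_normE.
have dout x : ~ U x -> d x = 0%R.
  move=> Ux; apply/eqP; rewrite eq_le d0 andbT.
  by apply: le_trans (dle x x Ux) _; rewrite subrr normr0.
exists (fun n x => Num.min 1%R (n%:R * d x)%R); split.
- by move=> n x; rewrite le_min ler01 mulr_ge0//= ge_min lexx.
- move=> n; exists n%:R => x y.
  wlog xy : x y / (Num.min 1 (n%:R * d y) <= Num.min 1 (n%:R * d x))%R.
    move=> H; have /orP[/H//|/H] := le_total (Num.min 1 (n%:R * d y))%R
      (Num.min 1 (n%:R * d x))%R.
    by rewrite distrC (distrC y).
  rewrite ger0_norm ?subr_ge0//.
  have h : (n%:R * d x - n%:R * d y <= n%:R * `|x - y|)%R.
    by rewrite -mulrBr ler_wpM2l.
  have c0 : (0 <= n%:R * `|x - y| :> R)%R by rewrite mulr_ge0.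
  by case: (lerP 1%R (n%:R * d x)%R); case: (lerP 1%R (n%:R * d y)%R); lra.
- move=> x n m nm; rewrite le_min !ge_min lexx /=; apply/orP; right.
  by rewrite ler_wpM2r// ler_nat.
- move=> x; have [Ux|Ux] := pselect (U x); last first.
    rewrite indicE memNset// dout//.
    under eq_fun do rewrite mulr0 min_r//.
    exact: cvg_cst.
  rewrite indicE mem_set//; apply/cvgrPdist_lt => e e0; near=> n.
  rewrite min_l ?subrr ?normr0//.
  rewrite -ler_pdivrMr ?dpos// mul1r.
  by near: n; exact: nbhs_infty_ger.
Unshelve. all: by end_near. Qed.

(** Open sets form a pi-system, and their measures are monotone limits of
integrals of Lipschitz functions. *)
Lemma lip_determine (m1 m2 : {finite_measure set BE -> \bar R}) :
  (forall (L : R) (f : E -> R), lip L f -> (forall x, 0 <= f x <= 1)%R ->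
     \int[m1]_x (f x)%:E = \int[m2]_x (f x)%:E) ->
  forall A, measurable A -> m1 A = m2 A.
Proof.
move=> m12 A mA.
have openE U : open U -> m1 U = m2 U.
  move=> oU; have [f_ [f01 fL fnd fU]] := open_lip_approx oU.
  have mU : measurable (U : set BE) by exact: open_borel_measurable.
  have cvgm (m : {finite_measure set BE -> \bar R}) :
      \int[m]_x (f_ n x)%:E @[n --> \oo] --> m U.
    rewrite -[m U]/(m (U : set BE)) -[in X in _ --> X](setIT (U : set BE)).
    rewrite -(integral_indic m measurableT mU).
    rewrite (_ : \int[m]_x (\1_U x)%:E =
        \int[m]_x limn (fun n => (f_ n x)%:E)); last first.
      apply: eq_integral => x _; apply/esym/cvg_lim => //.
      by apply: cvg_EFin; [exact: nearW|exact: fU].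
    apply: (@cvg_monotone_convergence _ BE R m setT measurableT
      (fun n x => (f_ n x)%:E)) => //.
    - by move=> n; have [L fnL] := fL n; apply/measurable_EFinP; exact: lip_measurable fnL.
    - by move=> n x _; rewrite lee_fin; have /andP[] := f01 n x.
    - by move=> x _ n k nk; rewrite lee_fin; exact: fnd.
  apply: (cvg_unique _ (cvgm m1)) => //.
  rewrite (_ : (fun n => _) = (fun n => \int[m2]_x (f_ n x)%:E)).
    exact: cvgm.
  apply/funext => n; have [L fnL] := fL n.
  by apply: m12 fnL _ => x; exact: f01.
apply: (@measure_unique _ R BE (@open E) (fun=> setT)) => //.
- exact: openI.
- by move=> _; exact: openT.
- by rewrite bigcup_const.
- by move=> k; rewrite -ge0_fin_numE// fin_num_measure.
Qed.

End lipschitz_determine.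

Section convolution_powers_limit.
Local Open Scope ereal_scope.
Context {R : realType} {E : completeNormedModType R}.
Variables (q : nat -> E) (dq : dense_seq q).
Notation BE := (borel E).

Lemma conv_op_lip (m : probability BE R) (L : R) (f : E -> R) :
  (forall x, 0 <= f x <= 1)%R -> lip L f ->
  exists h : E -> R, [/\ conv_op m (EFin \o f) = EFin \o h,
    forall x, (0 <= h x <= 1)%R & lip L h].
Proof.
move=> f01 fL; have f0 x : (0 <= f x)%R by have /andP[] := f01 x.
have mf := nonneg_meas_lip fL f0.
have mg : nonneg_meas (cst 1 : E -> \bar R) by split => // x; rewrite /= lee_fin.
have c0 x : 0 <= conv_op m (EFin \o f) x by have [_] := nonneg_meas_conv_op dq m mf; exact.
have c1 x : conv_op m (EFin \o f) x <= 1.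
  have : conv_op m (EFin \o f) x <= conv_op m (cst 1) x.
    by apply: (le_conv_op dq) => // y; rewrite lee_fin; have /andP[] := f01 y.
  by rewrite {2}/conv_op /= integral_cst// [X in _ * X]probability_setT mule1.
have cfin x : conv_op m (EFin \o f) x \is a fin_num.
  by rewrite ge0_fin_numE// (le_lt_trans (c1 x))// ltry.
pose h x := fine (conv_op m (EFin \o f) x).
have hE x : (h x)%:E = conv_op m (EFin \o f) x by rewrite /h fineK.
exists h; split; first by apply/funext => x; rewrite /= hE.
  by move=> x; rewrite -!lee_fin hE c0 c1.
have half x y : (h x - h y <= L * `|x - y|)%R.
  rewrite lerBlDl -lee_fin EFinD !hE.
  have Lxy : (0 <= L * `|x - y|)%R.
    by apply: le_trans (fL x y).
  have [mfy fy0] := nonneg_meas_shift dq y mf.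
  apply: (@le_trans _ _ (\int[m]_z ((f (y + (z : E)))%:E + (L * `|x - y|)%:E))).
    apply: ge0_le_integral => //.
    - by move=> z _; rewrite /= lee_fin.
    - by have [] := nonneg_meas_shift dq x mf.
    - by apply: emeasurable_funD => //; exact: measurable_cst.
    - move=> z _; rewrite /= -EFinD lee_fin -lerBlDl.
      apply: le_trans (ler_norm _) _; apply: le_trans (fL _ _) _.
      by rewrite opprD addrACA subrr addr0.
  rewrite ge0_integralD//; last by move=> z _; rewrite lee_fin.
  by rewrite integral_cst// [X in _ * X]probability_setT mule1.
move=> x y; rewrite ler_norml half andbT lerNl opprB.
by rewrite distrC half.
Qed.

(** Averaging the translates of a function over a law preserves its bounds and
its Lipschitz constant, so the averages are again admissible test functions and
the convolutions can be treated one at a time. *)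
Lemma weak_limit_iter_conv_op (al : nat -> probability BE R) (a : probability BE R)
    (n : nat) (L : R) (f_ : nat -> E -> R) (f : E -> R) :
  weak_limit al a ->
  (forall k x, 0 <= f_ k x <= 1)%R -> (forall k, lip L (f_ k)) ->
  (forall x, f_ k x @[k --> \oo] --> f x) ->
  exists (h_ : nat -> E -> R) (h : E -> R),
  [/\ forall k x, (0 <= h_ k x <= 1)%R, forall k, lip L (h_ k),
      forall x, h_ k x @[k --> \oo] --> h x,
      forall k, iter n (conv_op (al k)) (EFin \o f_ k) = EFin \o h_ k &
      iter n (conv_op a) (EFin \o f) = EFin \o h].
Proof.
move=> ala f01 fL ff; elim: n => [|n [h_ [h [h01 hL hh hE hE']]]].
  by exists f_, f.
have /choice[g_ g_P] k := conv_op_lip (al k) (h01 k) (hL k).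
have hs01 x k z : (0 <= h_ k (x + z) <= 1)%R by [].
have hlim01 x : (0 <= h x <= 1)%R.
  apply/andP; split.
    by apply: (cvgr_to_ge (hh x)); apply: nearW => k; have /andP[] := h01 k x.
  by apply: (cvgr_to_le (hh x)); apply: nearW => k; have /andP[] := h01 k x.
have hlimL : lip L h.
  move=> x y; have cn : `|h_ k x - h_ k y|%R @[k --> \oo] --> `|h x - h y|%R.
    by apply: cvg_norm; apply: cvgB.
  by apply: (cvgr_to_le cn); apply: nearW => k; exact: hL.
have [g [gE g01 gL]] := conv_op_lip a hlim01 hlimL.
exists g_, g; split.
- by move=> k; have [] := g_P k.
- by move=> k; have [] := g_P k.
- move=> x; suff : (g_ k x)%:E @[k --> \oo] --> (g x)%:E by move/fine_cvg.
  have := ala L (fun k z => h_ k (x + z)%R) (fun z => h (x + z)%R)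
    (hs01 x) _ (fun z => hh (x + z)%R).
  have gxE : \int[a]_z (h (x + (z : E)))%:E = (g x)%:E.
    by rewrite -[RHS]/((EFin \o g) x) -gE.
  rewrite gxE.
  have -> : (fun k => \int[al k]_z (h_ k (x + (z : E)))%:E) = (fun k => (g_ k x)%:E).
    apply/funext => k; have [gkE _ _] := g_P k.
    by rewrite -[RHS]/((EFin \o g_ k) x) -gkE.
  move=> /(_ _); apply.
  by move=> k y z; apply: le_trans (hL _ _ _) _; rewrite opprD addrACA subrr add0r.
- by move=> k; rewrite iterS hE; have [] := g_P k.
- by rewrite iterS hE'.
Qed.

Lemma conv_powerE (nu : probability BE R) n (A : set BE) :
  measurable A -> conv_power nu n A = conv_powm dq nu n A.
Proof.
move=> mA.
have mI : nonneg_meas (EFin \o (\1_A : E -> R)).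
  split; last by move=> x; rewrite /= lee_fin.
  by apply/measurable_EFinP; exact: measurable_indic.
have -> : conv_powm dq nu n A = iter n (conv_op nu) (EFin \o \1_A) 0%R.
  rewrite -(conv_op_conv_powm dq)// /conv_op -[A in LHS]setIT -(integral_indic _ measurableT mA).
  by apply: eq_integral => x _; rewrite /= add0r.
suff H x : conv_power nu n [set y : E | A (x + y)%R] = iter n (conv_op nu) (EFin \o \1_A) x.
  by rewrite -H; congr conv_power; apply/seteqP; split => y /=; rewrite add0r.
elim: n x => [|n IH] x.
  have e0 : ((0%R : E) \in [set y : E | A (x + y)%R]) = (x \in A).
    by apply/idP/idP; rewrite !inE /= addr0.
  rewrite /conv_power /= /dirac !indicE.
  by apply: (congr1 (fun b : bool => (b%:R)%:E)); exact: e0.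
rewrite iterS /conv_power iterS -/(conv_power nu n) /convolution /conv_op.
apply: eq_integral => z _; rewrite -IH; congr conv_power.
by apply/seteqP; split => y /=; rewrite addrA.
Qed.

(** Both sides are limits of the same integrals of Lipschitz functions, which
determine a law. *)
Lemma weak_limit_infinitely_divisible (mu_ : nat -> probability BE R)
    (nu_ : nat -> probability BE R) (mu nu : probability BE R) n :
  (forall k f, nonneg_meas f -> \int[mu_ k]_x f x = iter n (conv_op (nu_ k)) f 0%R) ->
  weak_limit mu_ mu -> weak_limit nu_ nu ->
  forall A : set BE, measurable A -> mu A = conv_power nu n A.
Proof.
move=> munu lmu lnu A mA; rewrite conv_powerE//.
apply: lip_determine => // L f fL f01.
have f0 x : (0 <= f x)%R by have /andP[] := f01 x.
have mf := nonneg_meas_lip fL f0.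
have [h_ [h [h01 hL hh hE hE']]] := @weak_limit_iter_conv_op nu_ nu n L (fun=> f) f lnu
  (fun=> f01) (fun=> fL) (fun x => cvg_cst (f x)).
have -> : \int[conv_powm dq nu n]_x (f x)%:E = (h 0%R)%:E.
  rewrite -[RHS]/((EFin \o h) 0%R) -hE' -(conv_op_conv_powm dq)//.
  by apply: eq_integral => x _; rewrite /= add0r.
have c1 : \int[mu_ k]_x (f x)%:E @[k --> \oo] --> \int[mu]_x (f x)%:E.
  by apply: (lmu L (fun=> f)) => // x; exact: cvg_cst.
apply: (cvg_unique _ c1) => //.
rewrite (_ : (fun k => _) = (fun k => (h_ k 0%R)%:E)).
  by apply: cvg_EFin; [exact: nearW|exact: hh].
by apply/funext => k; rewrite munu// hE.
Qed.

End convolution_powers_limit.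

(** * The complex exponential as a limit of powers *)

Section complex_exponential.
Context {R : realType}.
Implicit Types z w : R[i].
Local Open Scope complex_scope.
Notation Re := complex.Re.
Notation Im := complex.Im.
Import ComplexField.Normc.

Lemma normc_sqr z : normc z ^+ 2 = Re z ^+ 2 + Im z ^+ 2.
Proof. by case: z => a b /=; rewrite sqr_sqrtr// addr_ge0// sqr_ge0. Qed.

Lemma normc_ge0 z : 0 <= normc z.
Proof. by case: z => a b /=; exact: sqrtr_ge0. Qed.

Lemma normc_le z : normc z <= `|Re z| + `|Im z|.
Proof.
rewrite -(ler_pXn2r (n := 2))// ?nnegrE ?normc_ge0 ?addr_ge0//.
rewrite normc_sqr sqrrD !real_normK ?num_real// lerD2r lerDl.
by rewrite mulrn_wge0// mulr_ge0.
Qed.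

Lemma normcX z n : normc (z ^+ n) = normc z ^+ n.
Proof.
by elim: n => [|n IH]; rewrite ?expr0 ?normc1// !exprS normcM IH.
Qed.

(** Telescoping z^n - w^n; all the powers involved are in the unit disc. *)
Lemma normc_exprB z w n : normc z <= 1 -> normc w <= 1 ->
  normc (z ^+ n - w ^+ n) <= n%:R * normc (z - w).
Proof.
move=> z1 w1; elim: n => [|n IH].
  by rewrite !expr0 subrr normc0 mul0r.
rewrite (_ : _ - _ = z ^+ n * (z - w) + (z ^+ n - w ^+ n) * w); last first.
  by rewrite !exprSr; ring.
apply: le_trans (le_normcD _ _) _.
rewrite !normcM -natr1 mulrDl mul1r addrC lerD//.
  apply: le_trans IH; rewrite ler_piMr ?normc_ge0//.
by rewrite ler_piMl ?normc_ge0// normcX exprn_ile1 ?normc_ge0.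
Qed.

Lemma cexpD z w : cexp (z + w) = cexp z * cexp w.
Proof.
case: z => a b; case: w => c d; rewrite /cexp /=.
have mulcE (x y x' y' : R) : (x +i* y) * (x' +i* y') =
    (x * x' - y * y') +i* (x * y' + y * x') by [].
by rewrite expRD cosD sinD mulcE; congr (_ +i* _); ring.
Qed.

Lemma cexpMn z n : cexp (z *+ n) = cexp z ^+ n.
Proof.
elim: n => [|n IH].
  by rewrite mulr0n expr0 /cexp /= expR0 cos0 sin0 mul1r mulr0.
by rewrite mulrS exprS cexpD IH.
Qed.

Lemma normc_cexp z : normc (cexp z) = expR (Re z).
Proof.
apply/eqP; rewrite -(eqrXn2 (n := 2))// ?normc_ge0 ?expR_ge0//.
by rewrite normc_sqr /cexp /= !exprMn -mulrDr cos2Dsin2 mulr1.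
Qed.

(** The derivative at 0, along the sequence 1/(n+1). *)
Lemma deriv0_seq (f : R -> R) (l : R) : is_derive (0 : R) (1 : R) f l ->
  n.+1%:R * (f n.+1%:R^-1 - f 0) @[n --> \oo] --> l.
Proof.
move=> fl; have df : derivable f (0 : R) (1 : R) by [].
have dq : h^-1 *: (f (h *: 1 + 0) - f 0) @[h --> 0^'] --> l.
  have := @derive_val _ _ _ _ _ _ _ fl; rewrite /derive => <-.
  exact: df.
have hd : (fun n => n.+1%:R^-1 : R) @ \oo --> 0^'.
  move=> A /=; rewrite /dnbhs /within /= => nA.
  have h0 := @cvg_harmonic R.
  have : \forall n \near \oo, n.+1%:R^-1 != 0 :> R -> A n.+1%:R^-1 := h0 _ nA.
  rewrite -[X in _ -> X]/(\forall n \near \oo, A (n.+1%:R^-1 : R)).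
  by apply: filterS => n /=; apply; rewrite invr_eq0 pnatr_eq0.
have := cvg_comp _ _ hd dq; apply: cvg_trans; apply: near_eq_cvg.
by apply: nearW => n /=; rewrite invrK /GRing.scale /= mulr1 addr0.
Qed.

Lemma cexp_small_Re (p v : R) :
  n.+1%:R * (Re (cexp ((p / n.+1%:R) +i* (v / n.+1%:R))) - 1) @[n --> \oo] --> p.
Proof.
have /deriv0_seq H : is_derive (0 : R) (1 : R)
    (fun t => expR (p * t) * cos (v * t)) p.
  apply: is_derive_eq; rewrite !mulr0 expR0 cos0 sin0.
  by rewrite /GRing.scale /=; ring.
apply: cvg_trans H; apply: near_eq_cvg; apply: nearW => n /=.
by rewrite !mulr0 expR0 cos0 mulr1.
Qed.

Lemma cexp_small_Im (p v : R) :
  n.+1%:R * Im (cexp ((p / n.+1%:R) +i* (v / n.+1%:R))) @[n --> \oo] --> v.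
Proof.
have /deriv0_seq H : is_derive (0 : R) (1 : R)
    (fun t => expR (p * t) * sin (v * t)) v.
  apply: is_derive_eq; rewrite !mulr0 expR0 cos0 sin0.
  by rewrite /GRing.scale /=; ring.
apply: cvg_trans H; apply: near_eq_cvg; apply: nearW => n /=.
by rewrite !mulr0 expR0 sin0 mulr0 subr0.
Qed.

(** With s_n = exp(z/n), both phi_n and s_n have modulus at most 1, so the
difference of their n-th powers w and exp z is at most n |phi_n - s_n|, and phi_n
and s_n have the same expansion 1 + z/n to first order. *)
Lemma cexp_roots (phi : nat -> R[i]) w z : Re z <= 0 ->
  (forall n, w = phi n ^+ n.+1) -> (forall n, normc (phi n) <= 1) ->
  n.+1%:R * (Re (phi n) - 1) @[n --> \oo] --> Re z ->
  n.+1%:R * Im (phi n) @[n --> \oo] --> Im z ->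
  w = cexp z.
Proof.
case: z => p v /= p0 wphi phi1 cRe cIm.
pose s n := cexp ((p / n.+1%:R) +i* (v / n.+1%:R)).
have sE n : cexp (p +i* v) = s n ^+ n.+1.
  rewrite /s -cexpMn; congr cexp.
  have mulrnE k (x y : R) : (x +i* y) *+ k = (x *+ k) +i* (y *+ k).
    by elim: k => [|k IH]; rewrite ?mulr0n// !mulrS IH.
  have divnK (x : R) : x = (x / n.+1%:R) *+ n.+1.
    by rewrite -[RHS]mulr_natr divfK// pnatr_eq0.
  by rewrite mulrnE -!divnK.
have s1 n : normc (s n) <= 1.
  rewrite /s normc_cexp /= -expR0 ler_expR.
  by rewrite mulr_le0_ge0// invr_ge0.
have diff n : normc (w - cexp (p +i* v)) <=
    `|n.+1%:R * (Re (phi n) - 1) - n.+1%:R * (Re (s n) - 1)| +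
    `|n.+1%:R * Im (phi n) - n.+1%:R * Im (s n)|.
  rewrite (wphi n) (sE n); apply: le_trans (normc_exprB _ _ _) _ => //.
  rewrite -!mulrBr !normrM normr_nat -mulrDr ler_wpM2l//.
  apply: le_trans (normc_le _) _.
  rewrite opprB addrA subrK.
  by case: (phi n) => a b; case: (s n) => c d.
have /eqP d0 : normc (w - cexp (p +i* v)) == 0.
  rewrite eq_le normc_ge0 andbT.
  have H : `|n.+1%:R * (Re (phi n) - 1) - n.+1%:R * (Re (s n) - 1)| +
    `|n.+1%:R * Im (phi n) - n.+1%:R * Im (s n)| @[n --> \oo] --> (0 : R).
    have c1 : `|n.+1%:R * (Re (phi n) - 1) - n.+1%:R * (Re (s n) - 1)|
        @[n --> \oo] --> `|p - p|.
      by apply: cvg_norm; apply: cvgB; [exact: cRe|exact: cexp_small_Re].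
    have c2 : `|n.+1%:R * Im (phi n) - n.+1%:R * Im (s n)| @[n --> \oo] --> `|v - v|.
      by apply: cvg_norm; apply: cvgB; [exact: cIm|exact: cexp_small_Im].
    by have := cvgD c1 c2; rewrite !subrr normr0 addr0; exact.
  by apply: (cvgr_to_ge H); apply: nearW => n; exact: diff.
by apply/eqP; rewrite -subr_eq0; apply/eqP; case: (w - _) d0 => a b; exact: eq0_normc.
Qed.

End complex_exponential.

(** * Characteristic functions of compound Poisson laws *)

Section trig_lipschitz.
Context {R : realType}.

Lemma cos_lip (a b : R) : `|cos a - cos b| <= `|a - b|.
Proof.
wlog ab : a b / a <= b => [H|].
  have /orP[/H//|/H] := le_total a b; by rewrite distrC (distrC b).
have [c _ h] := @MVT_segment R cos (fun x => - sin x) a b ab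
  (fun x _ => is_derive_cos x) (continuous_subspaceT (@continuous_cos R)).
rewrite distrC h normrM (distrC a) ler_piMl//.
by rewrite normrN sin_max.
Qed.

Lemma sin_lip (a b : R) : `|sin a - sin b| <= `|a - b|.
Proof.
wlog ab : a b / a <= b => [H|].
  have /orP[/H//|/H] := le_total a b; by rewrite distrC (distrC b).
have [c _ h] := @MVT_segment R sin cos a b ab
  (fun x _ => is_derive_sin x) (continuous_subspaceT (@continuous_sin R)).
by rewrite distrC h normrM (distrC a) ler_piMl// cos_max.
Qed.

End trig_lipschitz.

Section cpoisson_natmul.
Local Open Scope ereal_scope.
Context {R : realType} {E : normedModType R} (q : nat -> E) (dq : dense_seq q).
Notation BE := (borel E).

(** For k > 0 the law with jump measure S / k is thus a k-th convolution root
of the law with jump measure S. *)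
Lemma cpoisson_natmul k (B S : {finite_measure set BE -> \bar R}) f :
  (forall U, measurable U -> S U = k%:R%:E * B U) -> nonneg_meas f ->
  conv_op (cpoisson dq S) f = iter k (conv_op (cpoisson dq B)) f.
Proof.
elim: k S => [|k IH] S SB mf.
  have S0 g x : conv_op S g x = 0.
    rewrite /conv_op -(integral_measure_zero setT (fun z : BE => g (x + (z : E))%R)).
    by apply: eq_measure_integral => U mU _; rewrite [LHS]SB// mul0e.
  apply/funext => x /=; rewrite conv_op_cpoisson// /mass SB// mul0e/= oppr0 expR0 mul1e.
  have [_ f0] := mf.
  rewrite /conv_exp (nneseries_split 0 1)//; last first.
    by move=> n _; rewrite mule_ge0//; have [_] := nonneg_meas_iter_conv_op dq S n mf; exact.
  rewrite add0n big_mkord big_ord1 /= invr1 mul1e eseries0 ?adde0//.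
  by move=> [//|n] _ _; rewrite iterS S0 mule0.
pose kB := [the {finite_measure set BE -> \bar R} of mscale (NngNum (ler0n R k)) B].
have kBE U : measurable U -> kB U = k%:R%:E * B U by [].
rewrite iterS -(IH kB kBE mf); apply: (@cpoisson_add _ _ _ dq B kB S _ f mf) => U mU.
rewrite SB// -natr1 addrC EFinD ge0_muleDl ?lee_fin// mul1e.
by congr (_ + _).
Qed.

End cpoisson_natmul.

Section characteristic_functions.
Context {R : realType} {E : completeNormedModType R}.
Variables (q : nat -> E) (dq : dense_seq q).
Notation BE := (borel E).
Local Open Scope complex_scope.
Notation Re := complex.Re.
Notation Im := complex.Im.
Import ComplexField.Normc.

Variables (u : E -> R) (L : R).
Hypothesis uD : forall x y, u (x + y) = u x + u y.
Hypothesis uL : lip L u.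

Lemma additive0 : u 0 = 0.
Proof. by apply: (addrI (u 0)); rewrite -uD !addr0. Qed.

Lemma cos_u_lip : lip L (fun x => cos (u x)).
Proof. by move=> x y; apply: le_trans (cos_lip _ _) _. Qed.

Lemma sin_u_lip : lip L (fun x => sin (u x)).
Proof. by move=> x y; apply: le_trans (sin_lip _ _) _. Qed.

Let mcos : measurable_fun setT ((fun x => cos (u x)) : BE -> R).
Proof. exact: lip_measurable cos_u_lip. Qed.

Let msin : measurable_fun setT ((fun x => sin (u x)) : BE -> R).
Proof. exact: lip_measurable sin_u_lip. Qed.

Definition cos_int (m : {measure set BE -> \bar R}) : R := \int[m]_x cos (u x).
Definition sin_int (m : {measure set BE -> \bar R}) : R := \int[m]_x sin (u x).

Section finite_measures.
Variable m : {finite_measure set BE -> \bar R}.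

Lemma integrable_cos_u : m.-integrable setT (fun x => (cos (u x))%:E).
Proof.
apply: (@measurable_bounded_integrable _ BE R m (fun x => cos (u x)) setT) => //.
  by rewrite -ge0_fin_numE// fin_num_measure.
exists 1; split; first exact: num_real.
by move=> y y1 x _; apply: le_trans (cos_max _) (ltW y1).
Qed.

Lemma integrable_sin_u : m.-integrable setT (fun x => (sin (u x))%:E).
Proof.
apply: (@measurable_bounded_integrable _ BE R m (fun x => sin (u x)) setT) => //.
  by rewrite -ge0_fin_numE// fin_num_measure.
exists 1; split; first exact: num_real.
by move=> y y1 x _; apply: le_trans (sin_max _) (ltW y1).
Qed.

Lemma trig_integral (a b c : R) :
  (\int[m]_x (a + b * cos (u x) + c * sin (u x))%:E =
   (a * mass m + b * cos_int m + c * sin_int m)%:E)%E.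
Proof.
have ia : m.-integrable setT (fun=> a%:E).
  exact: finite_measure_integrable_cst.
have ib : m.-integrable setT (fun x => (b * cos (u x))%:E).
  under eq_fun do rewrite EFinM; apply: integrableZl => //.
  exact: integrable_cos_u.
have ic : m.-integrable setT (fun x => (c * sin (u x))%:E).
  under eq_fun do rewrite EFinM; apply: integrableZl => //.
  exact: integrable_sin_u.
under eq_integral do rewrite 2!EFinD.
rewrite integralD//; last exact: integrableD.
rewrite integralD// integral_cst//.
under eq_integral do rewrite EFinM.
under [X in (_ + X)%E]eq_integral do rewrite EFinM.
rewrite integralZl//; last exact: integrable_cos_u.
rewrite integralZl//; last exact: integrable_sin_u.
have fc : (\int[m]_x (cos (u x))%:E)%E \is a fin_num.
  by apply: integrable_fin_num => //; exact: integrable_cos_u.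
have fs : (\int[m]_x (sin (u x))%:E)%E \is a fin_num.
  by apply: integrable_fin_num => //; exact: integrable_sin_u.
by rewrite !EFinD !EFinM massE /cos_int /sin_int /Rintegral !fineK.
Qed.

End finite_measures.

Lemma mass_probability (P : probability BE R) : mass P = 1.
Proof. by apply: EFin_inj; rewrite massE; exact: probability_setT. Qed.

(** The characteristic function at an additive Lipschitz functional u, that is
the integral of exp(iu). *)
Definition char_u (P : probability BE R) : R[i] := cos_int P +i* sin_int P.

Lemma normc_char_u (P : probability BE R) : normc (char_u P) <= 1.
Proof.
rewrite -(ler_pXn2r (n := 2))// ?nnegrE ?normc_ge0// expr1n normc_sqr /=.
set C := cos_int P; set S := sin_int P.
(* Cauchy-Schwarz: (C - cos)^2 + (S - sin)^2 is nonnegative, and its mean is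
   1 - C^2 - S^2. *)
have h x : 0 <= (C ^+ 2 + S ^+ 2 + 1) / 2 + - C * cos (u x) + - S * sin (u x).
  have := cos2Dsin2 (u x); have := sqr_ge0 (C - cos (u x)).
  have := sqr_ge0 (S - sin (u x)).
  move: (cos (u x)) (sin (u x)) C S => c s C S h1 h2 h3.
  suff : 0 <= (C - c) ^+ 2 + (S - s) ^+ 2 by rewrite !sqrrB; lra.
  by rewrite addr_ge0.
have : (0 <= \int[P]_x ((C ^+ 2 + S ^+ 2 + 1) / 2 + - C * cos (u x) + - S * sin (u x))%:E)%E.
  by apply: integral_ge0 => x _; rewrite lee_fin.
rewrite trig_integral lee_fin mass_probability -/C -/S; nra.
Qed.

(** The real trigonometric polynomial a + Re (k e^{iu}).  With |k| <= a it is
nonnegative, so it falls within the reach of the convolution operators, which act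
on it by multiplying k by the characteristic function. *)
Definition trig (a : R) (k : R[i]) (x : E) : R :=
  a + Re k * cos (u x) + - Im k * sin (u x).

Lemma conv_op_trig (P : probability BE R) a k :
  conv_op P (EFin \o trig a k) = EFin \o trig a (k * char_u P).
Proof.
apply/funext => x; rewrite /conv_op.
have := trig_integral P a (Re k * cos (u x) - Im k * sin (u x))
  (- (Re k * sin (u x)) - Im k * cos (u x)).
rewrite mass_probability mulr1 => H.
transitivity ((a + (Re k * cos (u x) - Im k * sin (u x)) * cos_int P +
  (- (Re k * sin (u x)) - Im k * cos (u x)) * sin_int P)%:E).
  rewrite -H; apply: eq_integral => z _; rewrite /= /trig; congr EFin.
  by rewrite uD cosD sinD; ring.
rewrite /= /trig; congr EFin; case: k {H} => b c; rewrite /char_u.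
have mulcE (x1 y1 x2 y2 : R) : (x1 +i* y1) * (x2 +i* y2) =
    (x1 * x2 - y1 * y2) +i* (x1 * y2 + y1 * x2) by [].
by rewrite mulcE /=; ring.
Qed.

Lemma iter_conv_op_trig (P : probability BE R) a k n :
  iter n (conv_op P) (EFin \o trig a k) = EFin \o trig a (k * char_u P ^+ n).
Proof.
elim: n => [|n IH]; first by rewrite expr0 mulr1.
by rewrite iterS IH conv_op_trig exprSr mulrA.
Qed.

Lemma nonneg_meas_trig a k : (forall x, 0 <= trig a k x) -> nonneg_meas (EFin \o trig a k).
Proof.
move=> t0; split => [|x]; last by rewrite /= lee_fin.
apply/measurable_EFinP; apply: measurable_funD; last exact: measurable_funM.
by apply: measurable_funD => //; exact: measurable_funM.
Qed.

(** Real and imaginary parts are read on the nonnegative functions 1 + cos u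
and 1 + sin u. *)
Lemma char_u_pow (P B : probability BE R) n :
  (forall f, nonneg_meas f -> \int[P]_x f x = iter n (conv_op B) f 0%R)%E ->
  char_u P = char_u B ^+ n.
Proof.
move=> PB.
have H k : (forall x, 0 <= trig 1 k x) ->
    Re k * cos_int P - Im k * sin_int P = Re (k * char_u B ^+ n).
  move=> t0; have := PB _ (nonneg_meas_trig t0); rewrite iter_conv_op_trig.
  rewrite (trig_integral P) mass_probability mulr1 /= /trig additive0 cos0 sin0.
  by rewrite !mulr0 mulr1 addr0 mulNr => -[] /eqP; rewrite -addrA => /eqP/addrI.
have h1 : cos_int P = Re (char_u B ^+ n).
  have := H 1; rewrite mul1r /= mul1r mul0r subr0; apply => x.
  by rewrite /trig /= mul1r oppr0 mul0r addr0 -lerBlDl sub0r cos_geN1.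
have h2 : sin_int P = Im (char_u B ^+ n).
  have := H (0 +i* (-1)).
  have -> : Re ((0 +i* (-1)) * char_u B ^+ n) = Im (char_u B ^+ n).
    case: (char_u B ^+ n) => a b.
    by rewrite -[LHS]/(0 * a - -1 * b) /= mul0r mulN1r opprK add0r.
  rewrite /= mul0r add0r mulN1r opprK; apply => x.
  by rewrite /trig /= mul0r addr0 opprK mul1r -lerBlDl sub0r sin_geN1.
rewrite /char_u h1 h2; by case: (_ ^+ n).
Qed.

(** The lower bound [cpoisson_ge] applied to the four nonnegative functions
1 + cos u, 1 - cos u, 1 + sin u, 1 - sin u gives two-sided estimates of the
characteristic function, with an error quadratic in the mass. *)
Lemma char_u_cpoisson_small (B : {finite_measure set BE -> \bar R}) :
  `|Re (char_u (cpoisson dq B)) - 1 - (cos_int B - mass B)| <= 2 * mass B ^+ 2 /\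
  `|Im (char_u (cpoisson dq B)) - sin_int B| <= 2 * mass B ^+ 2.
Proof.
set b := mass B; have b0 : 0 <= b by exact: mass_ge0.
set P := cpoisson dq B.
have cos1 x : -1 <= cos (u x) <= 1 by rewrite cos_geN1 cos_le1.
have sin1 x : -1 <= sin (u x) <= 1 by rewrite sin_geN1 sin_le1.
have t_ge0 k x : k \in [:: 1; -1; 0 +i* 1; 0 +i* -1] -> 0 <= trig 1 k x.
  have /andP[c1 c2] := cos1 x; have /andP[s1 s2] := sin1 x.
  by rewrite !inE => /or4P[] /eqP ->; rewrite /trig /=; lra.
have int_ge0 k : k \in [:: 1; -1; 0 +i* 1; 0 +i* -1] ->
    0 <= b + Re k * cos_int B - Im k * sin_int B.
  move=> kin; have : (0 <= \int[B]_x (trig 1 k x)%:E)%E.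
    by apply: integral_ge0 => x _; rewrite lee_fin t_ge0.
  by rewrite trig_integral lee_fin mul1r mulNr.
have H k : k \in [:: 1; -1; 0 +i* 1; 0 +i* -1] ->
    (1 - b) * (1 + Re k + b + Re k * cos_int B - Im k * sin_int B) <=
    1 + Re k * cos_int P - Im k * sin_int P.
  move=> kin; have t0 x : 0 <= trig 1 k x by exact: t_ge0.
  have := cpoisson_ge dq B (nonneg_meas_trig t0).
  rewrite !(trig_integral) mass_probability mulr1 /= /trig additive0 cos0 sin0.
  rewrite !mulr0 mulr1 addr0 -EFinD -EFinM lee_fin !mulNr mul1r -/b => h.
  apply: le_trans h; rewrite !addrA ler_wpM2r//.
    have := int_ge0 k kin; have := t0 0; rewrite /trig additive0 cos0 sin0; lra.
  by have := expR_ge1Dx (- b).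
have [m1 m2 m3 m4] : [/\ 1 \in [:: 1; -1; 0 +i* 1; 0 +i* (-1 : R)],
  -1 \in [:: 1; -1; 0 +i* 1; 0 +i* (-1 : R)],
  0 +i* 1 \in [:: 1; -1; 0 +i* 1; 0 +i* (-1 : R)] &
  0 +i* -1 \in [:: 1; -1; 0 +i* 1; 0 +i* (-1 : R)]].
  by split; rewrite !inE eqxx ?orbT.
have := H _ m1; have := H _ m2; have := H _ m3; have := H _ m4.
have := int_ge0 _ m1; have := int_ge0 _ m2.
have := int_ge0 _ m3; have := int_ge0 _ m4.
rewrite /= !ler_norml => i4 i3 i2 i1 h4 h3 h2 h1; split; apply/andP; split; nra.
Qed.

Lemma trig_int_mscale (A : {finite_measure set BE -> \bar R}) (r : {nonneg R}) :
  let B := [the {finite_measure set BE -> \bar R} of mscale r A] in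
  [/\ mass B = r%:num * mass A, cos_int B = r%:num * cos_int A &
      sin_int B = r%:num * sin_int A].
Proof.
move=> B.
have mB : mass B = r%:num * mass A.
  by apply: EFin_inj; rewrite EFinM !massE.
have H k : (forall x, 0 <= trig 1 k x) ->
    mass B + Re k * cos_int B - Im k * sin_int B =
    r%:num * (mass A + Re k * cos_int A - Im k * sin_int A).
  move=> t0; apply: EFin_inj.
  have [mt t0'] := nonneg_meas_trig t0.
  have := trig_integral B 1 (Re k) (- Im k); rewrite mul1r !mulNr => <-.
  have := trig_integral A 1 (Re k) (- Im k); rewrite mul1r !mulNr EFinM => <-.
  by rewrite -(ge0_integral_mscale A measurableT r mt).
split => //.
  have := H 1; rewrite /= !mul1r !mul0r !subr0 => /(_ _) h.
  have : mass B + cos_int B = r%:num * (mass A + cos_int A).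
    apply: h => x; rewrite /trig /= mul1r oppr0 mul0r addr0.
    by rewrite -lerBlDl sub0r cos_geN1.
  by rewrite mB mulrDr => /addrI.
have := H (0 +i* -1); rewrite /= !mul0r !addr0 !mulN1r !opprK => h.
have : mass B + sin_int B = r%:num * (mass A + sin_int A).
  apply: h => x; rewrite /trig /= mul0r addr0 opprK mul1r.
  by rewrite -lerBlDl sub0r sin_geN1.
by rewrite mB mulrDr => /addrI.
Qed.

(** The law with jump measure A is the n-th convolution power of the one with
jump measure A / n, whose characteristic function is known up to O(1/n^2). *)
Lemma char_u_cpoisson (A : {finite_measure set BE -> \bar R}) :
  char_u (cpoisson dq A) = cexp ((cos_int A - mass A) +i* sin_int A).
Proof.
pose r n : {nonneg R} := NngNum (harmonic_ge0 n : 0 <= n.+1%:R^-1 :> R).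
pose B n := [the {finite_measure set BE -> \bar R} of mscale (r n) A].
have nr n : n.+1%:R * (r n)%:num = 1 :> R by rewrite /= divff// pnatr_eq0.
have small (v w : nat -> R) (l : R) : (forall n, v n = (r n)%:num * l) ->
    (forall n, `|w n - v n| <= 2 * ((r n)%:num * mass A) ^+ 2) ->
    n.+1%:R * w n @[n --> \oo] --> l.
  move=> vE wv; apply/cvgrPdist_le => e e0.
  have c0 : (2 * mass A ^+ 2 * n.+1%:R^-1) @[n --> \oo] --> (0 : R).
    rewrite -(mulr0 (2 * mass A ^+ 2)); apply: cvgM; first exact: cvg_cst.
    exact: cvg_harmonic.
  move/cvgrPdist_le : c0 => /(_ e e0); apply: filterS => n.
  rewrite sub0r normrN ger0_norm ?mulr_ge0 ?mass_ge0// => he.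
  apply: le_trans he.
  have -> : l - n.+1%:R * w n = n.+1%:R * (v n - w n).
    by rewrite mulrBr vE mulrA nr mul1r.
  rewrite normrM normr_nat distrC.
  apply: (@le_trans _ _ (n.+1%:R * (2 * ((r n)%:num * mass A) ^+ 2))).
    by rewrite ler_wpM2l.
  rewrite le_eqVlt; apply/orP; left; apply/eqP.
  transitivity (n.+1%:R * (r n)%:num * (2 * mass A ^+ 2 * (r n)%:num)); first by ring.
  by rewrite nr mul1r.
apply: (@cexp_roots _ (fun n => char_u (cpoisson dq (B n)))).
- have := trig_integral A 1 (-1) 0; rewrite /= !mul1r mul0r addr0 => h.
  have : (0 <= \int[A]_x (1 + -1 * cos (u x) + 0 * sin (u x))%:E)%E.
    apply: integral_ge0 => x _; rewrite lee_fin mul0r addr0 mulN1r subr_ge0.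
    exact: cos_le1.
  by rewrite h lee_fin; lra.
- move=> n; apply: char_u_pow => f mf.
  rewrite -(cpoisson_natmul dq (S := A))//.
    by apply: eq_integral => x _; rewrite add0r.
  by move=> U mU; rewrite /= /mscale /= muleA -EFinM divff ?mul1e// pnatr_eq0.
- by move=> n; exact: normc_char_u.
- apply: (small (fun n => cos_int (B n) - mass (B n))).
    by move=> n; have [-> -> _] := trig_int_mscale A (r n); rewrite mulrBr.
  move=> n; have [<- _ _] := trig_int_mscale A (r n).
  by have [] := char_u_cpoisson_small (B n).
- apply: (small (fun n => sin_int (B n))).
    by move=> n; have [_ _ ->] := trig_int_mscale A (r n).
  move=> n; have [<- _ _] := trig_int_mscale A (r n).
  by have [] := char_u_cpoisson_small (B n).
Qed.

Lemma weak_limit_trig (al : nat -> probability BE R) (a : probability BE R) :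
  weak_limit al a ->
  cos_int (al k) @[k --> \oo] --> cos_int a /\
  sin_int (al k) @[k --> \oo] --> sin_int a.
Proof.
move=> ala.
(* Test functions take values in [0,1], hence the affine change of g. *)
have half (g : E -> R) (G : probability BE R -> R) :
    (forall x, -1 <= g x <= 1) -> lip L g ->
    (forall P : probability BE R,
      (\int[P]_x (2^-1 + 2^-1 * g x)%:E)%E = (2^-1 + 2^-1 * G P)%:E) ->
    G (al k) @[k --> \oo] --> G a.
  move=> g1 gL gG.
  have : (\int[al k]_x (2^-1 + 2^-1 * g x)%:E)%E @[k --> \oo] -->
      (\int[a]_x (2^-1 + 2^-1 * g x)%:E)%E.
    apply: (ala L (fun _ x => 2^-1 + 2^-1 * g x)).
    - by move=> _ x; have := g1 x; lra.
    - move=> _ x y; rewrite opprD addrACA subrr add0r -mulrBr normrM.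
      apply: le_trans (gL x y); rewrite ger0_norm// ler_piMl//.
      by rewrite invf_le1// ler1n.
    - by move=> x; exact: cvg_cst.
  rewrite gG; under eq_fun do rewrite gG.
  move/fine_cvg => /= h.
  have GE P : G P = 2 * (2^-1 + 2^-1 * G P) - 1 by field.
  rewrite (GE a) (_ : (fun k => _) = (fun k => 2 * (2^-1 + 2^-1 * G (al k)) - 1)).
    by apply: cvgB; [apply: cvgM; [exact: cvg_cst|exact: h]|exact: cvg_cst].
  by apply/funext => k; exact: GE.
split; [apply: (half (fun x => cos (u x)) (fun P => cos_int P)) |
  apply: (half (fun x => sin (u x)) (fun P => sin_int P))].
- by move=> x; rewrite cos_geN1 cos_le1.
- exact: cos_u_lip.
- move=> P; have := trig_integral P 2^-1 2^-1 0.
  rewrite mass_probability mulr1 mul0r addr0 => <-.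
  by apply: eq_integral => x _; rewrite mul0r addr0.
- by move=> x; rewrite sin_geN1 sin_le1.
- exact: sin_u_lip.
- move=> P; have := trig_integral P 2^-1 0 2^-1.
  rewrite mass_probability mulr1 mul0r addr0 => <-.
  by apply: eq_integral => x _; rewrite mul0r addr0.
Qed.

End characteristic_functions.

(** * The mean of a vector with integrable norm *)

Section vector_mean.
Local Open Scope ereal_scope.
Context {R : realType} {E : completeNormedModType R}.
Variables (q : nat -> E) (dq : dense_seq q).
Notation BE := (borel E).
Variables (N : {measure set BE -> \bar R}) (D : set BE) (mD : measurable D).
Hypothesis Dfin : \int[N]_(x in D) `|x : E|%:E < +oo.

Definition atom (i : nat) : E := if i is j.+1 then q j else 0%R.

(** Index of a closest point to x among 0, q 0, ..., q (m-1).  Having 0 among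
the candidates makes the approximation at most twice as large as x, hence
integrable, and restricts the nonzero values to sets of finite measure. *)
Fixpoint best (m : nat) (x : E) : nat :=
  if m is k.+1 then
    (if `|x - q k| < `|x - atom (best k x)| then k.+1 else best k x)%R
  else 0%N.

Lemma best_le m x : (best m x < m.+1)%N.
Proof. by elim: m => //= m IH; case: ifP => // _; rewrite (leq_trans IH). Qed.

Lemma best_norm m x : (`|x - atom (best m x)| <= `|x|)%R.
Proof.
elim: m => [|m IH] /=; first by rewrite subr0.
by case: ifP => // h; rewrite (le_trans (ltW h)).
Qed.

Lemma best_leq m k x : (m <= k)%N ->
  (`|x - atom (best k x)| <= `|x - atom (best m x)|)%R.
Proof.
elim: k => [|k IH]; first by rewrite leqn0 => /eqP ->.
rewrite leq_eqVlt => /orP[/eqP ->//|mk] /=.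
by case: ifP => [h|_]; [apply: le_trans (ltW h) _|]; exact: IH.
Qed.

Lemma best_cvg x : `|x - atom (best m x)|%R @[m --> \oo] --> (0 : R)%R.
Proof.
apply/cvgrPdist_lt => e e0; have [j hj] := dq x e0; near=> m.
rewrite sub0r normrN normr_id.
have jm : (j.+1 <= m)%N by near: m; exists j.+1.
apply: le_lt_trans (best_leq x jm) _ => /=.
case: ifP => // /negbT; rewrite -leNgt => h.
by apply: le_lt_trans h hj.
Unshelve. all: by end_near. Qed.

Lemma measurable_atom_dist (f : BE -> nat) :
  (forall i, measurable [set x | f x = i]) ->
  measurable_fun setT ((fun x => `|x - atom (f x)|%R) : BE -> R).
Proof.
move=> mf; have mdist v : measurable_fun setT ((fun x : E => `|x - v|%R) : BE -> R).
  apply: continuous_borel_measurable => x.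
  by apply: cvg_norm; apply: cvgB; [exact: cvg_id|exact: cvg_cst].
move=> _ U mU; rewrite setTI.
rewrite (_ : _ @^-1` U = \bigcup_i ([set x | f x = i] `&`
    ((fun x : E => `|x - atom i|%R) @^-1` U))).
  apply: bigcup_measurable => i _; apply: measurableI => //.
  by rewrite -[X in measurable X]setTI; exact: mdist.
by apply/seteqP; split => [x Ux|x [i _ /= [<-]]//]; exists (f x).
Qed.

Lemma measurable_best m i : measurable ([set x | best m x = i] : set BE).
Proof.
elim: m i => [|m IH] i.
  have [->|i0] := eqVneq i 0%N.
    by rewrite (_ : [set _ | _] = setT)//; apply/seteqP; split.
  rewrite (_ : [set _ | _] = set0)//; apply/seteqP; split => // x /= xi.
  by move: i0; rewrite -xi.
have mB : measurable ([set x : E | (`|x - q m| < `|x - atom (best m x)|)%R] : set BE).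
  rewrite -[X in measurable X]setTI.
  apply: (@measurable_fun_ltr _ BE R setT (fun x : E => `|x - q m|%R)
    (fun x : E => `|x - atom (best m x)|%R) _ _ measurableT [set true]) => //.
    apply: continuous_borel_measurable => x.
    by apply: cvg_norm; apply: cvgB; [exact: cvg_id|exact: cvg_cst].
  exact: measurable_atom_dist.
pose B := [set x : E | (`|x - q m| < `|x - atom (best m x)|)%R].
rewrite (_ : [set _ | _] = (B `&` [set _ | m.+1 = i]) `|`
    (~` B `&` [set x | best m x = i])).
  apply: measurableU; apply: measurableI => //; last exact: measurableC.
  have [->|mi] := eqVneq m.+1 i.
    by rewrite (_ : [set _ | _] = setT)//; apply/seteqP; split.
  rewrite (_ : [set _ | _] = set0)//; apply/seteqP; split => // x /= xi.
  by move: mi; rewrite xi eqxx.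
apply/seteqP; split => x; rewrite /B /=.
  by case: ifP => h; [left|right; split => //; rewrite h].
by case=> -[]; [move=> ->|move/negP/negbTE => ->].
Qed.

Let cell m i : set BE := [set x | best m x = i] `&` D.

Let mcell m i : measurable (cell m i).
Proof. by apply: measurableI => //; exact: measurable_best. Qed.

Let cell_fin m i : atom i != 0%R -> N (cell m i) < +oo.
Proof.
move=> i0; have a0 : (0 < `|atom i|)%R by rewrite normr_gt0.
have mnorm : measurable_fun D (fun x : BE => `|x : E|%:E).
  apply: measurable_funTS; apply/measurable_EFinP; exact: measurable_norm_borel.
have : (`|atom i| / 2)%:E * N (cell m i) <= \int[N]_(x in D) `|x : E|%:E.
  have -> : (`|atom i| / 2)%:E * N (cell m i) =
      \int[N]_(x in cell m i) cst (`|atom i| / 2)%:E x.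
    by rewrite integral_cst.
  apply: (@le_trans _ _ (\int[N]_(x in cell m i) `|x : E|%:E)).
    apply: ge0_le_integral => //.
    - by move=> x _; rewrite lee_fin divr_ge0.
    - by apply: measurable_funS mnorm => //; exact: subIsetr.
    move=> x [/= xi _]; rewrite lee_fin.
    have := best_norm m x; rewrite xi => h.
    rewrite ler_pdivrMr// mulr_natr mulr2n.
    apply: (@le_trans _ _ (`|x| + `|x - atom i|)%R); last by rewrite lerD2l.
    by rewrite -[leLHS](_ : `|x - (x - atom i)| = _)%R ?ler_normB// subKr.
  by apply: ge0_subset_integral => //; exact: subIsetr.
move/le_lt_trans => /(_ _ Dfin).
rewrite !ltey; apply: contra => /eqP ->.
by rewrite gt0_muley// lte_fin divr_gt0.
Qed.

(** The integral of the simple function x |-> atom (best m x). *)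
Definition mean_approx m : E :=
  (\sum_(i < m.+1) fine (N (cell m i)) *: atom i)%R.

(** The common refinement of the partitions of two approximation levels, on
which both simple functions are constant. *)
Let bicell m k i j : set BE := cell m i `&` [set x | best k x = j].

Let mbicell m k i j : measurable (bicell m k i j).
Proof. by apply: measurableI => //; exact: measurable_best. Qed.

Let mean_approx_split m k :
  mean_approx m =
  (\sum_(i < m.+1) \sum_(j < k.+1) fine (N (bicell m k i j)) *: atom i)%R.
Proof.
apply: eq_bigr => i _; rewrite -scaler_suml.
have [->|i0] := eqVneq (atom i) 0%R; first by rewrite !scaler0.
congr (_ *: _)%R; apply: EFin_inj.
have bfin j : N (bicell m k i j) \is a fin_num.
  rewrite ge0_fin_numE//; apply: le_lt_trans (cell_fin m i0).
  by apply: le_measure; rewrite ?inE//; exact: subIsetl.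
rewrite fineK; last by rewrite ge0_fin_numE// cell_fin.
rewrite -sumEFin; under eq_bigr do rewrite fineK//.
transitivity (N (\big[setU/set0]_(j < k.+1) bicell m k i j)).
  congr (N _); rewrite -(bigcup_mkord _ (bicell m k i)).
  apply/seteqP; split => x; last by case=> j _ [].
  by move=> xm; exists (best k x) => //=; exact: best_le.
rewrite measure_bigsetU_ord//.
apply/trivIsetP => j l _ _ /eqP jl; apply/seteqP; split => // x [[_ /= h1] [_ /= h2]].
by apply: jl; apply/val_inj; rewrite /= -h1 -h2.
Qed.

Let bicellC m k i j : bicell m k i j = bicell k m j i.
Proof. by rewrite /bicell /cell; apply/seteqP; split => x /= [[? ?] ?]. Qed.

Let mdist m : measurable_fun setT ((fun x : BE => `|x - atom (best m x)|%R) : BE -> R).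
Proof. by apply: measurable_atom_dist => //; exact: measurable_best. Qed.

Let mean_approx_sub m k :
  (`|mean_approx m - mean_approx k|%R)%:E <=
  \int[N]_(x in D) `|(x : E) - atom (best m x)|%:E +
  \int[N]_(x in D) `|(x : E) - atom (best k x)|%:E.
Proof.
pose c (i j : nat) := `|atom i - atom j|%R.
have c0 i j : (0 <= c i j)%R by exact: normr_ge0.
have -> : (mean_approx m - mean_approx k = \sum_(i < m.+1) \sum_(j < k.+1)
    fine (N (bicell m k i j)) *: (atom i - atom j))%R.
  rewrite (mean_approx_split m k) (mean_approx_split k m).
  rewrite [X in (_ - X)%R]exchange_big /= -sumrB; apply: eq_bigr => i _.
  by rewrite -sumrB; apply: eq_bigr => j _; rewrite scalerBr (bicellC k m).
apply: (@le_trans _ _ (\sum_(i < m.+1) \sum_(j < k.+1)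
    (c i j)%:E * N (bicell m k i j))).
  apply: (@le_trans _ _ (\sum_(i < m.+1) \sum_(j < k.+1)
      (c i j * fine (N (bicell m k i j)))%:E)).
    have -> : \sum_(i < m.+1) \sum_(j < k.+1) (c i j * fine (N (bicell m k i j)))%:E =
        (\sum_(i < m.+1) \sum_(j < k.+1) (c i j * fine (N (bicell m k i j))))%R%:E.
      by rewrite -sumEFin; apply: eq_bigr => i _; rewrite -sumEFin.
    rewrite lee_fin; apply: le_trans (ler_norm_sum _ _ _) _.
    apply: ler_sum => i _; apply: le_trans (ler_norm_sum _ _ _) _.
    by apply: ler_sum => j _; rewrite normrZ ger0_norm ?fine_ge0// mulrC.
  apply: lee_sum => i _; apply: lee_sum => j _.
  rewrite EFinM; apply: lee_wpmul2l; first by rewrite lee_fin.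
  have [f|] := boolP (N (bicell m k i j) \is a fin_num); first by rewrite fineK.
  rewrite ge0_fin_numE// -leNgt leye_eq => /eqP ->.
  exact: leey.
rewrite -ge0_integralD//; last 2 first.
- by apply: measurable_funTS; exact/measurable_EFinP.
- by apply: measurable_funTS; exact/measurable_EFinP.
pose g (i j : nat) (x : BE) := (c i j)%:E * (\1_(bicell m k i j) x)%:E.
have mg i j : measurable_fun D (g i j).
  apply: measurable_funTS; apply: measurable_funeM; apply/measurable_EFinP.
  exact: measurable_indic.
have g0 i j x : 0 <= g i j x by rewrite mule_ge0// lee_fin.
have -> : \sum_(i < m.+1) \sum_(j < k.+1) (c i j)%:E * N (bicell m k i j) =
    \int[N]_(x in D) \sum_(i < m.+1) \sum_(j < k.+1) g i j x.
  rewrite ge0_integral_sum//; last 2 first.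
  - by move=> i; exact: emeasurable_sum.
  - by move=> i x _; exact: sume_ge0.
  apply: eq_bigr => i _; rewrite ge0_integral_sum//; apply: eq_bigr => j _.
  rewrite /g ge0_integralZl//; last 2 first.
  - by apply: measurable_funTS; apply/measurable_EFinP; exact: measurable_indic.
  - by rewrite lee_fin.
  rewrite integral_indic//; congr (_ * N _).
  by rewrite setIidl// => x [[_ ]].
apply: ge0_le_integral => //.
- by move=> x _; apply: sume_ge0 => i _; exact: sume_ge0.
- by apply: emeasurable_sum => i; exact: emeasurable_sum.
- by apply: emeasurable_funD; apply: measurable_funTS; exact/measurable_EFinP.
move=> x Dx; rewrite (bigD1 (Ordinal (best_le m x)))//=.
rewrite (bigD1 (Ordinal (best_le k x)))//=.
rewrite [X in (_ + X) + _]big1 ?adde0; last first.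
  move=> j jk; rewrite /g indicE memNset ?mule0// => -[_ /= h].
  by move/eqP: jk; apply; apply/val_inj; rewrite /= h.
rewrite [X in _ + X]big1 ?adde0; last first.
  move=> i im; apply: big1 => j _; rewrite /g indicE memNset ?mule0// => -[[/= h _] _].
  by move/eqP: im; apply; apply/val_inj; rewrite /= h.
rewrite /g indicE mem_set ?mule1//.
rewrite -EFinD lee_fin /c [leRHS]addrC.
have -> : (atom (best m x) - atom (best k x) =
    ((x : E) - atom (best k x)) - ((x : E) - atom (best m x)))%R.
  by rewrite opprB [RHS]addrC addrA subrK.
exact: ler_normB.
Qed.

Let mnormD : measurable_fun D (fun x : BE => `|x : E|%:E).
Proof.
apply: measurable_funTS; apply/measurable_EFinP; exact: measurable_norm_borel.
Qed.

Let inormD : N.-integrable D (fun x : BE => `|x : E|%:E).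
Proof.
apply/integrableP; split => //.
by under eq_integral do rewrite gee0_abs ?lee_fin//.
Qed.

Let dist_cvg0 :
  \int[N]_(x in D) `|(x : E) - atom (best m x)|%:E @[m --> \oo] --> 0.
Proof.
have [] := @dominated_convergence _ BE R N D mD
  (fun m x => `|(x : E) - atom (best m x)|%:E) (cst 0) (fun x => `|x : E|%:E).
- by move=> m; apply: measurable_funTS; exact/measurable_EFinP.
- exact: measurable_cst.
- by apply: aeW => x _; apply: cvg_EFin; [exact: nearW|exact: best_cvg].
- exact: inormD.
- by apply: aeW => x m _; rewrite /= lee_fin normr_id; exact: best_norm.
by rewrite integral0.
Qed.

(** A Cauchy sequence: the integrals of two simple functions differ by at most
the sum of their L1 distances to the identity. *)
Lemma mean_approx_cvg : cvgn mean_approx.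
Proof.
pose r m := fine (\int[N]_(x in D) `|(x : E) - atom (best m x)|%:E).
have rE m : (r m)%:E = \int[N]_(x in D) `|(x : E) - atom (best m x)|%:E.
  rewrite /r fineK// ge0_fin_numE; last by apply: integral_ge0 => x _; rewrite lee_fin.
  apply: le_lt_trans Dfin; apply: ge0_le_integral => //.
  - by apply: measurable_funTS; exact/measurable_EFinP.
  - by move=> x _; rewrite lee_fin best_norm.
have r0 : r m @[m --> \oo] --> (0 : R)%R by exact: (fine_cvg dist_cvg0).
apply/cauchy_cvgP; apply: cauchy_exP => e e0.
have e2 : (0 < e / 2)%R by rewrite divr_gt0.
have r_ge0 m : (0 <= r m)%R by rewrite /r fine_ge0// integral_ge0.
have [m _ hm] : \forall m \near \oo, (r m < e / 2)%R.
  move/cvgrPdist_lt : r0 => /(_ _ e2); apply: filterS => m.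
  by rewrite sub0r normrN ger0_norm.
exists (mean_approx m); exists m => // k mk /=; rewrite -ball_normE /=.
rewrite -lte_fin; apply: le_lt_trans (mean_approx_sub m k) _.
rewrite -!rE -EFinD lte_fin (splitr e) ltrD//; apply: hm => //=.
Qed.

Lemma mean_approx_apply (g : E -> R) (C : R) m :
  g 0%R = 0%R -> (forall x, `|g x| <= C * `|x|)%R ->
  \int[N]_(x in D) (g (atom (best m x)))%:E =
  (\sum_(i < m.+1) fine (N (cell m i)) * g (atom i))%:E.
Proof.
move=> g0 gC.
pose h (i : nat) (x : BE) := (g (atom i))%:E * (\1_(cell m i) x)%:E.
have ih i : N.-integrable D (h i).
  rewrite /h; have [->|i0] := eqVneq (atom i) 0%R.
    by rewrite g0; under eq_fun do rewrite mul0e; exact: integrable0.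
  apply: integrableZl => //; apply/integrableP; split.
    by apply: measurable_funTS; apply/measurable_EFinP; exact: measurable_indic.
  under eq_integral do rewrite gee0_abs ?lee_fin//.
  rewrite integral_indic//; apply: le_lt_trans (cell_fin m i0).
  by apply: le_measure; rewrite ?inE//; exact: measurableI.
transitivity (\int[N]_(x in D) \sum_(i < m.+1) h i x).
  apply: eq_integral => x; rewrite inE => Dx.
  rewrite (bigD1 (Ordinal (best_le m x)))//= big1 ?adde0.
    by rewrite /h indicE mem_set ?mule1//; split.
  move=> i im; rewrite /h indicE memNset ?mule0// => -[/= hi _].
  by move/eqP: im; apply; apply/val_inj; rewrite /= hi.
rewrite integral_sum// -sumEFin; apply: eq_bigr => i _.
rewrite /h; have [->|i0] := eqVneq (atom i) 0%R.
  by rewrite g0 mulr0; under eq_integral do rewrite mul0e; rewrite integral0.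
rewrite integralZl//; last first.
  apply/integrableP; split.
    by apply: measurable_funTS; apply/measurable_EFinP; exact: measurable_indic.
  under eq_integral do rewrite gee0_abs ?lee_fin//.
  rewrite integral_indic//; apply: le_lt_trans (cell_fin m i0).
  by apply: le_measure; rewrite ?inE//; exact: measurableI.
rewrite integral_indic// (_ : cell m i `&` D = cell m i); last first.
  by apply/setIidl => x [].
rewrite mulrC EFinM fineK// ge0_fin_numE//; exact: cell_fin.
Qed.

(** The limit of the integrals of simple functions, as for the Bochner
integral; a continuous functional commutes with the approximation. *)
Lemma vector_mean_exists : exists a : E, forall (y : dual E) (C : R),
  (forall x, `|y x| <= C * `|x|)%R ->
  (y a)%:E = \int[N]_(x in D) (y x)%:E.
Proof.
exists (limn mean_approx) => y C yC.
have C0 : (0 <= `|C|)%R by [].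
have yC' x : (`|y x| <= `|C| * `|x|)%R.
  by apply: le_trans (yC x) _; rewrite ler_wpM2r// ler_norm.
have yE m : (y (mean_approx m))%:E = \int[N]_(x in D) (y (atom (best m x)))%:E.
  rewrite (@mean_approx_apply (y : E -> R) C)//; last exact: linear0.
  congr EFin; rewrite /mean_approx linear_sum; apply: eq_bigr => i _.
  by rewrite linearZ.
have c1 : (y (mean_approx m))%:E @[m --> \oo] --> (y (limn mean_approx))%:E.
  apply: cvg_EFin; first exact: nearW.
  apply: continuous_cvg; first exact: dual_continuous.
  exact: mean_approx_cvg.
have my : measurable_fun setT (y : BE -> R).
  by apply: continuous_borel_measurable; exact: dual_continuous.
have c2 : (y (mean_approx m))%:E @[m --> \oo] --> \int[N]_(x in D) (y x)%:E.
  rewrite (_ : (fun m => _) = (fun m => \int[N]_(x in D) (y (atom (best m x)))%:E)); last first.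
    by apply/funext => m; exact: yE.
  have [] := @dominated_convergence _ BE R N D mD
    (fun m x => (y (atom (best m x)))%:E) (fun x => (y x)%:E)
    (fun x => (`|C| * 2)%:E * `|x : E|%:E) => //.
  - move=> m; apply: measurable_funTS; apply/measurable_EFinP.
    move=> _ U mU; rewrite setTI.
    rewrite (_ : _ @^-1` U = \bigcup_(i in [set i | U (y (atom i))]) [set x | best m x = i]).
      by apply: bigcup_measurable => i _; exact: measurable_best.
    by apply/seteqP; split => [x Ux|x [i Ui /= ->]//]; exists (best m x).
  - by apply: measurable_funTS; exact/measurable_EFinP.
  - apply: aeW => x _; apply: cvg_EFin; first exact: nearW.
    apply: continuous_cvg; first exact: dual_continuous.
    apply/cvgrPdist_lt => e e0; move/cvgrPdist_lt: (best_cvg x) => /(_ e e0).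
    by apply: filterS => m; rewrite sub0r normrN normr_id.
  - by apply: integrableZl => //; exact: inormD.
  - apply: aeW => x m _; rewrite /= -EFinM lee_fin.
    apply: le_trans (yC' _) _; rewrite -mulrA ler_wpM2l// mulr_natl mulr2n.
    apply: (@le_trans _ _ `|(x : E) - ((x : E) - atom (best m x))|%R).
      by rewrite subKr.
    by apply: le_trans (ler_normB _ _) _; rewrite lerD2l best_norm.
apply: (cvg_unique _ c1) => //.
Qed.

End vector_mean.

(** * Compound Poisson approximation of a measure integrating the truncated norm *)

Section mrestr_integral.
Local Open Scope ereal_scope.
Context d (T : measurableType d) {R : realType}.
Variables (N : {measure set T -> \bar R}) (D : set T) (mD : measurable D).

Lemma ge0_integral_mrestr f : measurable_fun setT f -> (forall x, 0 <= f x) ->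
  \int[mrestr N mD]_x f x = \int[N]_(x in D) f x.
Proof.
move=> mf f0; rewrite -(setUv D) ge0_integral_setU//; last 3 first.
- exact: measurableC.
- by rewrite setUv.
- by apply/disj_setPCl.
rewrite [X in _ + X](_ : _ = 0) ?adde0.
  apply: eq_measure_integral => A mA AD; rewrite /= /mrestr.
  by rewrite (setIidl AD).
rewrite -(integral_measure_zero (~` D) f); apply: eq_measure_integral => A mA AD.
rewrite /= /mrestr (_ : A `&` D = set0) ?measure0//.
by apply/seteqP; split => // x [/AD].
Qed.

Lemma integral_mrestr f : measurable_fun setT f ->
  \int[mrestr N mD]_x f x = \int[N]_(x in D) f x.
Proof.
move=> mf; rewrite [LHS]integralE [in RHS]integralE.
rewrite !ge0_integral_mrestr//.
- exact: measurable_funeneg.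
- exact: measurable_funepos.
Qed.

End mrestr_integral.

Section levy_restrictions.
Local Open Scope ereal_scope.
Local Open Scope complex_scope.
Context {R : realType} {E : completeNormedModType R}.
Variables (q : nat -> E) (dq : dense_seq q).
Notation BE := (borel E).

Definition min1 (x : E) : R := Num.min 1%R `|x|%R.

Lemma min1_ge0 x : (0 <= min1 x)%R.
Proof. by rewrite le_min ler01 normr_ge0. Qed.

Lemma measurable_min1 : measurable_fun setT (min1 : BE -> R).
Proof.
apply: measurable_minr; first exact: measurable_cst.
exact: measurable_norm_borel.
Qed.

Lemma nonneg_meas_min1 : nonneg_meas (EFin \o min1).
Proof.
split; last by move=> x; rewrite /= lee_fin min1_ge0.
by apply/measurable_EFinP; exact: measurable_min1.
Qed.

Lemma min1D x y : (min1 (x + y) <= min1 x + min1 y)%R.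
Proof.
rewrite /min1; have := ler_normD x y.
have := normr_ge0 x; have := normr_ge0 y.
by case: (lerP 1%R `|x + y|%R); case: (lerP 1%R `|x|%R); case: (lerP 1%R `|y|%R); lra.
Qed.

Definition outer (k : nat) : set BE := [set x : E | (1 < k%:R * `|x|)%R].

Lemma measurable_outer k : measurable (outer k).
Proof.
have mk : measurable_fun setT ((fun x => k%:R * `|x|)%R : BE -> R).
  by apply: measurable_funM; [exact: measurable_cst|exact: measurable_norm_borel].
rewrite (_ : outer k = (fun x : BE => (k%:R * `|x : E|)%R) @^-1` `]1%R, +oo[%classic).
  by rewrite -[X in measurable X]setTI; exact: mk.
by apply/seteqP; split => x; rewrite /outer /= in_itv /= andbT.
Qed.

Lemma outer_le k m : (k <= m)%N -> outer k `<=` outer m.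
Proof.
move=> km x; rewrite /outer /= => h; apply: lt_le_trans h _.
by rewrite ler_wpM2r// ler_nat.
Qed.

Lemma outer0 : outer 0 = set0.
Proof. by apply/seteqP; split => // x; rewrite /outer /= mul0r ltr10. Qed.

Lemma outer_neq0 k x : outer k x -> x <> (0%R : E).
Proof. by rewrite /outer /= => + x0; rewrite x0 normr0 mulr0 ltr10. Qed.

Lemma near_outer (x : E) : x <> 0%R -> \forall k \near \oo, outer k x.
Proof.
move=> /eqP x0; near=> k; rewrite /outer /= -ltr_pdivrMr ?normr_gt0//.
by near: k; exact: nbhs_infty_gtr.
Unshelve. all: by end_near. Qed.

Lemma measurable_neq0 : measurable ([set~ (0%R : E)] : set BE).
Proof.
apply: measurableC; rewrite (_ : [set 0%R] = ~` (\bigcup_k outer k)).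
  by apply: measurableC; apply: bigcup_measurable => k _; exact: measurable_outer.
apply/seteqP; split => x /=.
  by move=> -> [k _ /outer_neq0].
move=> h; apply: contrapT => x0; apply: h.
by have [k _ /(_ k (leqnn k)) hk] := near_outer x0; exists k.
Qed.

(** The points that enter [outer k] at the next step: 1/(k+1) < |x| <= 1/k. *)
Definition annulus k : set BE := outer k.+1 `\` outer k.

Lemma measurable_annulus k : measurable (annulus k).
Proof. by apply: measurableD; exact: measurable_outer. Qed.

Section one_levy_measure.
Variable N : {measure set BE -> \bar R}.
Hypothesis Nfin : \int[N]_x (min1 x)%:E < +oo.

(** Markov's inequality. *)
Lemma outer_fin k : N (outer k) < +oo.
Proof.
have h : N (outer k) <= k%:R%:E * \int[N]_x (min1 x)%:E.
  rewrite -ge0_integralZl_EFin//; last 2 first.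
  - by move=> x _; rewrite lee_fin min1_ge0.
  - by have [] := nonneg_meas_min1.
  apply: (@le_trans _ _ (\int[N]_(x in outer k) (k%:R%:E * (min1 x)%:E))).
    rewrite -[leLHS]mul1e -(integral_cst N (measurable_outer k)).
    apply: ge0_le_integral => //.
    - exact: measurable_outer.
    - apply: measurable_funTS; apply: measurable_funeM; by have [] := nonneg_meas_min1.
    - move=> x; rewrite /outer /= -EFinM lee_fin /min1 => h.
      have k1 : (1 <= k%:R :> R)%R.
        by rewrite ler1n lt0n; apply: contraTneq h => ->; rewrite mul0r ltr10.
      by case: (lerP 1%R `|x|%R) => _; [rewrite mulr1|exact: ltW].
  apply: ge0_subset_integral => //.
  - exact: measurable_outer.
  - by apply: measurable_funeM; have [] := nonneg_meas_min1.
  - by move=> x _; rewrite mule_ge0// lee_fin min1_ge0.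
apply: le_lt_trans h _; rewrite lte_mul_pinfty//.
Qed.

Let restr_fin A (mA : measurable A) : N A < +oo -> fin_num_fun (mrestr N mA).
Proof.
move=> Af; apply: lty_fin_num_fun; rewrite /= /mrestr setTI.
exact: Af.
Qed.

Definition outer_measure k := mrestr N (measurable_outer k).
HB.instance Definition _ k := Measure.copy (outer_measure k)
  (mrestr N (measurable_outer k)).
HB.instance Definition _ k := Measure_isFinite.Build _ _ _ (outer_measure k)
  (restr_fin (measurable_outer k) (outer_fin k)).

Definition annulus_measure k := mrestr N (measurable_annulus k).
HB.instance Definition _ k := Measure.copy (annulus_measure k)
  (mrestr N (measurable_annulus k)).

Let annulus_fin k : N (annulus k) < +oo.
Proof.
apply: le_lt_trans (outer_fin k.+1); apply: le_measure; rewrite ?inE.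
- exact: measurable_annulus.
- exact: measurable_outer.
- exact: subDsetl.
Qed.

HB.instance Definition _ k := Measure_isFinite.Build _ _ _ (annulus_measure k)
  (restr_fin (measurable_annulus k) (annulus_fin k)).

Lemma outer_measureS k U : measurable U ->
  outer_measure k.+1 U = outer_measure k U + annulus_measure k U.
Proof.
move=> mU; rewrite /outer_measure /annulus_measure /mrestr -measureU.
- congr (N _); rewrite -setIUr; congr (_ `&` _).
  rewrite /annulus setDUK//; exact: outer_le.
- by apply: measurableI => //; exact: measurable_outer.
- by apply: measurableI => //; exact: measurable_annulus.
- by apply/seteqP; split => // x [[_ h] [_ [_ /(_ h)]]].
Qed.

(** A named probability, because the finiteness of the restricted measures
depends on the integrability hypothesis, which cannot be inferred. *)
Definition compound k : probability BE R :=
  [the probability BE R of cpoisson dq (outer_measure k)].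

(** The laws are those of the partial sums of a walk whose k-th step is
compound Poisson on the k-th annulus; the annuli being disjoint, the truncated
moments of the steps add up to at most the integral of min(1,|x|). *)
Lemma compound_weak_limit : exists mu : probability BE R, weak_limit compound mu.
Proof.
apply: (weak_limit_exists dq (mu := compound)
  (rho := fun k => [the probability BE R of cpoisson dq (annulus_measure k)])).
- move=> f mf.
  transitivity (conv_op (cpoisson dq (outer_measure 0)) f 0%R).
    by apply: eq_integral => x _; rewrite add0r.
  have o0 U : measurable U -> outer_measure 0 U = 0%:R%:E * outer_measure 0 U.
    by move=> _; rewrite mul0e /outer_measure /mrestr outer0 setI0 measure0.
  by rewrite (cpoisson_natmul dq o0 mf).
- move=> n f mf.
  transitivity (conv_op (cpoisson dq (outer_measure n.+1)) f 0%R).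
    by apply: eq_integral => x _; rewrite add0r.
  rewrite (cpoisson_add dq (@outer_measureS n) mf).
  by apply: eq_integral => x _; rewrite add0r.
- apply: le_lt_trans Nfin.
  have minI A (mA : measurable A) : \int[mrestr N mA]_x (min1 x)%:E =
      \int[N]_(x in A) (min1 x)%:E.
    by have [m1 m2] := nonneg_meas_min1; exact: ge0_integral_mrestr.
  have sub A : measurable A ->
      \int[N]_(x in A) (min1 x)%:E <= \int[N]_x (min1 x)%:E.
    move=> mA; apply: ge0_subset_integral => //; first by have [] := nonneg_meas_min1.
    by move=> x _; rewrite lee_fin min1_ge0.
  apply: (@le_trans _ _ (\sum_(k <oo) \int[N]_(x in annulus k) (min1 x)%:E)).
    apply: lee_nneseries => k _.
      by move=> _; apply: integral_ge0 => x _; rewrite lee_fin min1_ge0.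
    have rI := minI _ (measurable_annulus k).
    apply: (@le_trans _ _ (\int[annulus_measure k]_x (min1 x)%:E)); last by rewrite -rI.
    apply: (@cpoisson_subadditive _ _ _ dq (annulus_measure k) min1).
    - exact: measurable_min1.
    - exact: min1_ge0.
    - by rewrite /min1 normr0 min_r.
    - exact: min1D.
    - apply: le_lt_trans Nfin; apply: le_trans (sub _ (measurable_annulus k)).
      by rewrite -rI.
  rewrite -ge0_integral_bigcup.
  - by apply: sub; apply: bigcup_measurable => k _; exact: measurable_annulus.
  - by move=> k; exact: measurable_annulus.
  - by apply: measurable_funTS; have [] := nonneg_meas_min1.
  - by move=> x _; have [_] := nonneg_meas_min1; exact.
  - apply/trivIsetP => i j _ _; wlog ij : i j / (i < j)%N => [H ij|_].
      by move: (ij); rewrite neq_ltn => /orP[h|h];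
        [exact: H|rewrite setIC; apply: H => //; rewrite eq_sym].
    apply/seteqP; split => // x [[xi _] [_ xj]]; apply: xj.
    by apply: outer_le xi.
Qed.

(** Dominated convergence: the sets [outer k] exhaust the nonzero vectors. *)
Lemma cvg_outer_integral (g : E -> R) (C : R) :
  measurable_fun setT (g : BE -> R) -> (forall x, `|g x| <= C * min1 x)%R ->
  N.-integrable [set~ (0%R : E)] (fun x => (g x)%:E) /\
  \int[outer_measure k]_x (g x)%:E @[k --> \oo] -->
    \int[N]_(x in [set~ (0%R : E)]) (g x)%:E.
Proof.
move=> mg gC.
have mD0 := measurable_neq0.
have im : N.-integrable [set~ (0%R : E)] (fun x : BE => C%:E * (min1 x)%:E).
  apply: integrableZl => //; apply/integrableP; split.
    by apply: measurable_funTS; have [] := nonneg_meas_min1.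
  under eq_integral do rewrite gee0_abs ?lee_fin ?min1_ge0//.
  apply: le_lt_trans Nfin; apply: ge0_subset_integral => //; first by have [] := nonneg_meas_min1.
  by move=> x _; rewrite lee_fin min1_ge0.
have ig : N.-integrable [set~ (0%R : E)] (fun x : BE => (g x)%:E).
  apply: le_integrable im => //; first by apply: measurable_funTS; exact/measurable_EFinP.
  move=> x _; rewrite -EFinM !abse_EFin lee_fin.
  by apply: le_trans (gC x) (ler_norm _).
split => //.
pose gk k (x : BE) := ((fun x => (g x)%:E) \_ (outer k)) x.
have gE k : \int[outer_measure k]_x (g x)%:E = \int[N]_(x in [set~ (0%R : E)]) gk k x.
  rewrite integral_mrestr; last exact/measurable_EFinP.
  rewrite /gk -integral_mkcondr; congr (integral _ _ _).
  by apply/esym/setIidr => x; exact: outer_neq0.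
under eq_fun do rewrite gE.
have [] := @dominated_convergence _ BE R N _ mD0 gk (fun x => (g x)%:E)
  (fun x => C%:E * (min1 x)%:E) => //.
- move=> k; apply: measurable_funTS; rewrite /gk.
  apply/(measurable_restrictT _ (measurable_outer k)).
  by apply: measurable_funTS; exact/measurable_EFinP.
- by apply: measurable_funTS; exact/measurable_EFinP.
- apply: aeW => x x0; apply: cvg_near_cst.
  apply: filterS (near_outer x0) => k hk.
  by rewrite /gk /patch mem_set.
- apply: aeW => x k _; rewrite /gk /patch; case: ifP => _.
    by rewrite -EFinM abse_EFin lee_fin.
  by rewrite abse0 -EFinM lee_fin; apply: le_trans (gC x).
Qed.

Section characteristic_function_limit.
Variables (u : E -> R) (L : R).
Hypothesis uD : forall x y, (u (x + y) = u x + u y)%R.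
Hypothesis uL : lip L u.

Let u0 : u 0%R = 0%R. Proof. exact: additive0 uD. Qed.

Let min1_bound (v : R) (x : E) :
  (`|v| <= 2 -> `|v| <= `|L| * `|x| -> `|v| <= (2 + `|L|) * min1 x)%R.
Proof.
move=> v2 vL; rewrite /min1; have := normr_ge0 L; have := normr_ge0 x.
by case: (lerP 1%R `|x|%R) => h xx LL; nra.
Qed.

Let lipL x y : (`|u x - u y| <= `|L| * `|x - y|)%R.
Proof. by apply: le_trans (uL x y) _; rewrite ler_wpM2r// ler_norm. Qed.

Let cos_bound x : (`|cos (u x) - 1| <= (2 + `|L|) * min1 x)%R.
Proof.
apply: min1_bound.
- by have := cos_le1 (u x); have := cos_geN1 (u x); rewrite ler_norml; lra.
- have := cos_lip (u x) 0%R; rewrite cos0 => /le_trans; apply.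
  by have := lipL x 0%R; rewrite u0 !subr0.
Qed.

Let sin_bound x : (`|sin (u x)| <= (2 + `|L|) * min1 x)%R.
Proof.
apply: min1_bound.
- by have := sin_le1 (u x); have := sin_geN1 (u x); rewrite ler_norml; lra.
- have := sin_lip (u x) 0%R; rewrite sin0 subr0 => /le_trans; apply.
  by have := lipL x 0%R; rewrite u0 !subr0.
Qed.

Let mcos1 : measurable_fun setT ((fun x => cos (u x) - 1)%R : BE -> R).
Proof.
apply: measurable_funB; last exact: measurable_cst.
exact: lip_measurable (cos_u_lip uL).
Qed.

Lemma integrable_cos_levy :
  N.-integrable [set~ (0%R : E)] (fun x => (cos (u x) - 1)%:E).
Proof. by have [] := cvg_outer_integral mcos1 cos_bound. Qed.

Lemma integrable_sin_levy :
  N.-integrable [set~ (0%R : E)] (fun x => (sin (u x))%:E).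
Proof.
by have [] := cvg_outer_integral (lip_measurable (sin_u_lip uL)) sin_bound.
Qed.

Lemma weak_limit_char (mu : probability BE R) :
  weak_limit compound mu ->
  char_u u mu = cexp
    ((\int[N]_(x in [set~ (0%R : E)]) (cos (u x) - 1)%R)%R +i*
     (\int[N]_(x in [set~ (0%R : E)]) (sin (u x))%R)%R)%C.
Proof.
move=> lmu; have [hc hs] := weak_limit_trig uL lmu.
have [_ cc] := cvg_outer_integral mcos1 cos_bound.
have [_ cs] := cvg_outer_integral (lip_measurable (sin_u_lip uL)) sin_bound.
have mD0 : measurable ([set~ (0%R : E)] : set BE) by exact: measurable_neq0.
pose c := (\int[N]_(x in [set~ (0%R : E)]) (cos (u x) - 1)%R)%R.
pose s := (\int[N]_(x in [set~ (0%R : E)]) (sin (u x))%R)%R.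
have cE : \int[N]_(x in [set~ (0%R : E)]) (cos (u x) - 1)%:E = c%:E.
  by rewrite /c /Rintegral fineK//; apply: integrable_fin_num => //; exact: integrable_cos_levy.
have sE : \int[N]_(x in [set~ (0%R : E)]) (sin (u x))%:E = s%:E.
  by rewrite /s /Rintegral fineK//; apply: integrable_fin_num => //; exact: integrable_sin_levy.
pose ck k := (cos_int u (outer_measure k) - mass (outer_measure k))%R.
pose sk k := sin_int u (outer_measure k).
have ckc : ck k @[k --> \oo] --> c.
  move: cc; rewrite cE; under eq_fun => k.
    have -> : \int[outer_measure k]_x (cos (u x) - 1)%:E = (ck k)%:E.
      have := trig_integral uL (outer_measure k) (-1) 1 0.
      rewrite mulN1r mul1r mul0r addr0 addrC => <-.
      by apply: eq_integral => x _; rewrite mul1r mul0r addr0 addrC.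
    over.
  by move/fine_cvg.
have sks : sk k @[k --> \oo] --> s.
  move: cs; rewrite sE; under eq_fun => k.
    have -> : \int[outer_measure k]_x (sin (u x))%:E = (sk k)%:E.
      have := trig_integral uL (outer_measure k) 0 0 1.
      rewrite !mul0r mul1r !add0r => <-.
      by apply: eq_integral => x _; rewrite !mul0r mul1r !add0r.
    over.
  by move/fine_cvg.
have kE k : char_u u (cpoisson dq (outer_measure k)) = cexp (ck k +i* sk k)%C.
  exact: char_u_cpoisson uD uL _.
have eck : expR (ck k) @[k --> \oo] --> expR c.
  by apply: continuous_cvg => //; exact: continuous_expR.
rewrite /char_u /cexp /=; congr (_ +i* _)%C.
- apply: (cvg_unique _ hc) => //.
  rewrite (_ : (fun k => _) = (fun k => expR (ck k) * cos (sk k))%R); last first.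
    by apply/funext => k; have /(congr1 (@complex.Re R)) := kE k.
  apply: cvgM => //; apply: continuous_cvg => //; exact: continuous_cos.
- apply: (cvg_unique _ hs) => //.
  rewrite (_ : (fun k => _) = (fun k => expR (ck k) * sin (sk k))%R); last first.
    by apply/funext => k; have /(congr1 (@complex.Im R)) := kE k.
  apply: cvgM => //; apply: continuous_cvg => //; exact: continuous_sin.
Qed.

End characteristic_function_limit.

End one_levy_measure.
End levy_restrictions.

(** * The Levy-Khintchine representation without Gaussian part *)

Section levy_khintchine_existence.
Context {R : realType} {E : completeNormedModType R}.
Notation BE := (borel E).
Local Open Scope complex_scope.

Lemma dual_bounded (y : dual E) : exists2 L : R, 0 <= L &
  forall x, `|y x| <= L * `|x|.
Proof.
have /linear_boundedP hb : bounded_near y (nbhs (0 : E)).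
  apply: continuous_linear_bounded; exact: dual_continuous.
near (pinfty_nbhs R) => r; exists r => //.
by near: r.
Unshelve. all: by end_near. Qed.

Lemma dual_lip (y : dual E) (L : R) :
  (forall x, `|y x| <= L * `|x|) -> lip L (y : E -> R).
Proof. by move=> yL x z; rewrite -linearB. Qed.

Lemma dual_measurable (y : dual E) : measurable_fun setT (y : BE -> R).
Proof. have [L _ yL] := dual_bounded y; exact: lip_measurable (dual_lip yL). Qed.

Lemma lk_integrandE (y : dual E) (x : E) : lk_integrand y x =
  (cos (y x) - 1) +i* (sin (y x) - y x * \1_[set u : E | `|u| <= 1] x).
Proof.
rewrite /lk_integrand /cexp /= expR0 !mul1r.
rewrite -[LHS]/((cos (y x) - 1 - 0) +i* (sin (y x) - 0 - y x * _)).
by rewrite !subr0.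
Qed.

Lemma cintegralE (m : {measure set BE -> \bar R}) D (f : E -> R[i]) (g h : E -> R) :
  (forall x, f x = g x +i* h x) ->
  cintegral m D f = (\int[m]_(x in D) g x) +i* (\int[m]_(x in D) h x).
Proof.
by move=> fE; rewrite /cintegral; congr (_ +i* _); apply: eq_Rintegral => x _;
  rewrite fE.
Qed.

(** The covariance of the Dirac mass at 0. *)
Lemma gaussian_covariance0 : gaussian_covariance (fun _ : dual E => 0 : E).
Proof.
exists [the probability BE R of \d_(0 : BE)] => [y|y z].
  exists 0 => A mA; rewrite /centered_normal eqxx !diracE; congr ((nat_of_bool _)%:R%:E).
  by apply/idP/idP; rewrite !inE /= linear0.
rewrite integral_dirac//; last first.
  apply/measurable_EFinP; apply: measurable_funM; apply: dual_measurable.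
by rewrite diracT mul1e !linear0 mul0r.
Qed.

Variables (q : nat -> E) (dq : dense_seq q).
Variable N : {measure set BE -> \bar R}.
Hypothesis Nfin : (\int[N]_x (min1 x)%:E < +oo)%E.

Lemma infinitely_divisible_limit (mu : probability BE R) :
  weak_limit (compound dq Nfin) mu ->
  infinitely_divisible mu.
Proof.
move=> lmu n n0.
have inv0 : 0 <= n%:R^-1 :> R by rewrite invr_ge0.
pose B := [the {measure set BE -> \bar R} of mscale (NngNum inv0) N].
have Bfin : (\int[B]_x (min1 x)%:E < +oo)%E.
  have [mm mp] := @nonneg_meas_min1 R E.
  rewrite (ge0_integral_mscale N measurableT (NngNum inv0) mm)//.
  by rewrite lte_mul_pinfty// lee_fin.
have [nu lnu] := compound_weak_limit dq Bfin.
exists nu; apply: (weak_limit_infinitely_divisible dq _ lmu lnu) => k f mf.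
transitivity (conv_op (compound dq Nfin k) f 0).
  by apply: eq_integral => x _; rewrite add0r.
rewrite /compound; apply: (congr1 (fun F => F 0)); apply: cpoisson_natmul => // U mU.
rewrite /= /outer_measure /mrestr /B /= /mscale /= muleA -EFinM divff ?mul1e//.
by rewrite pnatr_eq0 -lt0n.
Qed.

(** Since x is integrable on the unit ball, the compensating term of the
integrand can be separated; its integral is y(a) and cancels against the shift. *)
Lemma levy_khintchine_limit (mu : probability BE R) :
  weak_limit (compound dq Nfin) mu ->
  exists a, lk_representation mu a (fun=> 0) N.
Proof.
move=> lmu.
pose B1 : set BE := [set u : E | `|u| <= 1].
pose D0 : set BE := [set~ (0 : E)].
have mD0 : measurable D0 by exact: measurable_neq0.
have mB1 : measurable B1.
  rewrite -[B1]setTI.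
  rewrite (_ : B1 = (fun x : BE => `|x : E|) @^-1` `]-oo, 1]%classic).
    exact: measurable_norm_borel.
  by apply/seteqP; split => x; rewrite /B1 /= in_itv.
have mD : measurable (D0 `&` B1) by exact: measurableI.
have Dfin : (\int[N]_(x in D0 `&` B1) `|x : E|%:E < +oo)%E.
  apply: le_lt_trans Nfin; apply: (@le_trans _ _ (\int[N]_(x in D0 `&` B1) (min1 x)%:E)%E).
    rewrite le_eqVlt; apply/orP; left; apply/eqP; apply: eq_integral => x.
    by rewrite inE => -[_ x1]; rewrite /min1 min_r.
  apply: ge0_subset_integral => //; first by have [] := @nonneg_meas_min1 R E.
  by move=> x _; rewrite lee_fin min1_ge0.
have [a ha] := vector_mean_exists dq mD Dfin.
exists a => y; have [L L0 yL] := dual_bounded y.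
have yD : forall x z, y (x + z) = (y x : R) + y z by move=> x z; rewrite linearD.
have yl := dual_lip yL.
have ic := integrable_cos_levy Nfin yD yl.
have is_ := integrable_sin_levy Nfin yD yl.
have iy : N.-integrable D0 (fun x : BE => (y x * \1_B1 x)%:E).
  have mg : measurable_fun setT ((fun x => y x * \1_B1 x) : BE -> R).
    apply: measurable_funM; first exact: dual_measurable.
    exact: measurable_indic.
  have gb x : `|y x * \1_B1 x| <= L * min1 x.
    rewrite indicE; have [|_] := boolP (x \in B1).
      rewrite inE /B1 /= => x1; rewrite mulr1 /min1 min_r//.
    by rewrite mulr0 normr0 mulr_ge0// min1_ge0.
  by have [] := cvg_outer_integral Nfin mg gb.
have iyE : (y a)%:E = (\int[N]_(x in D0) (y x * \1_B1 x)%:E)%E.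
  rewrite (ha y L yL) integral_mkcondr; apply: eq_integral => x _.
  rewrite /patch indicE; case: ifP => _; first by rewrite mulr1.
  by rewrite mulr0.
split.
  split.
    by under eq_fun do rewrite lk_integrandE /=.
  under eq_fun do rewrite lk_integrandE /= EFinB.
  exact: integrableB.
transitivity (char_u y mu).
  rewrite /char_fun /char_u; apply: cintegralE => x.
  by rewrite /cexp /= expR0 !mul1r.
rewrite (weak_limit_char yD yl lmu); congr cexp.
rewrite /lk_exponent (cintegralE _ _ (lk_integrandE y)).
rewrite -[RHS]/((_ + _) +i* (_ + _)); congr (_ +i* _).
  by rewrite linear0 mulr0 oppr0 add0r.
rewrite RintegralB// -/B1 -/D0; have -> : y a = \int[N]_(x in D0) (y x * \1_B1 x).
  by apply: EFin_inj; rewrite iyE /Rintegral fineK//; exact: integrable_fin_num.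
by rewrite addrC subrK.
Qed.

End levy_khintchine_existence.

Theorem levy_khintchine_exists (R : realType) (E : completeNormedModType R)
    (sepE : separable E) (N : {measure set (borel E) -> \bar R}) :
  (\int[N]_x (min1 x)%:E < +oo)%E ->
  exists mu a (Q : dual E -> E),
    [/\ infinitely_divisible mu, gaussian_covariance Q & lk_representation mu a Q N].
Proof.
move=> Nfin; have [q dq] := separable_dense_seq sepE.
have [mu lmu] := compound_weak_limit dq Nfin.
have [a ha] := levy_khintchine_limit lmu.
exists mu, a, (fun=> 0); split => //; first exact: infinitely_divisible_limit lmu.
exact: gaussian_covariance0.
Qed.

(** * Truncated moments *)

Section truncated_integrals.
Local Open Scope ereal_scope.
Context d (T : measurableType d) {R : realType}.
Variables (m : {measure set T -> \bar R}).

(** Otherwise the function is constantly +oo on a set of positive measure. *)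
Lemma integral_lty_ex (D : set T) (f : T -> \bar R) : measurable D ->
  m D != 0 -> (forall x, D x -> 0 <= f x) -> \int[m]_(x in D) f x < +oo ->
  exists2 x, D x & f x < +oo.
Proof.
move=> mD D0 f0 fD; apply: contrapT => nex; move: fD.
rewrite (_ : \int[m]_(x in D) f x = \int[m]_(x in D) (cst +oo) x); last first.
  apply: eq_integral => x /set_mem Dx.
  case E : (f x) => [r| |] //; last by have := f0 x Dx; rewrite E.
  by case: nex; exists x => //; rewrite E ltry.
by rewrite integral_cst// gt0_mulye ?ltxx// lt0e D0 measure_ge0.
Qed.

Variables (g : T -> R) (mg : measurable_fun setT g).

Let mlevel (a b : itv_bound R) : measurable [set x | g x \in Interval a b].
Proof.
rewrite (_ : [set _ | _] = g @^-1` [set` Interval a b])//.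
rewrite -[X in measurable X]setTI; apply: mg => //.
Qed.

Let mpos : measurable [set x | (0 < g x)%R].
Proof.
by have := mlevel (BRight 0%R) (BInfty _ false); congr measurable; apply/seteqP; split => x /=;
  rewrite in_itv /= ?andbT.
Qed.

Let mming c : measurable_fun setT (fun x => (Num.min 1 (c * g x))%:E).
Proof.
apply/measurable_EFinP; apply: measurable_minr; first exact: measurable_cst.
by apply: measurable_funM => //; exact: measurable_cst.
Qed.

(** The function min(1, c g) equals c g where g <= 1/c, and 1 beyond. *)
Lemma truncated_integral (c : R) : (0 < c)%R ->
  c%:E * \int[m]_(x in [set x | (0 < g x <= c^-1)%R]) (g x)%:E +
    m [set x | (c^-1 < g x)%R] =
  \int[m]_(x in [set x | (0 < g x)%R]) (Num.min 1 (c * g x))%:E.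
Proof.
move=> c0.
have m1 : measurable [set x | (0 < g x <= c^-1)%R].
  rewrite (_ : [set _ | _] = [set x | g x \in Interval (BRight 0%R) (BRight (c^-1)%R)]);
    first exact: mlevel.
  by apply/seteqP; split => x /=; rewrite in_itv /=.
have m2 : measurable [set x | (c^-1 < g x)%R].
  rewrite (_ : [set _ | _] = [set x | g x \in Interval (BRight (c^-1)%R) (BInfty _ false)]);
    first exact: mlevel.
  by apply/seteqP; split => x /=; rewrite in_itv /= andbT.
rewrite (_ : [set x | (0 < g x)%R] =
    [set x | (0 < g x <= c^-1)%R] `|` [set x | (c^-1 < g x)%R]); last first.
  apply/seteqP; split => x /=.
    by move=> gx; rewrite gx /=; case: (leP (g x) c^-1%R); [left|right].
  by move=> [/andP[]//|h]; rewrite (lt_trans _ h)// invr_gt0.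
rewrite ge0_integral_setU//; last 3 first.
- by apply: measurable_funTS; exact: mming.
- move=> x Ux; have gx : (0 <= g x)%R.
    case: Ux => /= [/andP[/ltW//]|/ltW]; apply: le_trans.
    by rewrite invr_ge0 ltW.
  by rewrite lee_fin le_min ler01 mulr_ge0// ltW.
- apply/disj_setPS => x /= [/andP[_ h]]; by rewrite ltNge h.
congr (_ + _).
  rewrite -ge0_integralZl_EFin//; last 3 first.
  - by move=> x /andP[/ltW gx _]; rewrite lee_fin.
  - by apply/measurable_EFinP; exact: measurable_funTS.
  - exact: ltW.
  apply: eq_integral => x /set_mem /= /andP[_ gx]; rewrite -EFinM min_r//.
  by rewrite -ler_pdivlMl// mulr1.
rewrite -[LHS]mul1e -integral_cst//; apply: eq_integral => x /set_mem /= gx.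
by rewrite min_l// -ler_pdivrMl// mulr1 ltW.
Qed.

(** With K = max(1, 1/c), min(1, g) <= K min(1, c g). *)
Lemma truncated_integral_rescale (c : R) : (0 < c)%R ->
  \int[m]_(x in [set x | (0 < g x)%R]) (Num.min 1 (c * g x))%:E < +oo ->
  \int[m]_(x in [set x | (0 < g x)%R]) (Num.min 1 (g x))%:E < +oo.
Proof.
move=> c0 fin; pose K := Num.max 1%R c^-1%R.
have K0 : (0 <= K)%R by rewrite le_max ler01.
have p0 a x : (0 < a)%R -> (0 < g x)%R -> 0 <= (Num.min 1 (a * g x))%:E.
  by move=> a0 gx; rewrite lee_fin le_min ler01 mulr_ge0// ltW.
apply: (@le_lt_trans _ _
    (K%:E * \int[m]_(x in [set x | (0 < g x)%R]) (Num.min 1 (c * g x))%:E)); last first.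
  by rewrite lte_mul_pinfty.
rewrite -ge0_integralZl_EFin//; last 2 first.
- by move=> x /= gx; exact: p0.
- by apply: measurable_funTS; exact: mming.
apply: ge0_le_integral => //.
- by move=> x /= gx; have := @p0 1%R x ltr01 gx; rewrite mul1r.
- apply: measurable_funTS; have := mming 1; congr (measurable_fun _ _).
  by apply/funext => x; rewrite mul1r.
- by apply: measurable_funeM; apply: measurable_funTS; exact: mming.
move=> x /= gx; rewrite -EFinM lee_fin.
have K1 : (1 <= K)%R by rewrite le_max lexx.
have Kc : (1 <= K * c)%R by rewrite -ler_pdivrMr// mul1r le_max lexx orbT.
case: (lerP 1%R (c * g x)) => h; first by rewrite mulr1 ge_min K1.
by rewrite ge_min mulrA ler_peMl ?orbT// ltW.
Qed.

End truncated_integrals.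

Section sigma_finite_restriction.
Local Open Scope ereal_scope.
Context d (T : measurableType d) {R : realType}.
Variables (N : {measure set T -> \bar R}) (D : set T) (mD : measurable D).
Variables (h : T -> R) (mh : measurable_fun setT h).
Hypothesis h_gt0 : forall x, D x -> (0 < h x)%R.
Hypothesis h_fin : \int[N]_(x in D) (h x)%:E < +oo.

Let level k := [set x | (1 < k%:R * h x)%R].

Let mlevel k : measurable (level k).
Proof.
have mk : measurable_fun setT (fun x => k%:R * h x)%R.
  by apply: measurable_funM => //; exact: measurable_cst.
rewrite (_ : level k = (fun x => (k%:R * h x)%R) @^-1` `]1%R, +oo[%classic).
  by rewrite -[X in measurable X]setTI; exact: mk.
by apply/seteqP; split => x; rewrite /level /= in_itv /= andbT.
Qed.

Let restr := mrestr N mD.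
HB.instance Definition _ := Measure.copy restr (mrestr N mD).

Let restr_sigma_finite : sigma_finite setT restr.
Proof.
exists (fun k => level k `|` ~` D).
  apply/esym/seteqP; split => // x _.
  have [Dx|] := pselect (D x); last by exists 0%N => //; right.
  have [k kx] : exists k, level k x.
    near \oo => k; exists k.
    rewrite /level /= -ltr_pdivrMr ?h_gt0//.
    by near: k; exact: nbhs_infty_gtr.
  by exists k => //; left.
move=> k; split; first by apply: measurableU => //; exact: measurableC.
rewrite /restr /mrestr setIUl setICl setU0.
apply: (@le_lt_trans _ _ (\int[N]_(x in D) (k%:R%:E * (h x)%:E))); last first.
  rewrite ge0_integralZl_EFin//; last 2 first.
  - by move=> x Dx; rewrite lee_fin ltW// h_gt0.
  - by apply: measurable_funTS; exact/measurable_EFinP.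
  by rewrite lte_mul_pinfty// lee_fin.
rewrite -[leLHS]mul1e -integral_cst//; last exact: measurableI.
have mkh : measurable_fun setT (fun x => k%:R%:E * (h x)%:E).
  by apply: measurable_funeM; exact/measurable_EFinP.
apply: (@le_trans _ _ (\int[N]_(x in level k `&` D) (k%:R%:E * (h x)%:E))).
  apply: ge0_le_integral => //.
  - exact: measurableI.
  - exact: measurable_funTS.
  - by move=> x [/ltW xk _]; rewrite -EFinM lee_fin.
apply: ge0_subset_integral => //.
- exact: measurableI.
- exact: measurable_funTS.
- by move=> x Dx; rewrite -EFinM lee_fin mulr_ge0// ltW// h_gt0.
Unshelve. all: by end_near. Qed.

HB.instance Definition _ :=
  Measure_isSigmaFinite.Build _ _ _ restr restr_sigma_finite.

(** The sets where h > 1/k have finite measure in D and exhaust it. *)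
Lemma sigma_finite_restriction :
  exists N' : {sigma_finite_measure set T -> \bar R},
  forall f, measurable_fun setT f -> (forall x, 0 <= f x) ->
    \int[N']_x f x = \int[N]_(x in D) f x.
Proof.
exists [the {sigma_finite_measure set T -> \bar R} of restr] => f mf f0.
exact: ge0_integral_mrestr.
Qed.

End sigma_finite_restriction.

(** * The three spectral measures *)

Section spectral_measures.
Local Open Scope ereal_scope.
Context {R : realType} {E : completeNormedModType R}.
Hypothesis sepE : separable E.
Notation BE := (borel E).

Lemma levy_spectral_min1 (m : set E -> \bar R) (N : {measure set BE -> \bar R}) :
  N [set 0%R] = 0 ->
  (forall A : set BE, measurable A -> ~ A (0%R : E) -> N A = m A) ->
  \int[N]_x (min1 x)%:E < +oo -> levy_spectral m.
Proof.
by move=> N0 Nm Nfin; exists N; split => //; exact: levy_khintchine_exists.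
Qed.

Lemma levy_spectral_restriction (M : {measure set BE -> \bar R}) :
  \int[M]_(x in [set~ (0%R : E)]) (min1 x)%:E < +oo -> levy_spectral M.
Proof.
move=> Mfin.
apply: (@levy_spectral_min1 _
  [the {measure set BE -> \bar R} of mrestr M (@measurable_neq0 R E)]).
- by rewrite /= /mrestr setICr measure0.
- move=> A mA A0; rewrite /= /mrestr; congr (M _); apply/setIidl => x Ax x0.
  by apply: A0; rewrite -x0.
- by have [m1 m2] := @nonneg_meas_min1 R E; rewrite ge0_integral_mrestr.
Qed.

Lemma measurable_scale : measurable_fun setT
  ((fun z : R * E => z.1 *: z.2)%R : (R * BE)%type -> BE).
Proof.
have [q dq] := separable_dense_seq sepE; have [r dr] := separable_dense_seq (@separable_real R).
apply: (@measurable_continuous2 R _ (R * BE)%type R^o E E r q q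
  (fun (t : R^o) (x : E) => (t *: x)%R) fst snd dr dq dq).
- by move=> z; apply: (@scale_continuous R E).
- exact: (measurableT_comp (@measurable_id_borel_real R) measurable_fst).
- exact: measurable_snd.
Qed.

(** The image, under scaling, of the product of the restrictions of the two
measures off the origin, which are sigma-finite. *)
Lemma mixture_measure_exists (lam : {measure set R -> \bar R})
    (M : {measure set BE -> \bar R}) :
  \int[lam]_(t in `]0%R, +oo[) (Num.min 1 t)%:E < +oo ->
  \int[M]_(x in [set~ (0%R : E)]) (min1 x)%:E < +oo ->
  exists N : {measure set BE -> \bar R}, forall f : BE -> \bar R,
    measurable_fun setT f -> (forall x, 0 <= f x) ->
    \int[N]_x f x = \int[lam]_(t in `]0%R, +oo[)
      \int[M]_(x in [set~ (0%R : E)]) f (t *: (x : E))%R.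
Proof.
move=> lfin Mfin.
have [lam' lamE] : exists l : {sigma_finite_measure set R -> \bar R},
    forall f, measurable_fun setT f -> (forall x, 0 <= f x) ->
    \int[l]_x f x = \int[lam]_(x in `]0%R, +oo[) f x.
  apply: (@sigma_finite_restriction _ _ _ lam `]0%R, +oo[%classic _
    (fun t => Num.min 1%R t)) => //.
    by apply: measurable_minr; [exact: measurable_cst|exact: measurable_id].
  by move=> t /=; rewrite in_itv /= andbT lt_min ltr01.
have [M' ME] : exists m : {sigma_finite_measure set BE -> \bar R},
    forall f, measurable_fun setT f -> (forall x, 0 <= f x) ->
    \int[m]_x f x = \int[M]_(x in [set~ (0%R : E)]) f x.
  apply: (@sigma_finite_restriction _ _ _ M _ measurable_neq0 (@min1 R E)) => //.
    exact: measurable_min1.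
  by move=> x /eqP x0; rewrite /min1 lt_min ltr01 normr_gt0.
exists [the {measure set BE -> \bar R} of
  image_measure measurable_scale (lam' \x M')] => f mf f0.
have mfs := measurableT_comp mf measurable_scale.
have fs0 z : 0 <= (f \o (fun z : R * E => z.1 *: z.2)%R) z by exact: f0.
rewrite ge0_integral_image// (@fubini_tonelli1 _ _ _ _ _ lam' M' _ mfs fs0).
rewrite lamE//; last 2 first.
- exact: measurable_fun_fubini_tonelli_F.
- by move=> t; apply: integral_ge0.
apply: eq_integral => t _; rewrite /fubini_F ME//.
exact: (measurableT_comp mfs (measurable_pair1 t)).
Qed.

Lemma levy_spectral_mixture (lam : {measure set R -> \bar R})
    (M : {measure set BE -> \bar R}) :
  \int[lam]_(t in `]0%R, +oo[) (Num.min 1 t)%:E < +oo ->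
  \int[M]_(x in [set~ (0%R : E)]) (min1 x)%:E < +oo ->
  \int[lam]_(t in `]0%R, +oo[)
    \int[M]_(x in [set~ (0%R : E)]) (Num.min 1 (t * `|x : E|))%:E < +oo ->
  levy_spectral (mixture lam M).
Proof.
move=> lfin Mfin fin; have [N NE] := mixture_measure_exists lfin Mfin.
have NA (A : set BE) : measurable A -> N A = mixture lam M A.
  move=> mA; rewrite -[A in LHS]setIT -(integral_indic N measurableT mA) NE//.
  by apply/measurable_EFinP; exact: measurable_indic.
apply: (@levy_spectral_min1 _ N) => [|A mA _|].
- have m0 : measurable ([set 0%R : E] : set BE).
    by rewrite -[X in measurable X]setCK; apply: measurableC; exact: measurable_neq0.
  rewrite NA// /mixture; apply: integral0_eq => t.
  rewrite /= in_itv /= andbT => t0; apply: integral0_eq => x /eqP x0.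
  rewrite indicE memNset//= => /eqP; rewrite scaler_eq0 (negbTE x0) orbF.
  by rewrite gt_eqF.
- exact: NA.
- have [m1 m2] := @nonneg_meas_min1 R E; rewrite NE//.
  apply: le_lt_trans fin; rewrite le_eqVlt; apply/orP; left; apply/eqP.
  apply: eq_integral => t /set_mem; rewrite /= in_itv /= andbT => t0.
  by apply: eq_integral => x _; rewrite /min1 normrZ gtr0_norm.
Qed.

End spectral_measures.

Lemma levy_spectral_pos_min (R : realType) (lam : {measure set R -> \bar R}) :
  lam `]-oo, 0%R]%classic = 0%E ->
  (\int[lam]_(t in `]0%R, +oo[) (Num.min 1 t)%:E < +oo)%E ->
  levy_spectral_pos lam.
Proof.
move=> lam0 lfin.
have mpos : measurable (`]0%R, +oo[%classic : set R) by [].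
split => //.
- pose N : {measure set (borel R^o) -> \bar R} :=
    [the {measure set _ -> \bar R} of
      image_measure (@measurable_id_borel_real R) (mrestr lam mpos)].
  apply: (@levy_spectral_min1 R R^o (@separable_real R) lam N).
  + rewrite /N /= /image_measure /pushforward /mrestr.
    rewrite (_ : _ `&` _ = set0) ?measure0//.
    apply/seteqP; split => // t [/= ->].
    by rewrite in_itv /= ltxx.
  + move=> A mA A0; rewrite /N /= /image_measure /pushforward /mrestr.
    have mA' : measurable (A : set R).
      by rewrite -[A]setTI; exact: measurable_id_borel_real.
    rewrite -[in RHS](setIT A) -(setUv (`]0%R, +oo[%classic : set R)) setIUr measureU//.
    - rewrite [X in (_ + X)%E](_ : _ = 0%E) ?adde0//.
      apply/eqP; rewrite -measure_le0 -lam0; apply: le_measure; rewrite ?inE//.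
        by apply: measurableI => //; exact: measurableC.
      move=> t [_ /= ]; rewrite !in_itv /= andbT => /negP; by rewrite -leNgt.
    - exact: measurableI.
    - by apply: measurableI => //; exact: measurableC.
    - by apply/seteqP; split => // t [[_ ?] [_]].
  + have [m1 m2] := @nonneg_meas_min1 R R^o.
    rewrite ge0_integral_image//.
    rewrite (@ge0_integral_mrestr _ _ _ lam _ mpos (fun t => (min1 (t : R^o))%:E))//.
    * apply: le_lt_trans lfin; rewrite le_eqVlt; apply/orP; left; apply/eqP.
      apply: eq_integral => t /set_mem; rewrite /= in_itv /= andbT => t0.
      by rewrite /min1 gtr0_norm.
    * exact: (measurableT_comp m1 (@measurable_id_borel_real R)).
- apply: le_lt_trans lfin; apply: ge0_le_integral => //.
  + by move=> t _; rewrite lee_fin le_min ler01 sqr_ge0.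
  + apply: measurable_funTS; apply/measurable_EFinP; apply: measurable_minr => //.
  + by apply: measurable_funTS; apply/measurable_EFinP; apply: measurable_minr.
  move=> t; rewrite /= in_itv /= andbT => t0; rewrite lee_fin.
  case: (lerP 1 t) => h; first by rewrite ge_min lexx.
  by rewrite ge_min expr2 ler_piMl ?orbT// ltW.
Qed.

Theorem proposition1 (R : realType) (E : completeNormedModType R)
    (sepE : separable E)
    (lam : {measure set R -> \bar R})
    (M : {measure set (borel E) -> \bar R})
    (lam_pos : lam `]-oo, 0]%classic = 0%E)
    (M_zero : M [set (0 : E)] = 0%E)
    (lam_neq0 : lam [set: R] <> 0%E)
    (M_neq0 : M [set: E] <> 0%E)
    (integrals_eq :
      (\int[M]_(x in [set~ (0%R : E)])
         (`|x : E|%:E * (\int[lam]_(t in `]0%R, (`|x : E|^-1)%R]) t%:E)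
          + lam [set s : R | (`|x : E|^-1 < s)%R])
       = \int[lam]_(t in `]0%R, +oo[)
         (t%:E * (\int[M]_(x in [set u : E | (0 < `|u| <= t^-1)%R]) `|x : E|%:E)
          + M [set u : E | (t^-1 < `|u|)%R]))%E)
    (integrals_fin :
      (\int[lam]_(t in `]0%R, +oo[)
         (t%:E * (\int[M]_(x in [set u : E | (0 < `|u| <= t^-1)%R]) `|x : E|%:E)
          + M [set u : E | (t^-1 < `|u|)%R]) < +oo)%E) :
  [/\ levy_spectral (mixture lam M), levy_spectral M & levy_spectral_pos lam].
Proof.
have posE : `]0%R, +oo[%classic = [set t : R | 0 < t].
  by apply/seteqP; split => t; rewrite /= in_itv /= andbT.
have neq0E : [set~ (0 : E)] = [set x : E | 0 < `|x|].
  by apply/seteqP; split => x /=; rewrite normr_gt0 => /eqP.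
have mpos : measurable (`]0%R, +oo[%classic : set R) by [].
have mneq0 := @measurable_neq0 R E.
have mid : measurable_fun setT (id : R -> R) by exact: measurable_id.
have mnorm := @measurable_norm_borel R E.
have innerM (t : R) : 0 < t ->
    (t%:E * (\int[M]_(x in [set u : E | (0 < `|u| <= t^-1)%R]) `|x : E|%:E)
       + M [set u : E | (t^-1 < `|u|)%R] =
     \int[M]_(x in [set~ (0%R : E)]) (Num.min 1 (t * `|x : E|))%:E)%E.
  by move=> t0; rewrite neq0E; exact: (truncated_integral M mnorm t0).
have innerL (x : E) : x <> 0 ->
    (`|x|%:E * (\int[lam]_(t in `]0%R, (`|x|^-1)%R]) t%:E)
       + lam [set s : R | (`|x|^-1 < s)%R] =
     \int[lam]_(t in `]0%R, +oo[) (Num.min 1 (`|x| * t))%:E)%E.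
  move=> /eqP x0; rewrite posE.
  rewrite (_ : `]0%R, (`|x|^-1)%R]%classic = [set t | 0 < t <= `|x|^-1]); last first.
    by apply/seteqP; split => t; rewrite /= in_itv.
  by apply: (truncated_integral lam mid); rewrite normr_gt0.
have eqM : (\int[lam]_(t in `]0%R, +oo[)
      (t%:E * (\int[M]_(x in [set u : E | (0 < `|u| <= t^-1)%R]) `|x : E|%:E)
       + M [set u : E | (t^-1 < `|u|)%R]) =
    \int[lam]_(t in `]0%R, +oo[)
      \int[M]_(x in [set~ (0%R : E)]) (Num.min 1 (t * `|x : E|))%:E)%E.
  apply: eq_integral => t /set_mem; rewrite /= in_itv /= andbT => t0.
  exact: innerM.
have finM := integrals_fin; rewrite eqM in finM.
have finL := integrals_fin; rewrite -integrals_eq in finL.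
have lam_neq : lam `]0%R, +oo[%classic != 0%E.
  apply/eqP => lam0; apply: lam_neq0.
  rewrite (_ : setT = `]-oo, 0%R] `|` `]0%R, +oo[)%classic; last first.
    apply/seteqP; split => // t _ /=; rewrite !in_itv /= andbT.
    by case: (leP t 0); [left|right].
  rewrite measureU//.
    by rewrite -[RHS]adde0; congr (_ + _)%E; [exact: lam_pos|exact: lam0].
  apply/seteqP; split => // t []/=; rewrite !in_itv /= andbT => h.
  by rewrite ltNge h.
have M_neq : M [set~ (0 : E)] != 0%E.
  apply/eqP => M0; apply: M_neq0.
  have m0 : measurable ([set 0%R : E] : set (borel E)).
    by rewrite -[X in measurable X]setCK; exact: measurableC.
  rewrite -(setUv ([set 0%R : E] : set (borel E))) measureU//.
    by rewrite -[RHS]adde0; congr (_ + _)%E; [exact: M_zero|exact: M0].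
  by rewrite setICr.
have Mfin : (\int[M]_(x in [set~ (0%R : E)]) (min1 x)%:E < +oo)%E.
  have [|t t0 tfin] := integral_lty_ex mpos lam_neq _ finM.
    move=> t; rewrite /= in_itv /= andbT => t0; apply: integral_ge0 => x _.
    by rewrite lee_fin le_min ler01 mulr_ge0// ltW.
  rewrite neq0E in tfin *.
  apply: (truncated_integral_rescale mnorm _ tfin).
  by move: t0; rewrite /= in_itv /= andbT.
have lfin : (\int[lam]_(t in `]0%R, +oo[) (Num.min 1 t)%:E < +oo)%E.
  have [|x x0 xfin] := integral_lty_ex mneq0 M_neq _ finL.
    move=> x x0; rewrite innerL//; apply: integral_ge0 => t.
    rewrite /= in_itv /= andbT => t0.
    by rewrite lee_fin le_min ler01 mulr_ge0// ltW.
  rewrite innerL// posE in xfin; rewrite posE.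
  by apply: (truncated_integral_rescale mid _ xfin); rewrite normr_gt0; exact/eqP.
split.
- exact: levy_spectral_mixture.
- exact: levy_spectral_restriction.
- exact: levy_spectral_pos_min.
Qed.
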